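(* Let $H\in C(\mathbb R\times\mathbb R)$ be $\mathbb Z$-periodic in $x$, and convex and superlinear in $p$. Let $V\in C_c(\mathbb R)$ and $G(x,p):=H(x,p)-V(x)$. For $\lambda>0$ let $u^\lambda_G$ be the unique bounded viscosity solution of $\lambda u+G(x,u')=c(G)$ in $\mathbb R$. If $c(G)=c(H)=c_f(H)$, assume in addition condition (U) stated in the context. Then the limit $u^0_G:=\lim_{\lambda\to0^+}u^\lambda_G$ (locally uniform in $\mathbb R$) is characterized as follows. (I) If $c(G)>c(H)$, then $c(G)=c_f(G)$ and $$u^0_G(x)=\sup_{v\in\mathfrak S_{b-}(G)}v(x),\qquad x\in\mathbb R.$$ Furthermore, $u^0_G$ is coercive on $\mathbb R$, i.e. $u^0_G(x)\to+\infty$ as $|x|\to+\infty$. (II) If $c(G)=c(H)>c_f(H)$ (with $V\not\equiv0$), then: (A) if $\int_0^1p^+_H(x)\,dx=0$, then for every $x\in\mathbb R$ $$u^0_G(x)=\sup\{v(x):\ v\in\mathfrak S_{b-}(G),\ v\le u^0_H\text{ in }(-\infty,\underline y_V)\},\qquad \underline y_V:=\min(\operatorname{supp}V);$$ (B) if $\int_0^1p^-_H(x)\,dx=0$, then for every $x\in\mathbb R$ $$u^0_G(x)=\sup\{v(x):\ v\in\mathfrak S_{b-}(G),\ v\le u^0_H\text{ in }(\overline y_V,+\infty)\},\qquad \overline y_V:=\max(\operatorname{supp}V).$$ In either case, $u^0_G$ is bounded on $\mathbb R$. (III) If $c(G)=c(H)=c_f(H)$, then $c(G)=c_f(G)$ and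 $$u^0_G(x)=\sup_{v\in\mathfrak S_{b-}(G)}v(x),\qquad x\in\mathbb R.$$ Furthermore, $u^0_G$ is bounded on $\mathbb R$.
   Context: Solutions and subsolutions are continuous and understood in the viscosity sense. Superlinear in $p$ means $H(x,p)/|p|\to+\infty$ as $|p|\to+\infty$ (uniformly in $x$, by periodicity). For a Hamiltonian $F\in C(\mathbb R\times\mathbb R)$ define $$c(F):=\inf\{a\in\mathbb R:\ F(x,u')=a \text{ in }\mathbb R\text{ admits a bounded viscosity subsolution}\},$$ $$c_f(F):=\min\{a\in\mathbb R:\ F(x,u')=a \text{ in }\mathbb R\text{ admits a (possibly unbounded) viscosity subsolution}\}.$$ Mather measures: let $L_G(x,q):=\sup_{p\in\mathbb R}\{pq-G(x,p)\}$. A Borel probability measure $\tilde\mu$ on $\mathbb R\times\mathbb R$ is closed if $\int|q|\,d\tilde\mu(x,q)<+\infty$ and $\int\varphi'(x)\,q\,d\tilde\mu(x,q)=0$ for every bounded Lipschitz $\varphi\in C^1(\mathbb R)$. One has $\min\int L_G\,d\tilde\mu=-c_f(G)$, the minimum being over closed probability measures $\tilde\mu$ on $\mathbb R\times\mathbb R$; minimizers are called Mather measures for $G$ and their set is denoted $\tilde{\mathfrak M}(G)$. $\mathfrak S_{b-}(G)$ is the family of bounded viscosity subsolutions $v:\mathbb R\to\mathbb R$ of $G(x,u')=c(G)$ in $\mathbb R$ such that, if $c(G)=c_f(G)$, $$\int_{\mathbb R\times\mathbb R}v(y)\,d\tilde\mu(y,q)\le0\qquad\text{for every }\tilde\mu\in\tilde{\mathfrak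 M}(G);$$ if $c(G)>c_f(G)$ no integral constraint is imposed. $u^0_H$ denotes the uniform limit on $\mathbb R$, as $\lambda\to0^+$, of the unique bounded viscosity solutions $u^\lambda_H$ of $\lambda u+H(x,u')=c(H)$ in $\mathbb R$ (this limit is known to exist; it is $\mathbb Z$-periodic). Moreover $$p^-_H(x):=\min\{p\in\mathbb R:H(x,p)\le c(H)\},\qquad p^+_H(x):=\max\{p\in\mathbb R:H(x,p)\le c(H)\}.$$ Let $\mathcal E(H):=\{y\in\mathbb R:\ \min_{p\in\mathbb R}H(y,p)=c_f(H)\}$. Condition (U) (used only when $c(G)=c(H)=c_f(H)$): for all $x\in\mathbb R$, $$u^0_H(x)=\sup\{v(x):\ v\text{ is a }\mathbb Z\text{-periodic viscosity subsolution of }H(x,u')=c(H)\text{ in }\mathbb R\text{ with }v\le0\text{ on }\mathcal E(H)\}.$$ *)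

(* Defs.v *)
From HB Require Import structures.
From mathcomp Require Import all_boot all_order all_algebra.
From mathcomp Require Import all_classical all_reals all_analysis.

Set Implicit Arguments.
Unset Strict Implicit.
Unset Printing Implicit Defensive.

Import Order.TTheory GRing.Theory Num.Theory.
Import numFieldNormedType.Exports.

Local Open Scope classical_set_scope.
Local Open Scope ring_scope.

Definition C1 (R : realType) (f : R -> R) : Prop :=
  (forall x, derivable f x 1) /\ continuous (derive1 f).

Section Viscosity.
Variable R : realType.
Implicit Types (E : R -> R -> R -> R) (F : R -> R -> R) (u v : R -> R).

(** Viscosity (sub/super)solutions of [E(x, u, u') = 0] on the whole line. *)
Definition visc_sub E u : Prop :=
  continuous u /\
  forall (phi : R -> R) (x : R), C1 phi ->
    (\forall y \near x, u y - phi y <= u x - phi x) ->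
    E x (u x) (derive1 phi x) <= 0.

Definition visc_super E u : Prop :=
  continuous u /\
  forall (phi : R -> R) (x : R), C1 phi ->
    (\forall y \near x, u x - phi x <= u y - phi y) ->
    0 <= E x (u x) (derive1 phi x).

Definition visc_sol E u : Prop := visc_sub E u /\ visc_super E u.

Definition stationary F (a : R) : R -> R -> R -> R := fun x _ p => F x p - a.

Definition discounted F (lam a : R) : R -> R -> R -> R :=
  fun x r p => lam * r + F x p - a.

(** Real-valued infima: for the Hamiltonians considered here (superlinear,
    with [F(., 0)] bounded above) the sets below are nonempty and bounded
    from below, and the second infimum is attained. *)
Definition c_bounded F : R :=
  inf [set a | exists u, bounded_fun u /\ visc_sub (stationary F a) u].

Definition c_free F : R :=
  inf [set a | exists u, visc_sub (stationary F a) u].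

(** [w lam] is the (unique) bounded solution of [lam u + F(x,u') = c(F)]; the values
    [w lam] for [lam <= 0] are irrelevant. *)
Definition discounted_family F (w : R -> R -> R) : Prop :=
  forall lam, 0 < lam ->
    bounded_fun (w lam) /\ visc_sol (discounted F lam (c_bounded F)) (w lam).

End Viscosity.

Section Mather.
Variable R : realType.
Implicit Types (G : R -> R -> R) (v : R -> R).

(** The product sigma-algebra of the Borel sets of [R] is the Borel
    sigma-algebra of the plane. *)
Local Notation phase := (measurableTypeR R * measurableTypeR R)%type.

Definition lagrangian G (x q : R) : \bar R :=
  ereal_sup [set (p * q - G x p)%:E | p in [set: R]].

Definition closed_measure (mu : probability phase R) : Prop :=
  (\int[mu]_z (`|z.2|)%:E < +oo)%E /\
  forall phi : R -> R, C1 phi -> bounded_fun phi -> lipschitz phi ->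
    (\int[mu]_z (derive1 phi z.1 * z.2)%:E = 0)%E.

Definition mather_measure G (mu : probability phase R) : Prop :=
  closed_measure mu /\
  forall nu : probability phase R, closed_measure nu ->
    (\int[mu]_z lagrangian G z.1 z.2 <= \int[nu]_z lagrangian G z.1 z.2)%E.

Definition Sb_minus G : set (R -> R) :=
  [set v | [/\ bounded_fun v,
     visc_sub (stationary G (c_bounded G)) v &
     c_bounded G = c_free G ->
     forall mu : probability phase R, mather_measure G mu ->
       (\int[mu]_z (v z.1)%:E <= 0)%E]].

End Mather.

Section Hamiltonian.
Variable R : realType.
Implicit Types (H : R -> R -> R) (V u v : R -> R) (S : set (R -> R)).

Definition superlinear H : Prop :=
  forall M : R, exists K : R, 0 < K /\
    forall x p : R, K <= `|p| -> M <= H x p / `|p|.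

Definition admissible H : Prop :=
  [/\ continuous (fun z : R * R => H z.1 z.2),
      (forall p, periodic (H ^~ p) 1),
      (forall x, convex_function [set: R^o] (H x)) &
      superlinear H].

Definition supp V : set R := closure [set x | V x != 0].

Definition sub_potential H V : R -> R -> R := fun x p => H x p - V x.

(** The sublevel sets of [H(x,.)] at height [c(H)] are nonempty and compact, so
    these are the minimum and the maximum. *)
Definition p_minus H (x : R) : R := inf [set p | H x p <= c_bounded H].
Definition p_plus H (x : R) : R := sup [set p | H x p <= c_bounded H].

(** [u] is the pointwise supremum of [S]; taking the supremum in [\bar R] makes
    the nonemptiness and pointwise boundedness of [S] part of the equation. *)
Definition is_pointwise_sup u S : Prop :=
  forall x, (u x)%:E = ereal_sup [set (v x)%:E | v in S].

Definition E_set H : set R := [set y | inf (range (H y)) = c_free H].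

Definition condU H u : Prop :=
  is_pointwise_sup u
    [set v | [/\ periodic v 1, visc_sub (stationary H (c_bounded H)) v &
                 forall y, E_set H y -> v y <= 0]].

End Hamiltonian.

(* Main.v *)
(** Everything rests on one-dimensional slopes: for a convex coercive Hamiltonian a continuous
    function [u] is a viscosity subsolution of [G(x,u') = f(x)] exactly when difference quotients
    of [u] near [x] asymptotically lie in the sublevel set [G(x,.) <= f(x)].  In this form
    subsolutions may be translated, glued, truncated, averaged and passed to upper limits, and
    averaging over [[x,x+h]] turns them into C^1 approximate subsolutions, which makes the
    comparison principle immediate.

    A closed measure on the non-periodic line satisfies [int p(x) q = 0] for every bounded
    continuous [p], so when [c(G) = c_f(G)] the Mather measures are carried by the set
    where [min_p G(x,p) = c(G)]; as Dirac masses at its points are Mather measures, the integral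
    constraint becomes [v <= 0] on that set.

    Let [u*] be the upper limit of [u_G^lam].  It is a subsolution, and [u* <= 0] on that set.  For
    the matching lower bound on a candidate [v], one perturbs [v] on a compact interval by a
    subsolution of [G(x,u') = min_p G(x,p)], which creates room for the discount term, and
    continues it outside by discounted subsolutions of [H]: a subcritical one in case (I); shifted
    [u_H^lam] in case (III), where condition (U) gives [v <= u_H^0] up to epsilon at points of both
    ends; in case (II,A), [u_H^lam] on the left and on the right a function which descends with
    slope strictly below [p^+].  In case (II,A) this right-hand continuation, attached to
    [u_G^lam] itself, also yields [u_G^lam <= u_H^lam] to the left of the support of [V]. *)

Require Import Defs.
From mathcomp Require Import all_boot all_order all_algebra.
From mathcomp Require Import all_classical all_reals all_analysis.
From mathcomp Require Import measurable_realfun ring lra.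

Set Implicit Arguments.
Unset Strict Implicit.
Unset Printing Implicit Defensive.

Import Order.TTheory GRing.Theory Num.Theory.
Import numFieldNormedType.Exports.

Local Open Scope classical_set_scope.
Local Open Scope ring_scope.

(** * Epsilon-delta forms of continuity, extrema on segments, derivatives *)

Section EpsilonDelta.
Variable R : realType.
Implicit Types (f g u v : R -> R) (a b c d e x y z : R).

(** The limit exists because each candidate [v] bounds the lower limit of the family from below,
    while at every point the upper limit is the value of some candidate. Where the upper limit is
    bounded it is itself a candidate; in case (I) it is coercive and has to be truncated. Case (II)
    claims convergence although neither integral is assumed to vanish. If [p^+] had positive mean
    and [p^-] negative mean, the convex combination of mean zero would have a periodic primitive at
    a level strictly below [c(H)], against the definition of [c(H)]; so one of the two means is
    zero, and [p^+] or [p^-] integrates to a periodic critical subsolution. The second obstacle in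
    (II) is the upper bound: there may be no point with [min_p G = c(G)] at which [u_G^lam <= 0] is
    automatic. Instead, where [u_G^lam] is large, its increment over a period is strictly smaller
    than that of the periodic primitive, so it grows along translates to the left, which contradicts
    its boundedness. *)

Lemma cont_atP f x : {for x, continuous f} <->
  forall e, 0 < e -> exists2 d : R, 0 < d & forall y, `|y - x| < d -> `|f y - f x| < e.
Proof.
split=> [cf e e0|cf].
  have /cvgrPdistC_lt/(_ _ e0) /nbhs_ballP[d /= d0 dP] := cf.
  by exists d => // y yx; apply: dP; rewrite /ball /= distrC.
apply/cvgrPdistC_lt => e e0; have [d d0 dP] := cf _ e0.
by apply/nbhs_ballP; exists d => //= y; rewrite /ball /= distrC => /dP.
Qed.

Lemma contP f : continuous f <->
  forall x e, 0 < e -> exists2 d : R, 0 < d & forall y, `|y - x| < d -> `|f y - f x| < e.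
Proof. by split=> cf x; apply/cont_atP; apply: cf. Qed.

Lemma nearP (P : R -> Prop) x : (\forall y \near x, P y) <->
  exists2 d : R, 0 < d & forall y, `|y - x| < d -> P y.
Proof.
split=> [/nbhs_ballP[d /= d0 dP]|[d d0 dP]].
  by exists d => // y yx; apply: dP; rewrite /ball /= distrC.
by apply/nbhs_ballP; exists d => //= y; rewrite /ball /= distrC => /dP.
Qed.

Lemma near0P (P : R -> Prop) : (\forall y \near 0^'+, P y) <->
  exists2 d : R, 0 < d & forall y, 0 < y -> y < d -> P y.
Proof.
split=> [/nbhs_ballP[d /= d0 dP]|[d d0 dP]].
  exists d => // y y0 yd; apply: dP => //.
  by rewrite /ball /= sub0r normrN gtr0_norm.
apply/nbhs_ballP; exists d => //= y; rewrite /ball /= sub0r normrN => yd y0.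
by apply: dP => //; rewrite -(gtr0_norm y0).
Qed.

Lemma boundedP f : bounded_fun f <-> exists M : R, forall x, `|f x| <= M.
Proof.
have PF : ProperFilter (globally [set: R]) by exact: (@globally_properfilter _ _ 0).
rewrite /= ex_bound; split=> -[M fM]; exists M => x; first exact: fM.
by move=> _; apply: fM.
Qed.

Lemma min_seg f a b : a <= b -> continuous f ->
  exists c, a <= c <= b /\ forall t, a <= t <= b -> f c <= f t.
Proof.
move=> ab cf; have [|c] := @EVT_min R f a b ab; first exact: continuous_subspaceT.
by rewrite in_itv /= => cab cP; exists c; split=> // t tab; apply: cP; rewrite in_itv.
Qed.

Lemma max_seg f a b : a <= b -> continuous f ->
  exists c, a <= c <= b /\ forall t, a <= t <= b -> f t <= f c.
Proof.
move=> ab cf; have [|c] := @EVT_max R f a b ab; first exact: continuous_subspaceT.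
by rewrite in_itv /= => cab cP; exists c; split=> // t tab; apply: cP; rewrite in_itv.
Qed.

Lemma bounded_seg f a b : continuous f ->
  exists2 M : R, 0 < M & forall t, a <= t <= b -> `|f t| <= M.
Proof.
move=> cf; have [ab|ab] := leP a b; last first.
  by exists 1 => // t /andP[? ?]; exfalso; lra.
have cn : continuous (fun x => `|f x|) by move=> x; apply: cvg_norm; exact: cf.
have [c [_ cP]] := max_seg ab cn.
exists (`|f c| + 1); first by rewrite ltr_wpDl.
by move=> t tab; apply: le_trans (cP _ tab) _; lra.
Qed.

Lemma min_coercive f M : continuous f ->
  (forall x, M <= `|x| -> f 0 <= f x) -> exists c, forall t, f c <= f t.
Proof.
move=> cf fM; have [M0|M0] := leP 0 M; last first.
  by exists 0 => t; apply: fM; apply: le_trans (ltW M0) _.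
have [|c [cM cP]] := @min_seg f (- M) M _ cf; first lra.
exists c => t; have [tM|tM] := leP M `|t|.
  by apply: le_trans (fM _ tM); apply: cP; lra.
by apply: cP; rewrite -ler_norml ltW.
Qed.

Definition has_deriv f f' := forall x, is_derive x (1 : R) f (f' x).

Lemma derive_C1 f f' : has_deriv f f' -> continuous f' -> C1 f.
Proof.
move=> df cf'; split=> [x|]; first by case: (df x).
suff -> : derive1 f = f' by [].
by apply/funext => x; rewrite derive1E; by case: (df x).
Qed.

Lemma has_deriv_derive1 f f' : has_deriv f f' -> derive1 f = f'.
Proof.
by move=> df; apply/funext => x; rewrite derive1E; by case: (df x).
Qed.

Lemma C1_derive f : C1 f -> has_deriv f (derive1 f).
Proof. by move=> [df _] x; rewrite derive1E; exact: derivableP. Qed.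

Lemma has_deriv_cont f f' : has_deriv f f' -> continuous f.
Proof.
move=> df x; apply: differentiable_continuous; apply/derivable1_diffP.
by case: (df x).
Qed.

Lemma mvt f f' a b : a < b -> has_deriv f f' ->
  exists c, [/\ a < c, c < b & f b - f a = f' c * (b - a)].
Proof.
move=> ab df; have [|c] := @MVT R f f' a b ab (fun x _ => df x).
  by apply: continuous_subspaceT => x; exact: (has_deriv_cont df).
by rewrite in_itv /= => /andP[ac cb] ->; exists c.
Qed.

Lemma normlt (x e : R) : `|x| < e -> - e < x /\ x < e.
Proof. by rewrite ltr_norml => /andP. Qed.

End EpsilonDelta.

(** * Difference quotients and the mean value inequality *)

Section Slopes.
Variable R : realType.
Implicit Types (G H : R -> R -> R) (K f g u v : R -> R) (a b c d e x y z p q : R).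

Definition cvx K := forall p q t, 0 <= t -> t <= 1 ->
  K (t * p + (1 - t) * q) <= t * K p + (1 - t) * K q.

Definition coercive K := forall M, exists2 B : R, 0 < B & forall p, B <= `|p| -> M <= K p.

Definition slope u x y := (u y - u x) / (y - x).

Lemma slopeM u x y : x < y -> u y - u x = slope u x y * (y - x).
Proof. by move=> xy; rewrite /slope divfK // gt_eqF // subr_gt0. Qed.

Lemma slope_le u x y a : x < y -> (slope u x y <= a) = (u y - u x <= a * (y - x)).
Proof. by move=> xy; rewrite /slope ler_pdivrMr // subr_gt0. Qed.

Lemma slope_ge u x y a : x < y -> (a <= slope u x y) = (a * (y - x) <= u y - u x).
Proof. by move=> xy; rewrite /slope ler_pdivlMr // subr_gt0. Qed.

(* Encodes [K(u'(z)) <= a]; equivalent to the viscosity notion, see [vsub_sub], [sub_vsub]. *)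
Definition subat K a u z := forall e, 0 < e -> exists2 d : R, 0 < d &
  forall x y, z - d < x -> x < y -> y < z + d -> K (slope u x y) <= a + e.

Lemma cvx_between K a p r q : cvx K -> p <= r -> r <= q ->
  K p <= a -> K q <= a -> K r <= a.
Proof.
move=> cK pr rq Kp Kq; have [pq|qp] := ltP p q; last first.
  by have -> : r = p by apply/eqP; rewrite eq_le pr andbT; apply: le_trans rq _.
have qp0 : 0 < q - p by lra.
pose t := (q - r) / (q - p).
have t0 : 0 <= t by rewrite divr_ge0 //; lra.
have t1 : t <= 1 by rewrite ler_pdivrMr //; lra.
have tE : t * (q - p) = q - r by rewrite /t divfK // gt_eqF.
have -> : r = t * p + (1 - t) * q by nra.
by apply: le_trans (cK _ _ _ t0 t1) _; nra.
Qed.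

Lemma cvxN K : cvx K -> cvx (fun p => K (- p)).
Proof.
move=> cK p q t t0 t1; have -> : - (t * p + (1 - t) * q) = t * - p + (1 - t) * - q by ring.
exact: cK.
Qed.

Lemma contN K : continuous K -> continuous (fun p => K (- p)).
Proof. by move=> cK p; apply: continuous_comp; [exact: oppr_continuous|exact: cK]. Qed.

Lemma coerciveN K : coercive K -> coercive (fun p => K (- p)).
Proof. by move=> cK M; have [B B0 BP] := cK M; exists B => // p; rewrite -normrN; exact: BP. Qed.

Lemma slopeN u x y : slope (fun z => - u z) x y = - slope u x y.
Proof. by rewrite /slope -opprD mulNr. Qed.

Lemma subatN K a u z : subat K a u z -> subat (fun p => K (- p)) a (fun z => - u z) z.
Proof.
move=> sK e e0; have [d d0 dP] := sK e e0; exists d => // x y zx xy yz.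
by rewrite slopeN opprK; apply: dP.
Qed.

(** The sublevel set is an interval that misses [s], so it lies on one side of [s]; continuity at
    [s] leaves a gap, in which [s'] is placed. An empty sublevel set falls under the second
    alternative. *)
Lemma cvx_level_separated K a s : cvx K -> continuous K -> a < K s ->
  (exists s', [/\ s' < s, a < K s' & forall p, K p <= a -> p < s']) \/
  (exists s', [/\ s < s', a < K s' & forall p, K p <= a -> s' < p]).
Proof.
move=> cvK /contP cK aKs.
have [|d d0 dP] := cK s (K s - a); first lra.
have near p : `|p - s| < d -> a < K p by move/dP; rewrite ltr_norml => /andP[]; lra.
have [[p0 [p0s Kp0]]|nop] := pselect (exists p0, p0 <= s /\ K p0 <= a).
  left; exists (s - d / 2); split; first lra.
    by apply: near; rewrite ltr_norml; apply/andP; split; lra.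
  move=> p Kp; rewrite ltNge; apply/negP => ps.
  have [sp|sp] := leP s p.
    by have := cvx_between cvK p0s sp Kp0 Kp; lra.
  suff : a < K p by lra.
  by apply: near; rewrite ltr_norml; apply/andP; split; lra.
right; exists (s + d / 2); split; first lra.
  by apply: near; rewrite ltr_norml; apply/andP; split; lra.
move=> p Kp; rewrite ltNge; apply/negP => ps.
have [sp|sp] := leP p s; first by apply: nop; exists p.
suff : a < K p by lra.
by apply: near; rewrite ltr_norml; apply/andP; split; lra.
Qed.

(** Reduces a bound on [K] to linear inequalities on the increment of [u], one for each slope
    strictly outside the sublevel set. Such inequalities pass directly to upper limits and follow
    from one-sided estimates. *)
Lemma slope_hull K a u x y : cvx K -> continuous K -> x < y ->
  (forall s, a < K s -> (forall p, K p <= a -> p < s) -> u y - u x <= s * (y - x)) ->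
  (forall s, a < K s -> (forall p, K p <= a -> s < p) -> s * (y - x) <= u y - u x) ->
  K (slope u x y) <= a.
Proof.
move=> cvK cK xy up lo; rewrite leNgt; apply/negP => /(cvx_level_separated cvK cK)[[s [ss as' sP]]|[s [ss as' sP]]].
  by have := up _ as' sP; rewrite -slope_le // leNgt ss.
by have := lo _ as' sP; rewrite -slope_ge // leNgt ss.
Qed.

Lemma coercive_min K : continuous K -> coercive K -> exists p, forall q, K p <= K q.
Proof. by move=> cK coK; have [B _ BP] := coK (K 0); apply: min_coercive BP. Qed.

Lemma subat_nonempty K a u z : continuous K -> coercive K -> subat K a u z ->
  exists p, K p <= a.
Proof.
move=> cK coK sK; have [p pP] := coercive_min cK coK; exists p.
rewrite leNgt; apply/negP => aKp.
have [|d d0 dP] := sK ((K p - a) / 2); first lra.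
have := dP (z - d/2) (z + d/2); have := pP (slope u (z - d / 2) (z + d / 2)).
by move=> h1 h2; have {h2} := h2 _ _ _; lra.
Qed.

(** Continuous induction, with no continuity of [g] assumed. The estimate is required only on small
    intervals around [z]: its left half puts the supremum [T] of the good points in [A], its right
    half pushes beyond [T] unless [T = y]. *)
Lemma dini_nonincreasing g x y : x <= y ->
  (forall z, x <= z -> z <= y -> forall e, 0 < e -> exists2 d : R, 0 < d &
     forall s t, z - d < s -> s <= z -> z <= t -> t < z + d -> s < t ->
       g t - g s <= e * (t - s)) ->
  g y <= g x.
Proof.
move=> xy H; apply/ler_addgt0Pr => e e0.
suff {e e0} F e : 0 < e -> g y - g x <= e * (y - x).
  have [xy'|yx] := ltP x y; last first.
    have -> : y = x by lra.
    lra.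
  have yx0 : 0 < y - x by lra.
  have := F (e / (y - x)); rewrite divfK ?gt_eqF // divr_gt0 // => /(_ isT).
  lra.
move=> e0; pose A := [set t | x <= t /\ t <= y /\ g t - g x <= e * (t - x)].
have Ax : A x by rewrite /A /= lexx subrr; split=> //; split=> //; lra.
have hA : has_sup A by split; [exists x|exists y => t [_ []]].
pose T := sup A.
have Tub t : A t -> t <= T by exact: sup_upper_bound.
have xT : x <= T by exact: Tub.
have Ty : T <= y by apply: ge_sup; [exists x|move=> t [_ []]].
have [d d0 dP] := H T xT Ty e e0.
have [s As sT] := sup_adherent d0 hA.
have AT : A T.
  have sT' := Tub _ As; case: As => xs [sy gs].
  split=> //; split=> //; have [sT1|Ts] := ltP s T; last by have <- : s = T by lra.
  have := dP s T sT sT' (lexx _); have T2 : T < T + d by lra.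
  by move=> /(_ T2 sT1); nra.
have [Ty'|yT] := ltP T y; last by case: AT => _ []; have -> : y = T by lra.
pose t := Num.min y (T + d / 2).
have Tt : T < t by rewrite /t lt_min Ty' /=; lra.
have ty : t <= y by rewrite /t ge_min lexx.
have td : t <= T + d / 2 by rewrite /t ge_min lexx orbT.
suff /Tub : A t by lra.
case: AT => _ [_ gT]; split; first lra; split=> //.
have := dP T t; have h1 : T - d < T by lra.
have h2 : t < T + d by lra.
by move=> /(_ h1 (lexx _) (ltW Tt) h2 Tt); nra.
Qed.

Section MeanValue.
Variables (G : R -> R -> R) (f u : R -> R) (x y : R).
Hypothesis xy : x < y.

(** If a quotient near [z] reached [s], convexity between it and a point of the sublevel set would
    bound [G' z s] by the midpoint of [f' z] and [G' z s]. So [u' - s id] is nonincreasing near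
    every point. *)
Lemma subat_slope_lt G' f' u' s :
  (forall z, x <= z -> z <= y -> [/\ cvx (G' z), continuous (G' z) & coercive (G' z)]) ->
  (forall z, x <= z -> z <= y -> subat (G' z) (f' z) u' z) ->
  (forall z, x <= z -> z <= y -> f' z < G' z s) ->
  (forall z p, x <= z -> z <= y -> G' z p <= f' z -> p < s) ->
  u' y - u' x <= s * (y - x).
Proof.
move=> gG sG fs ps; pose g z := u' z - s * z.
suff : g y <= g x by rewrite /g; lra.
apply: dini_nonincreasing (ltW xy) _ => z xz zy e e0.
have [cv cG co] := gG z xz zy; have fz := fs z xz zy.
have [|d d0 dP] := sG z xz zy ((G' z s - f' z) / 2); first lra.
exists d => // s1 t1 h1 h2 h3 h4 st.
have := dP s1 t1 h1 st h4; set sl := slope _ _ _ => Gsl.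
have [p0 Gp0] := subat_nonempty cG co (sG z xz zy).
have sls : sl < s.
  rewrite ltNge; apply/negP => ssl.
  suff : G' z s <= f' z + (G' z s - f' z) / 2 by lra.
  by apply: cvx_between cv (ltW (ps z p0 xz zy Gp0)) ssl _ Gsl; lra.
have := slopeM u' st; rewrite -/sl /g => E.
have : sl * (t1 - s1) <= s * (t1 - s1) by rewrite ler_pM2r ?subr_gt0 // ltW.
have : 0 <= e * (t1 - s1) by rewrite mulr_ge0 //; lra.
lra.
Qed.

Hypothesis gG : forall z, x <= z -> z <= y -> [/\ cvx (G z), continuous (G z) & coercive (G z)].
Hypothesis sG : forall z, x <= z -> z <= y -> subat (G z) (f z) u z.

(** The local condition integrates without any derivative of [u]: a convex [K] that controls the
    sublevel sets over [[x, y]] controls the secant. The typical [K] is [G] frozen at a nearby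
    point. *)
Lemma mean_value K a : cvx K -> continuous K ->
  (forall z p, x <= z -> z <= y -> G z p <= f z -> K p <= a) ->
  K (slope u x y) <= a.
Proof.
move=> cvK cK GK; apply: slope_hull => // s as' sP.
  apply: (subat_slope_lt gG sG) => [z xz zy|z p xz zy Gp]; last exact/sP/(GK z).
  by rewrite ltNge; apply/negP => /(GK _ _ xz zy); lra.
(* The lower estimate is the upper one for [- u] and the Hamiltonian [p -> G z (- p)]. *)
have := @subat_slope_lt (fun z p => G z (- p)) f (fun z => - u z) (- s).
move=> H; suff : - u y - - u x <= - s * (y - x) by lra.
apply: H => [z xz zy|z xz zy|z xz zy|z p xz zy Gp].
- by have [? ? ?] := gG xz zy; split; [exact: cvxN|exact: contN|exact: coerciveN].
- exact/subatN/sG.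
- by rewrite opprK ltNge; apply/negP => /(GK _ _ xz zy); lra.
- by rewrite ltrNr; apply/sP/(GK z).
Qed.

End MeanValue.

End Slopes.

(** * Operations that preserve the slope condition *)

Section SubatOperations.
Variable R : realType.
Implicit Types (G H : R -> R -> R) (K f g u v : R -> R) (a b c d e x y z p q : R).

(** Serves both [max] and [min]: their increments lie between those of the two functions, and the
    sublevel set of [K] is an interval. *)
Lemma slope_between2 K a u v w x y : cvx K -> x < y ->
  K (slope u x y) <= a -> K (slope v x y) <= a ->
  (w y - w x <= u y - u x \/ w y - w x <= v y - v x) ->
  (u y - u x <= w y - w x \/ v y - v x <= w y - w x) ->
  K (slope w x y) <= a.
Proof.
move=> cK xy Ku Kv up lo.
have yx : 0 < y - x by lra.
have mono (s t : R) : s <= t -> s / (y - x) <= t / (y - x) by move=> ?; rewrite ler_pM2r // invr_gt0.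
case: up => /mono h1; case: lo => /mono h2.
- exact: (cvx_between cK h2 h1 Ku Ku).
- exact: (cvx_between cK h2 h1 Kv Ku).
- exact: (cvx_between cK h2 h1 Ku Kv).
- exact: (cvx_between cK h2 h1 Kv Kv).
Qed.

Lemma subat_le K a b u z : a <= b -> subat K a u z -> subat K b u z.
Proof.
move=> ab sK e e0; have [d d0 dP] := sK e e0; exists d => // x y zx xy yz.
by apply: le_trans (dP _ _ zx xy yz) _; lra.
Qed.

Lemma subat_local K a u v z d : 0 < d -> (forall y, `|y - z| < d -> u y = v y) ->
  subat K a u z -> subat K a v z.
Proof.
move=> d0 uv sK e e0; have [d1 d10 dP] := sK e e0.
exists (Num.min d d1); first by rewrite lt_min d0.
move=> x y zx xy yz; have hm : Num.min d d1 <= d by rewrite ge_min lexx.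
have hm1 : Num.min d d1 <= d1 by rewrite ge_min lexx orbT.
suff -> : slope v x y = slope u x y by apply: dP => //; lra.
by rewrite /slope !uv // ltr_norml; apply/andP; split; lra.
Qed.

Lemma subat_ext K a u v z : u =1 v -> subat K a u z -> subat K a v z.
Proof. by move=> uv; apply: (@subat_local _ _ _ _ _ 1) => // y _; exact: uv. Qed.

Lemma subat_shift K a u z c : subat K a u z -> subat K a (fun y => u y + c) z.
Proof.
move=> sK e e0; have [d d0 dP] := sK e e0; exists d => // x y zx xy yz.
have -> : slope (fun y => u y + c) x y = slope u x y by rewrite /slope; congr (_ / _); ring.
exact: dP.
Qed.

Lemma subat_translate K a u z k : subat K a u (z + k) -> subat K a (fun y => u (y + k)) z.
Proof.
move=> sK e e0; have [d d0 dP] := sK e e0; exists d => // x y zx xy yz.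
have -> : slope (fun y => u (y + k)) x y = slope u (x + k) (y + k) by rewrite /slope; congr (_ / _); ring.
by apply: dP; lra.
Qed.

Lemma subat_reflect K a u z : subat K a u (- z) ->
  subat (fun p => K (- p)) a (fun y => u (- y)) z.
Proof.
move=> sK e e0; have [d d0 dP] := sK e e0; exists d => // x y zx xy yz.
have -> : - slope (fun y => u (- y)) x y = slope u (- y) (- x).
  by rewrite /slope -mulNr opprB; congr (_ / _); ring.
by apply: dP; lra.
Qed.

Lemma subat_max K a u v z : cvx K -> subat K a u z -> subat K a v z ->
  subat K a (fun y => Num.max (u y) (v y)) z.
Proof.
move=> cK su sv e e0; have [d d0 dP] := su e e0; have [d' d0' dP'] := sv e e0.
exists (Num.min d d'); first by rewrite lt_min d0.
move=> x y zx xy yz; have hm : Num.min d d' <= d by rewrite ge_min lexx.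
have hm1 : Num.min d d' <= d' by rewrite ge_min lexx orbT.
apply: (slope_between2 cK xy (dP x y _ xy _) (dP' x y _ xy _)); try lra.
- by have [h|h] := leP (u y) (v y); [right|left]; have := le_max (v x) (u x) (v x);
    have := le_max (u x) (u x) (v x); rewrite !lexx ?orbT /=; lra.
- by have [h|h] := leP (u x) (v x); [right|left]; have := le_max (v y) (u y) (v y);
    have := le_max (u y) (u y) (v y); rewrite !lexx ?orbT /=; lra.
Qed.

Lemma subat_min K a u v z : cvx K -> subat K a u z -> subat K a v z ->
  subat K a (fun y => Num.min (u y) (v y)) z.
Proof.
move=> cK su sv e e0; have [d d0 dP] := su e e0; have [d' d0' dP'] := sv e e0.
exists (Num.min d d'); first by rewrite lt_min d0.
move=> x y zx xy yz; have hm : Num.min d d' <= d by rewrite ge_min lexx.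
have hm1 : Num.min d d' <= d' by rewrite ge_min lexx orbT.
apply: (slope_between2 cK xy (dP x y _ xy _) (dP' x y _ xy _)); try lra.
- by have [h|h] := leP (u x) (v x); [left|right]; have := ge_min (v y) (u y) (v y);
    have := ge_min (u y) (u y) (v y); rewrite !lexx ?orbT /=; lra.
- by have [h|h] := leP (u y) (v y); [left|right]; have := ge_min (v x) (u x) (v x);
    have := ge_min (u x) (u x) (v x); rewrite !lexx ?orbT /=; lra.
Qed.

Lemma subat_cvx K a b u v z t : cvx K -> 0 <= t -> t <= 1 ->
  subat K a u z -> subat K b v z ->
  subat K (t * a + (1 - t) * b) (fun y => t * u y + (1 - t) * v y) z.
Proof.
move=> cK t0 t1 su sv e e0; have [d d0 dP] := su e e0; have [d' d0' dP'] := sv e e0.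
exists (Num.min d d'); first by rewrite lt_min d0.
move=> x y zx xy yz; have hm : Num.min d d' <= d by rewrite ge_min lexx.
have hm1 : Num.min d d' <= d' by rewrite ge_min lexx orbT.
have -> : slope (fun y => t * u y + (1 - t) * v y) x y = t * slope u x y + (1 - t) * slope v x y.
  by rewrite /slope !mulrA -mulrDl; congr (_ / _); ring.
apply: le_trans (cK _ _ _ t0 t1) _.
have h1 : t * K (slope u x y) <= t * (a + e) by rewrite ler_wpM2l // dP //; lra.
have h2 : (1 - t) * K (slope v x y) <= (1 - t) * (b + e).
  by rewrite ler_wpM2l ?subr_ge0 // dP' //; lra.
lra.
Qed.

(** A secant across [z] is a convex combination of a secant of [u] ending at [z] and one of [v]
    starting there, so the corner costs nothing. *)
Lemma subat_glue K a u v z : cvx K -> u z = v z -> subat K a u z -> subat K a v z ->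
  subat K a (fun y => if y <= z then u y else v y) z.
Proof.
move=> cK uv su sv e e0; have [d d0 dP] := su e e0; have [d' d0' dP'] := sv e e0.
exists (Num.min d d'); first by rewrite lt_min d0.
move=> x y zx xy yz; have hm : Num.min d d' <= d by rewrite ge_min lexx.
have hm1 : Num.min d d' <= d' by rewrite ge_min lexx orbT.
set w := fun y => _.
have [yz'|zy] := leP y z.
  have -> : slope w x y = slope u x y by rewrite /slope /w yz' (le_trans (ltW xy) yz').
  by apply: dP; lra.
have [xz|zx'] := leP x z; last first.
  have -> : slope w x y = slope v x y by rewrite /slope /w !leNgt zx' zy.
  by apply: dP'; lra.
have [zx'|xz'] := leP z x.
  have <- : z = x by lra.
  have -> : slope w z y = slope v z y by rewrite /slope /w lexx leNgt zy uv.
  by apply: dP'; lra.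
have Ku : K (slope u x z) <= a + e by apply: dP; lra.
have Kv : K (slope v z y) <= a + e by apply: dP'; lra.
have yx0 : 0 < y - x by lra.
pose t := (z - x) / (y - x).
have t0 : 0 <= t by rewrite divr_ge0 //; lra.
have t1 : t <= 1 by rewrite ler_pdivrMr //; lra.
have tE : t * (y - x) = z - x by rewrite /t divfK // gt_eqF.
have -> : slope w x y = t * slope u x z + (1 - t) * slope v z y.
  have hw : w y - w x = slope w x y * (y - x) by apply: slopeM.
  have hu := slopeM u xz'; have hv := slopeM v zy.
  have hwx : w x = u x by rewrite /w xz.
  have hwy : w y = v y by rewrite /w leNgt zy.
  apply: (mulIf (lt0r_neq0 yx0)); rewrite -hw hwx hwy.
  have -> : (t * slope u x z + (1 - t) * slope v z y) * (y - x) =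
     slope u x z * (t * (y - x)) + slope v z y * ((y - x) - t * (y - x)) by ring.
  rewrite tE -hu; have -> : y - x - (z - x) = y - z by ring.
  by rewrite -hv uv; ring.
apply: le_trans (cK _ _ _ t0 t1) _.
have h1 : t * K (slope u x z) <= t * (a + e) by rewrite ler_wpM2l.
have h2 : (1 - t) * K (slope v z y) <= (1 - t) * (a + e) by rewrite ler_wpM2l ?subr_ge0.
lra.
Qed.

Lemma subat_C1 K a u u' z : continuous K -> has_deriv u u' -> {for z, continuous u'} ->
  K (u' z) <= a -> subat K a u z.
Proof.
move=> /contP cK du /cont_atP cu Ka e e0.
have [d d0 dP] := cK (u' z) e e0; have [d1 d10 dP1] := cu d d0.
exists d1 => // x y zx xy yz; have [c [xc cy E]] := mvt xy du.
have -> : slope u x y = u' c by rewrite /slope E mulfK // gt_eqF // subr_gt0.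
have /dP : `|u' c - u' z| < d by apply: dP1; rewrite ltr_norml; apply/andP; split; lra.
by rewrite ltr_norml => /andP[_]; lra.
Qed.

Lemma subat_lip_local K a u z : coercive K -> subat K a u z ->
  exists B d, [/\ 0 < B, 0 < d & forall x y, z - d < x -> x < y -> y < z + d -> `|u y - u x| <= B * (y - x)].
Proof.
move=> coK sK; have [d d0 dP] := sK 1 ltr01; have [B B0 BP] := coK (a + 2).
exists B, d; split=> // x y zx xy yz; rewrite (slopeM _ xy) normrM (gtr0_norm (_ : 0 < y - x)) ?subr_gt0 //.
rewrite ler_pM2r ?subr_gt0 // ltW // ltNge; apply/negP => /BP.
by have := dP x y zx xy yz; lra.
Qed.

Lemma subat_cont K a u z : coercive K -> subat K a u z -> {for z, continuous u}.
Proof.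
move=> coK /(subat_lip_local coK)[B [d [B0 d0 BP]]]; apply/cont_atP => e e0.
exists (Num.min d (e / B)); first by rewrite lt_min d0 divr_gt0.
move=> y; rewrite lt_min => /andP[yd ye].
have BB : B * `|y - z| < e by rewrite mulrC -ltr_pdivlMr.
move: yd; rewrite ltr_norml => /andP[h1 h2].
have [yz|zy|->] := ltgtP y z.
- have := BP y z; rewrite distrC => H.
  have h : `|y - z| = z - y by rewrite ltr0_norm; lra.
  by rewrite h in BB; apply: le_lt_trans BB; apply: H; lra.
- have := BP z y => H.
  have h : `|y - z| = y - z by rewrite gtr0_norm; lra.
  by rewrite h in BB; apply: le_lt_trans BB; apply: H; lra.
- by rewrite subrr normr0.
Qed.

End SubatOperations.

(** * Convex Hamiltonians with bounds uniform in the space variable *)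

Section GoodHamiltonians.
Variable R : realType.
Implicit Types (G H : R -> R -> R) (K f g u v : R -> R) (a b c d e x y z p q : R).

Definition unif_cont G := forall B e, 0 < e -> exists2 d : R, 0 < d &
  forall x y p q, `|x - y| < d -> `|p - q| < d -> `|p| <= B -> `|q| <= B -> `|G x p - G y q| < e.

Definition unif_coercive G := forall M, exists2 B : R, 0 < B & forall x p, B <= `|p| -> M <= G x p.

(** Uniformity in [x] replaces periodicity, which [G] lacks; both [H] and its perturbation by [V]
    qualify, so one theory serves the two. *)
Record good G : Prop := Good {
  good_cvx : forall x, cvx (G x);
  good_ucont : unif_cont G;
  good_coer : unif_coercive G;
  good_bnd : forall B, exists M : R, forall x p, `|p| <= B -> `|G x p| <= M }.

(** The level may depend on [x]: a constant gives the stationary equation, [f = c - lam * u] the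
    discounted one, and [f = minH G] the lowest level possible. *)
Definition sub G f u := forall x, subat (G x) (f x) u x.

Variable G : R -> R -> R.
Hypothesis gG : good G.

Lemma good_coercive x : coercive (G x).
Proof. by move=> M; have [B B0 BP] := good_coer gG M; exists B => // p; exact: BP. Qed.

Lemma good_cont x : continuous (G x).
Proof.
apply/contP => p e e0; have [d d0 dP] := good_ucont gG (`|p| + 1) e0.
exists (Num.min d 1); first by rewrite lt_min d0 ltr01.
move=> q; rewrite lt_min => /andP[qd q1]; apply: dP => //.
- by rewrite subrr normr0.
- have := ler_normD p (q - p); have -> : p + (q - p) = q by ring.
  lra.
- by rewrite ler_wpDr.
Qed.

Lemma good_cont1 p : continuous (G ^~ p).
Proof.
apply/contP => x e e0; have [d d0 dP] := good_ucont gG (`|p|) e0.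
by exists d => // y yx; apply: dP; rewrite // subrr normr0.
Qed.

Lemma good_CCC z : [/\ cvx (G z), continuous (G z) & coercive (G z)].
Proof. by split; [exact: good_cvx|exact: good_cont|exact: good_coercive]. Qed.

(** Momenta at level [M] are bounded uniformly in [x] by coercivity, so uniform continuity lets the
    base point move. *)
Lemma sublevel_unif M e : 0 < e -> exists2 d : R, 0 < d &
  forall x z p, `|z - x| < d -> G z p <= M -> G x p <= G z p + e.
Proof.
move=> e0; have [B B0 BP] := good_coer gG (M + 1).
have [d d0 dP] := good_ucont gG B e0; exists d => // x z p zx Gz.
have pB : `|p| <= B by rewrite leNgt; apply/negP => /ltW /BP h; have := h z; lra.
by have := dP z x p p zx; rewrite subrr normr0 => /(_ d0 pB pB); rewrite ltr_norml => /andP[]; lra.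
Qed.

Lemma sublevel_local f x e : {for x, continuous f} -> 0 < e -> exists2 d : R, 0 < d &
  forall z p, `|z - x| < d -> G z p <= f z -> G x p <= f x + e.
Proof.
move=> /cont_atP cf e0; have e20 : 0 < e / 2 by lra.
have [d d0 dP] := cf _ e20; have [d1 d10 dP1] := sublevel_unif (f x + e) e20.
exists (Num.min d d1); first by rewrite lt_min d0.
move=> z p; rewrite lt_min => /andP[zd zd1] Gz.
have := dP z zd; rewrite ltr_norml => /andP[_ h].
have h' : G z p <= f x + e by lra.
by have := dP1 x z p zd1 h'; lra.
Qed.

Lemma sub_mean f u x y K a : sub G f u -> x < y -> cvx K -> continuous K ->
  (forall z p, x <= z -> z <= y -> G z p <= f z -> K p <= a) -> K (slope u x y) <= a.
Proof. by move=> su xy; apply: (mean_value xy) => z _ _; [exact: good_CCC|exact: su]. Qed.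

Lemma sub_cont f u : sub G f u -> continuous u.
Proof. by move=> su x; apply: subat_cont (su x); exact: good_coercive. Qed.

End GoodHamiltonians.

(** * Viscosity subsolutions versus the slope condition *)

Section ViscositySlopes.
Variable R : realType.
Implicit Types (G H : R -> R -> R) (K f g u v phi : R -> R) (a b c d e x y z p q s : R).

Definition vsub G f u := forall phi z, C1 phi ->
  (\forall y \near z, u y - phi y <= u z - phi z) -> G z (derive1 phi z) <= f z.

Lemma expR_decay a c d : 0 < a -> 0 < c -> 0 < d -> exists2 k, 0 < k & a * expR (- (k * d)) < c.
Proof.
move=> a0 c0 d0; exists (a / (c * d)); first by rewrite divr_gt0 ?mulr_gt0.
have -> : a / (c * d) * d = a / c by field; rewrite !gt_eqF.
rewrite expRN -ltr_pdivlMl // invf_plt ?posrE ?expR_gt0 //; last first.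
  by rewrite mulr_gt0 // invr_gt0.
rewrite invfM invrK; apply: lt_le_trans (expR_ge1Dx _).
by lra.
Qed.

Lemma derive_tilt s a k c : has_deriv (fun z => s * z + a * expR (k * (z - c)))
  (fun z => s + a * (k * expR (k * (z - c)))).
Proof.
move=> z; apply: is_derive_eq.
by rewrite /GRing.scale /=; ring.
Qed.

(** If [u] rose too fast, subtract the line of slope [s] and a steep exponential layer at [y]. The
    layer keeps the maximum away from [y]; it is negligible at [y - m], where [g] still exceeds
    [g x], so the maximum is not at [x] either. At an interior maximum the test slope exceeds [s],
    against the bound on the sublevel sets. *)
Lemma vsub_slope_lt G f u x y s : continuous u -> vsub G f u -> x < y ->
  (forall z p, x <= z -> z <= y -> G z p <= f z -> p < s) ->
  u y - u x <= s * (y - x).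
Proof.
move=> cu vu xy ps; rewrite leNgt; apply/negP => h.
pose g z := u z - s * z.
have gxy : g x < g y by rewrite /g; lra.
have cg : continuous g.
  by move=> z; apply: cvgB; [exact: cu|apply: cvgMr; exact: cvg_id].
pose c := (g y - g x) / 2; have c0 : 0 < c by rewrite /c; lra.
have [d d0 dP] := (contP g).1 cg y c c0.
pose m := Num.min d (y - x) / 2.
have m0 : 0 < m by rewrite divr_gt0 // lt_min d0 subr_gt0.
have md : m < d.
  have : Num.min d (y - x) <= d by rewrite ge_min lexx.
  rewrite /m; lra.
have mx : m < y - x.
  have : Num.min d (y - x) <= y - x by rewrite ge_min lexx orbT.
  rewrite /m; lra.
have gy1 : g x + c < g (y - m).
  have := dP (y - m); rewrite ltr_norml ltr_norml => /(_ _)/andP[].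
    by apply/andP; split; lra.
  by rewrite /c; lra.
(* The height of the layer at [y], enough to bring the value at [y] below the one at [y - m]. *)
pose a := `|g y - g (y - m)| + c.
have a0 : 0 < a by rewrite ltr_wpDl.
have [k k0 kP] := expR_decay a0 c0 m0.
pose psi z := s * z + a * expR (k * (z - y)).
have dpsi := derive_tilt s a k y.
have cpsi : continuous psi := has_deriv_cont dpsi.
have cup : continuous (fun z => u z - psi z) by move=> z; apply: cvgB; [exact: cu|exact: cpsi].
have [z [/andP[xz zy] zP]] := max_seg (ltW xy) cup.
have e0 t : 0 < expR (k * (t - y)) by exact: expR_gt0.
have hm : x <= y - m <= y by apply/andP; split; lra.
have := zP _ hm; rewrite /psi.
have -> : k * (y - m - y) = - (k * m) by ring.
move=> hz.
have zx : z != x.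
  apply/eqP => zx; rewrite zx in hz.
  have : 0 < a * expR (k * (x - y)) by rewrite mulr_gt0.
  by rewrite /g in gy1; lra.
have zy' : z != y.
  apply/eqP => zy1; rewrite zy1 subrr mulr0 expR0 in hz.
  have : g y - g (y - m) <= `|g y - g (y - m)| by exact: ler_norm.
  by rewrite /a in hz kP; rewrite /g in hz kP *; lra.
have {}xz : x < z by rewrite lt_neqAle eq_sym zx.
have {}zy : z < y by rewrite lt_neqAle zy'.
have C1psi : C1 psi.
  apply: derive_C1 dpsi _ => t; apply: cvgD; first exact: cvg_cst.
  apply: cvgMr; apply: cvgMr.
  apply: (@continuous_comp _ _ _ (fun z => k * (z - y)) expR); last exact: continuous_expR.
  by apply: cvgMr; apply: cvgB; [exact: cvg_id|exact: cvg_cst].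
have nz : \forall t \near z, u t - psi t <= u z - psi z.
  apply/nearP; exists (Num.min (z - x) (y - z)); first by rewrite lt_min !subr_gt0 xz.
  move=> t; rewrite lt_min !ltr_norml => /andP[/andP[h1 h2] /andP[h3 h4]].
  by apply: zP; apply/andP; split; lra.
have := vu _ _ C1psi nz; rewrite (has_deriv_derive1 dpsi).
move=> /(ps _ _ (ltW xz) (ltW zy)).
have : 0 < a * (k * expR (k * (z - y))) by rewrite !mulr_gt0.
lra.
Qed.

Lemma C1_comp_opp phi : C1 phi -> C1 (fun x => phi (- x)) /\
  derive1 (fun x => phi (- x)) = fun x => - derive1 phi (- x).
Proof.
move=> Cphi; have dphi := C1_derive Cphi.
have d' : has_deriv (fun x => phi (- x)) (fun x => - derive1 phi (- x)).
  move=> x; have H := dphi (- x).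
  have H2 : is_derive x (1:R) (fun x : R => - x) (- 1) by apply: is_derive_eq.
  have := @is_derive1_comp R phi (fun x : R => - x) x _ _ H H2.
  by rewrite mulrN1.
split; last exact: has_deriv_derive1.
apply: derive_C1 d' _ => x; apply: cvgN.
by apply: continuous_comp; [exact: oppr_continuous|exact: Cphi.2].
Qed.

Lemma vsub_reflect G f u : vsub G f u ->
  vsub (fun x p => G (- x) (- p)) (fun x => f (- x)) (fun x => u (- x)).
Proof.
move=> vu phi z Cphi nz; have [Cphi' dphi'] := C1_comp_opp Cphi.
have := vu (fun x => phi (- x)) (- z) Cphi'; rewrite dphi' opprK; apply.
move/nearP : nz => [d d0 dP]; apply/nearP; exists d => // y yz.
by have := dP (- y); rewrite opprK; apply; rewrite -normrN opprD opprK.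
Qed.

Lemma vsub_mean G f u x y K a : continuous u -> vsub G f u -> x < y -> cvx K -> continuous K ->
  (forall z p, x <= z -> z <= y -> G z p <= f z -> K p <= a) -> K (slope u x y) <= a.
Proof.
move=> cu vu xy cvK cK GK; apply: slope_hull => // s as' sP.
  by apply: (vsub_slope_lt cu vu xy) => z p xz zy Gp; exact/sP/(GK z).
have cu' : continuous (fun x => u (- x)) := contN cu.
have := @vsub_slope_lt _ _ _ (- y) (- x) (- s) cu' (vsub_reflect vu).
rewrite !opprK ltrN2 => /(_ xy) H.
suff : u x - u y <= - s * (- x + y) by lra.
apply: H => z p yz zx Gp; rewrite ltrNr; apply: sP; apply: (GK (- z)) => //; lra.
Qed.

Variable G : R -> R -> R.
Hypothesis gG : good G.

Lemma vsub_sub f u : continuous f -> continuous u -> vsub G f u -> sub G f u.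
Proof.
move=> cf cu vu x e e0; have [d d0 dP] := sublevel_local gG (cf x) e0.
exists d => // y z xy yz zx; apply: (vsub_mean cu vu yz).
- exact: good_cvx.
- exact: good_cont.
- by move=> t p yt tz; apply: dP; rewrite ltr_norml; apply/andP; split; lra.
Qed.

(** Touching from above makes the right secant at most, and the left secant at least, about
    [phi'(z)]. Either one of them is close to [phi'(z)], or [phi'(z)] lies between two points of the
    sublevel set. *)
Lemma sub_vsub f u : sub G f u -> vsub G f u.
Proof.
move=> su phi z Cphi /nearP[d0 d00 dP0]; set p := derive1 phi z.
apply/ler_addgt0Pr => e e0; have e20 : 0 < e / 2 by lra.
have [d1 d10 dP1] := su z _ e20.
have [d2 d20 dP2] := (contP _).1 (good_cont gG (x := z)) p _ e20.
have d220 : 0 < d2 / 2 by lra.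
have [d3 d30 dP3] := (contP _).1 Cphi.2 z _ d220.
pose d := Num.min (Num.min d0 d1) d3 / 2.
have dd : 0 < d by rewrite divr_gt0 // !lt_min d00 d10.
have hd0 : d < d0.
  have : Num.min (Num.min d0 d1) d3 <= d0 by rewrite !ge_min lexx.
  rewrite /d; rewrite /d in dd; lra.
have hd1 : d < d1.
  have : Num.min (Num.min d0 d1) d3 <= d1 by rewrite !ge_min lexx orbT.
  rewrite /d; rewrite /d in dd; lra.
have hd3 : d < d3.
  have : Num.min (Num.min d0 d1) d3 <= d3 by rewrite !ge_min lexx !orbT.
  rewrite /d; rewrite /d in dd; lra.
have zd : z < z + d by lra.
have dz : z - d < z by lra.
have Gr : G z (slope u z (z + d)) <= f z + e / 2 by apply: dP1; lra.
have Gl : G z (slope u (z - d) z) <= f z + e / 2 by apply: dP1; lra.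
have rP : slope u z (z + d) <= p + d2 / 2.
  have [c [c1 c2 E]] := mvt zd (C1_derive Cphi).
  have : `|derive1 phi c - p| < d2 / 2 by apply: dP3; rewrite ltr_norml; apply/andP; split; lra.
  rewrite ltr_norml => /andP[_ h].
  rewrite slope_le //; apply: le_trans (_ : phi (z + d) - phi z <= _).
    have hz : `|z + d - z| < d0 by rewrite addrAC subrr add0r gtr0_norm.
    by have := dP0 _ hz; lra.
  by rewrite E; nra.
have lP : p - d2 / 2 <= slope u (z - d) z.
  have [c [c1 c2 E]] := mvt dz (C1_derive Cphi).
  have : `|derive1 phi c - p| < d2 / 2 by apply: dP3; rewrite ltr_norml; apply/andP; split; lra.
  rewrite ltr_norml => /andP[h _].
  rewrite slope_ge //; apply: le_trans (_ : _ <= phi z - phi (z - d)) _; last first.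
    have hz : `|z - d - z| < d0 by rewrite addrAC subrr add0r normrN gtr0_norm.
    by have := dP0 _ hz; lra.
  by rewrite E; nra.
suff [q [qp Gq]] : exists q, `|q - p| < d2 /\ G z q <= f z + e / 2.
  by have := dP2 q qp; rewrite ltr_norml => /andP[h _]; lra.
have [h|h] := leP (slope u (z - d) z) (p + d2 / 2).
  by exists (slope u (z - d) z); split=> //; rewrite ltr_norml; apply/andP; split; lra.
have [h'|h'] := leP (p - d2 / 2) (slope u z (z + d)).
  by exists (slope u z (z + d)); split=> //; rewrite ltr_norml; apply/andP; split; lra.
exists p; split; first by rewrite subrr normr0.
by apply: cvx_between Gr Gl; [exact: good_cvx|lra|lra].
Qed.

Lemma visc_sub_stationaryP a u : visc_sub (stationary G a) u <-> sub G (fun=> a) u.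
Proof.
split=> [[cu vu]|su].
  apply: vsub_sub => //; first by move=> x; exact: cvg_cst.
  by move=> phi z Cphi nz; have := vu phi z Cphi nz; rewrite /stationary; lra.
split; first exact: sub_cont su.
by move=> phi z Cphi nz; have := sub_vsub su Cphi nz; rewrite /stationary; lra.
Qed.

Lemma visc_sub_discounted lam a u : visc_sub (discounted G lam a) u ->
  sub G (fun x => a - lam * u x) u.
Proof.
move=> [cu vu]; apply: vsub_sub => //.
  by move=> x; apply: cvgB; [exact: cvg_cst|apply: cvgMr; exact: cu].
by move=> phi z Cphi nz; have := vu phi z Cphi nz; rewrite /discounted; lra.
Qed.

End ViscositySlopes.

(** * Upper limits along a filter *)

Section UpperLimits.
Variable R : realType.

Definition evb T (F : set_system T) (f : T -> R) := exists B, \forall t \near F, `|f t| <= B.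

(** The upper limit along [F]; under [evb] and for a proper filter the set is nonempty and bounded
    below, so the real [inf] is not a default value. *)
Definition lsup T (F : set_system T) (f : T -> R) : R := inf [set r | \forall t \near F, f t <= r].

Section Theory.
Variables (T : Type) (F : set_system T).
Hypothesis FF : ProperFilter F.
Implicit Types (f g : T -> R) (r e c : R).

Lemma evb_nonempty f : evb F f -> [set r | \forall t \near F, f t <= r] !=set0.
Proof.
move=> [B fB]; exists B; apply: filterS fB => t.
exact: le_trans (ler_norm _).
Qed.

Lemma evb_has_lbound f : evb F f -> has_lbound [set r | \forall t \near F, f t <= r].
Proof.
move=> [B fB]; exists (- B) => r fr.
have [t [fBt frt]] := filter_ex (filterI fB fr).
by move: fBt; rewrite ler_norml => /andP[]; lra.
Qed.

Lemma lsup_le f r : evb F f -> (\forall t \near F, f t <= r) -> lsup F f <= r.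
Proof. by move=> bf fr; apply: inf_lbound => //; exact: evb_has_lbound. Qed.

Lemma lsup_ge f r : evb F f -> (\forall t \near F, r <= f t) -> r <= lsup F f.
Proof.
move=> bf rf; apply: lb_le_inf; first exact: evb_nonempty.
move=> s fs; have [t [h1 h2]] := filter_ex (filterI rf fs).
exact: le_trans h1 h2.
Qed.

Lemma lsup_eps f e : evb F f -> 0 < e -> \forall t \near F, f t <= lsup F f + e.
Proof.
move=> bf e0; have := @inf_adherent _ _ _ e0 (conj (evb_nonempty bf) (evb_has_lbound bf)).
move=> [r fr rl]; apply: filterS fr => t ftr.
by apply: le_trans ftr (ltW rl).
Qed.

Lemma lsup_add_le f g c : evb F f -> evb F g ->
  (\forall t \near F, f t <= g t + c) -> lsup F f <= lsup F g + c.
Proof.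
move=> bf bg fg; apply/ler_addgt0Pr => e e0; apply: lsup_le => //.
apply: filterS2 fg (lsup_eps bg e0) => t; lra.
Qed.

Lemma lsup_eq f g : (\forall t \near F, f t = g t) -> lsup F f = lsup F g.
Proof.
move=> fg; rewrite /lsup; congr inf; apply/seteqP; split=> r /= fr.
  by apply: filterS2 fg fr => t ->.
by apply: filterS2 fg fr => t ->.
Qed.

(** The radius [d] is independent of [t], but the eventuality may depend on [x] and [y]. By
    [slope_hull] only inequalities between values at two points are needed, and these survive upper
    limits. *)
Lemma lsup_stable (G : R -> R -> R) (u : T -> R -> R) (f : R -> R) : good G ->
  (forall x, evb F (u ^~ x)) ->
  (forall x0 e, 0 < e -> exists2 d : R, 0 < d & forall x y, x0 - d < x -> x < y -> y < x0 + d ->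
     \forall t \near F, G x0 (slope (u t) x y) <= f x0 + e) ->
  sub G f (fun x => lsup F (u ^~ x)).
Proof.
move=> gG bu su x0 e e0; have [d d0 dP] := su x0 e e0; exists d => // x y h1 xy h2.
have sn := dP x y h1 xy h2.
apply: slope_hull => //; [exact: good_cvx|exact: good_cont|move=> s as' sP|move=> s as' sP].
  suff : lsup F (u ^~ y) <= lsup F (u ^~ x) + s * (y - x) by lra.
  apply: lsup_add_le => //; apply: filterS sn => t /sP /ltW; rewrite slope_le //; lra.
suff : lsup F (u ^~ x) <= lsup F (u ^~ y) + - (s * (y - x)) by lra.
apply: lsup_add_le => //; apply: filterS sn => t /sP /ltW; rewrite slope_ge //; lra.
Qed.

End Theory.
End UpperLimits.

(** * Primitives of continuous functions on the whole line *)

Section Primitives.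
Variable R : realType.
Implicit Types (f : R -> R) (a b x y : R).

(** Integration from a left endpoint [a], renormalised at 0 so that the result does not depend on
    [a]; the base point can then move with [x]. *)
Let Zf f (a x : R) : R := (\int[lebesgue_measure]_(t in `[a, x]) f t -
   \int[lebesgue_measure]_(t in `[a, 0%R]) f t)%R.

Lemma Zf_derive f a x : continuous f -> a < x -> is_derive x (1:R) (Zf f a) (f x).
Proof.
move=> cf ax.
have int : lebesgue_measure.-integrable `[a, x + 1] (EFin \o f).
  apply: continuous_compact_integrable; first exact: segment_compact.
  exact: continuous_subspaceT.
have x1 : x < x + 1 by lra.
have [d1 d2] := continuous_FTC1_closed x1 int ax (cf x).
have D : is_derive x (1:R) (fun y => \int[lebesgue_measure]_(t in `[a, y]) f t)%R (f x).
  by apply: DeriveDef; [exact: d1|rewrite -derive1E; exact: d2].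
have := @is_deriveB _ _ _ _ (cst (\int[lebesgue_measure]_(t in `[a, 0%R]) f t)%R) _ _ _ _ D (is_derive_cst _ _ _).
by rewrite subr0.
Qed.

Lemma Zf_consistent f a b x : continuous f -> a < x -> b < x -> a < 0 -> b < 0 -> Zf f a x = Zf f b x.
Proof.
move=> cf ax bx a0 b0.
pose m := Num.min x 0; pose M := Num.max x 0.
have mx : m <= x by rewrite /m ge_min lexx.
have m0 : m <= 0 by rewrite /m ge_min lexx orbT.
have xM : x <= M by rewrite /M le_max lexx.
have M0 : 0 <= M by rewrite /M le_max lexx orbT.
have am : a < m by rewrite /m lt_min ax.
have bm : b < m by rewrite /m lt_min bx.
pose D y := Zf f a y - Zf f b y.
have dD y : m <= y -> is_derive y (1:R) D 0.
  move=> my; have da : is_derive y (1:R) (Zf f a) (f y) by apply: Zf_derive => //; lra.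
  have db : is_derive y (1:R) (Zf f b) (f y) by apply: Zf_derive => //; lra.
  have := is_deriveB da db.
  by rewrite subrr.
have [|||c _] := @MVT_segment R D (fun=> 0) m M; first lra.
- by move=> y; rewrite in_itv /= => /andP[h _]; apply: dD; lra.
- apply: derivable_within_continuous => y; rewrite in_itv /= => /andP[h _].
  by case: (dD y h).
rewrite mul0r /D /m /M; have D0 : Zf f a 0 - Zf f b 0 = 0 by rewrite /Zf !subrr.
by case: (leP x 0) => h; lra.
Qed.

Lemma primitive f : continuous f -> exists Z, has_deriv Z f.
Proof.
move=> cf; pose Z x := Zf f (- (`|x| + 1)) x.
exists Z => x.
have nx := normr_ge0 x; have lx : - `|x| <= x by rewrite lerNl ler_normr lexx orbT.
(* One fixed base point, to the left of every [y] within distance 1 of [x]. *)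
have d : is_derive x (1:R) (Zf f (- (`|x| + 3))) (f x) by apply: Zf_derive => //; lra.
apply: near_eq_is_derive d.
apply/nearP; exists 1 => // y yx.
have ny := normr_ge0 y; have ly : - `|y| <= y by rewrite lerNl ler_normr lexx orbT.
have yy : `|y| <= `|x| + 1.
  have := ler_normD x (y - x); have -> : x + (y - x) = y by ring.
  lra.
by apply: Zf_consistent => //; lra.
Qed.

End Primitives.

(** * Smoothing, Lipschitz bounds and the comparison principle *)

Section Comparison.
Variable R : realType.
Implicit Types (f u v w z : R -> R) (c lam h x y : R).

(** The derivative of the average is exactly a secant of [z], to which the mean value inequality
    applies. *)
Lemma smooth_slope z (B h : R) : continuous z -> 0 < h ->
  (forall x y, x < y -> `|z y - z x| <= B * (y - x)) ->
  exists zh, [/\ has_deriv zh (fun x => slope z x (x + h)),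
     continuous (fun x => slope z x (x + h)) & forall x, `|zh x - z x| <= B * h].
Proof.
move=> cz h0 zB; have [Z dZ] := primitive cz.
exists (fun x => h^-1 * (Z (x + h) - Z x)); split.
- move=> x; have H1 := dZ (x + h).
  have H2 : is_derive x (1:R) (fun x : R => x + h) 1 by apply: is_derive_eq; rewrite addr0.
  have H3 := @is_derive1_comp R Z (fun x : R => x + h) x _ _ H1 H2.
  have H4 := is_deriveB H3 (dZ x).
  have := @is_deriveZ _ _ _ _ h^-1 _ _ _ H4.
  rewrite mulr1 /slope; have -> : x + h - x = h by ring.
  by rewrite mulrC.
- rewrite /slope => x; apply: cvgM; last first.
    have -> : (fun x0 => (x0 + h - x0)^-1) = fun=> h^-1.
      by apply/funext => y; congr (_^-1); ring.
    have -> : x + h - x = h by ring.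
    exact: cvg_cst.
  apply: cvgB; last exact: cz.
  apply: (@continuous_comp _ _ _ (fun x => x + h) z); last exact: cz.
  by apply: cvgD; [exact: cvg_id|exact: cvg_cst].
- move=> x; have xh : x < x + h by lra.
  have [c [xc ch ->]] := mvt xh dZ.
  have -> : h^-1 * (z c * (x + h - x)) = z c by field; rewrite gt_eqF.
  apply: le_trans (zB _ _ xc) _.
  have B0 : 0 <= B.
    have := le_trans (normr_ge0 _) (zB _ _ xh); have -> : x + h - x = h by ring.
    by rewrite pmulr_lge0.
  by rewrite ler_wpM2l //; lra.
Qed.

Variable G : R -> R -> R.
Hypothesis gG : good G.

(** [B] is chosen before [f] and [u], so families with a common bound on the level are
    equi-Lipschitz. *)
Lemma sub_lip M : exists2 B : R, 0 < B & forall f u, sub G f u -> (forall x, f x <= M) ->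
  forall x y, x < y -> `|u y - u x| <= B * (y - x).
Proof.
have [B B0 BP] := good_coer gG (M + 1); exists B => // f u su fM x y xy.
rewrite (slopeM _ xy) normrM (gtr0_norm (_ : 0 < y - x)) ?subr_gt0 // ler_pM2r ?subr_gt0 //.
have bp (z p : R) : G z p <= f z -> `|p| <= B.
  by move=> Gz; rewrite leNgt; apply/negP => /ltW /(BP z); have := fM z; lra.
rewrite ler_norml; apply/andP; split.
  suff : - slope u x y - B <= 0 by lra.
  apply: (sub_mean gG (K := fun p => - p - B) su xy).
  - by move=> p q t t0 t1; lra.
  - by move=> p; apply: cvgB; [apply: cvgN; exact: cvg_id|exact: cvg_cst].
  - by move=> z p _ _ /bp; rewrite ler_norml => /andP[]; lra.
suff : slope u x y - B <= 0 by lra.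
apply: (sub_mean gG (K := fun p => p - B) su xy).
- by move=> p q t t0 t1; lra.
- by move=> p; apply: cvgB; [exact: cvg_id|exact: cvg_cst].
- by move=> z p _ _ /bp; rewrite ler_norml => /andP[]; lra.
Qed.

(** The smoothed [z], minus a small quadratic that forces an extremum on the line, is a test
    function for [u], so no doubling of variables occurs. At the minimum point [x1] the equations
    give [lam * (z x1 - u x1) <= 3 * e], while minimality gives [z x1 - u x1 >= s / 2]. *)
Lemma comparison lam c z u : 0 < lam -> bounded_fun z -> bounded_fun u ->
  sub G (fun x => c - lam * z x) z -> visc_super (discounted G lam c) u ->
  forall x, z x <= u x.
Proof.
move=> lam0 /boundedP[Bz zB] /boundedP[Bu uB] sz [cu su] x0.
rewrite leNgt; apply/negP => uz0; pose s := z x0 - u x0.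
have s0 : 0 < s by rewrite /s; lra.
have Bz0 : 0 <= Bz by apply: le_trans (zB 0); rewrite normr_ge0.
have Bu0 : 0 <= Bu by apply: le_trans (uB 0); rewrite normr_ge0.
have zM x : c - lam * z x <= c + lam * Bz.
  by have := zB x; rewrite ler_norml => /andP[h _]; nra.
have [B B0 BP] := sub_lip (c + lam * Bz).
have {}BP := BP _ _ sz zM.
(* Chosen so that [3 * e] stays below [lam * s / 2]. *)
pose e := lam * s / 8; have e0 : 0 < e by rewrite /e !mulr_gt0 //; lra.
have [d d0 dP] := sublevel_unif gG (c + lam * Bz) e0.
have [d1 d10 dP1] := good_ucont gG (B + 1) e0.
pose h := Num.min (d / 2) (s / (8 * B)).
have h0 : 0 < h by rewrite lt_min !divr_gt0 // mulr_gt0.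
have hd : h < d by have : h <= d / 2 by [rewrite ge_min lexx]; lra.
have hB : B * h <= s / 8.
  have : h <= s / (8 * B) by rewrite ge_min lexx orbT.
  rewrite ler_pdivlMr; first lra.
  by rewrite mulr_gt0.
have cz := sub_cont gG sz.
have [zh [dzh cdzh zhP]] := smooth_slope cz h0 BP.
(* One [e] pays for moving the base point of [G] from [y] to [x], the other for the variation of
   [lam * z] over a length [h]. *)
have sl x : G x (slope z x (x + h)) <= c - lam * z x + 2 * e.
  have xh : x < x + h by lra.
  apply: (sub_mean gG sz xh (good_cvx gG x) (good_cont gG (x := x))) => y p xy yh Gy.
  have yx : `|y - x| < d by rewrite ger0_norm ?subr_ge0 //; lra.
  have Gc : G y p <= c + lam * Bz by apply: le_trans Gy (zM y).
  have := dP x y p yx Gc; suff : lam * (z x - z y) <= e by lra.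
  rewrite /e -mulrA ler_pM2l //.
  have [xy'|yx'] := ltP x y; last first.
    have -> : y = x by lra.
    rewrite subrr; lra.
  have := BP _ _ xy'; rewrite ler_norml => /andP[h1 _].
  have : B * (y - x) <= B * h by rewrite ler_pM2l //; lra.
  lra.
have slB x : `|slope z x (x + h)| <= B.
  have xh : x < x + h by lra.
  have hh : x + h - x = h by ring.
  have := BP _ _ xh; rewrite /slope hh => ?.
  by rewrite normrM normfV (gtr0_norm h0) ler_pdivrMr.
(* Bounds the penalty at the minimum point, by comparison with the point 0. *)
pose C := 2 * (Bu + Bz + s).
have C0 : 0 < C by rewrite /C; lra.
pose m := Num.min 1 d1 / 2.
have m0 : 0 < m by rewrite divr_gt0 // lt_min ltr01.
have m1 : m < 1 by have : Num.min 1 d1 <= 1 by [rewrite ge_min lexx]; rewrite /m; lra.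
have md1 : m < d1 by have : Num.min 1 d1 <= d1 by [rewrite ge_min lexx orbT]; rewrite /m; lra.
(* The squared penalty slope is [4 * th] times the penalty, hence at most [4 * th * C <= m ^+ 2];
   the second bound makes the penalty at [x0] at most [s / 8]. *)
pose th := Num.min (m ^+ 2 / (4 * C + 1)) (s / (8 * (x0 ^+ 2 + 1))).
have x02 : 0 <= x0 ^+ 2 by rewrite sqr_ge0.
have th0 : 0 < th by rewrite lt_min !divr_gt0 ?exprn_gt0 // ?mulr_gt0 //; lra.
have thx0 : th * x0 ^+ 2 <= s / 8.
  have : th <= s / (8 * (x0 ^+ 2 + 1)) by rewrite ge_min lexx orbT.
  rewrite ler_pdivlMr; last by lra.
  nra.
have thm : th * (4 * C + 1) <= m ^+ 2.
  have : th <= m ^+ 2 / (4 * C + 1) by rewrite ge_min lexx.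
  by rewrite ler_pdivlMr //; lra.
pose phi x := zh x - th * x ^+ 2.
have dphi : has_deriv phi (fun x => slope z x (x + h) - th * (2 * x)).
  move=> x; apply: is_deriveB; first exact: dzh.
  apply: is_derive_eq; rewrite /GRing.scale /=; ring.
have Cphi : C1 phi.
  apply: derive_C1 dphi _ => x; apply: cvgB; first exact: cdzh.
  by apply: cvgMr; apply: cvgMr; exact: cvg_id.
have cw : continuous (fun x => u x - phi x).
  by move=> x; apply: cvgB; [exact: cu|exact: (has_deriv_cont dphi)].
have zhB x : `|zh x| <= Bz + s / 8.
  have := ler_normD (z x) (zh x - z x); have -> : z x + (zh x - z x) = zh x by ring.
  by have := zhP x; have := zB x; lra.
have [|x1 x1P] := @min_coercive R _ (C / th + 1) cw.
  move=> x xC; rewrite /phi expr0n /= mulr0.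
  have := uB x; have := uB 0; have := zhB x; have := zhB 0; rewrite !ler_norml.
  move=> /andP[? ?] /andP[? ?] /andP[? ?] /andP[? ?].
  have Cth : 0 < C / th by rewrite divr_gt0.
  have : C <= th * x ^+ 2.
    rewrite -ler_pdivrMl // mulrC -real_normK ?num_real //.
    have : 1 <= `|x| by lra.
    by nra.
  by rewrite /C; lra.
have nx : \forall y \near x1, u x1 - phi x1 <= u y - phi y.
  by apply/nearP; exists 1 => // y _; exact: x1P.
have := su _ _ Cphi nx; rewrite /discounted (has_deriv_derive1 dphi) => key.
have h1 := x1P x0; have h2 := x1P 0; rewrite /phi in h1 h2 *.
rewrite expr0n /= mulr0 subr0 in h2.
have thx1 : 0 <= th * x1 ^+ 2 by rewrite mulr_ge0 ?sqr_ge0 // ltW.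
have small : `|th * (2 * x1)| < d1 /\ `|th * (2 * x1)| < 1.
  have : th * x1 ^+ 2 <= C.
    have := uB x1; have := uB 0; have := zhB x1; have := zhB 0; rewrite !ler_norml.
    by move=> /andP[? ?] /andP[? ?] /andP[? ?] /andP[? ?]; rewrite /C; lra.
  move=> hC; suff : `|th * (2 * x1)| <= m by lra.
  rewrite -(ler_pXn2r (n := 2)) ?nnegrE ?normr_ge0 ?(ltW m0) //.
  rewrite real_normK ?num_real //; apply: le_trans thm.
  have -> : (th * (2 * x1)) ^+ 2 = th * (4 * (th * x1 ^+ 2)) by ring.
  by rewrite ler_pM2l //; lra.
case: small => sm1 sm2.
have sB := slB x1; have ss := sl x1.
have q1 : G x1 (slope z x1 (x1 + h) - th * (2 * x1)) <= G x1 (slope z x1 (x1 + h)) + e.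
  have := dP1 x1 x1 (slope z x1 (x1 + h) - th * (2 * x1)) (slope z x1 (x1 + h)).
  rewrite subrr normr0 => /(_ d10).
  have -> : slope z x1 (x1 + h) - th * (2 * x1) - slope z x1 (x1 + h) = - (th * (2 * x1)) by ring.
  rewrite normrN => /(_ sm1).
  have b1 : `|slope z x1 (x1 + h) - th * (2 * x1)| <= B + 1.
    by apply: le_trans (ler_normB _ _) _; lra.
  have b2 : `|slope z x1 (x1 + h)| <= B + 1 by lra.
  by move=> /(_ b1 b2); rewrite ltr_norml => /andP[]; lra.
have z1 := zhP x1; have z2 := zhP x0; move: z1 z2; rewrite !ler_norml => /andP[z1 z1'] /andP[z2 z2'].
have fin : lam * (z x1 - u x1) <= 3 * e by lra.
have : s * (1 / 2) <= z x1 - u x1 by rewrite /s in s0 h0 hB thx0 *; lra.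
move=> fin2; have : lam * (s * (1/2)) <= lam * (z x1 - u x1) by rewrite ler_pM2l.
rewrite /e in fin e0; lra.
Qed.

End Comparison.

(** * Maximal slopes at a level, and the lowest level [minH] *)

Section Levels.
Variable R : realType.
Implicit Types (G H : R -> R -> R) (K f g u v : R -> R) (a b c d e x y z p q : R).

Definition pmax K a := sup [set p | K p <= a].

Lemma level_has_sup K a : coercive K -> (exists p, K p <= a) -> has_sup [set p | K p <= a].
Proof.
move=> coK ex; split=> //; have [B B0 BP] := coK (a + 1).
exists B => p /= Kp; rewrite leNgt; apply/negP => Bp.
have : B <= `|p| by apply: le_trans (ltW Bp) (ler_norm _).
by move=> /BP; lra.
Qed.

Lemma pmax_ge K a p : coercive K -> K p <= a -> p <= pmax K a.
Proof. by move=> coK Kp; apply: sup_upper_bound => //; apply: level_has_sup => //; exists p. Qed.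

Lemma pmax_gt K a p : coercive K -> pmax K a < p -> a < K p.
Proof. by move=> coK; rewrite !ltNge; apply: contra => /(pmax_ge coK). Qed.

Lemma pmax_level K a : continuous K -> coercive K -> (exists p, K p <= a) -> K (pmax K a) = a.
Proof.
move=> cK coK ex; have hs := level_has_sup coK ex.
apply/eqP; rewrite eq_le; apply/andP; split; apply/ler_addgt0Pr => e e0;
  have [d d0 dP] := (contP _).1 cK (pmax K a) _ e0.
  have [p Kp pP] := sup_adherent d0 hs.
  have := pmax_ge coK Kp; rewrite -/(pmax K a) in pP * => pP'.
  have pd : `|p - pmax K a| < d by rewrite ltr_norml; apply/andP; split; lra.
  by have := dP p pd; rewrite ltr_norml => /andP[? _]; rewrite /= in Kp; lra.
have := @pmax_gt K a (pmax K a + d / 2) coK; have h : pmax K a < pmax K a + d / 2 by lra.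
move=> /(_ h); have := dP (pmax K a + d / 2).
have -> : pmax K a + d / 2 - pmax K a = d / 2 by ring.
rewrite gtr0_norm; last lra.
have h2 : d / 2 < d by lra.
by move=> /(_ h2); rewrite ltr_norml => /andP[]; lra.
Qed.

Definition minH G x := inf (range (G x)).

Variable G : R -> R -> R.
Hypothesis gG : good G.

Lemma minH_lbound x : has_lbound (range (G x)).
Proof.
have [p pP] := coercive_min (good_cont gG (x := x)) (good_coercive gG x).
by exists (G x p) => _ [q _ <-]; exact: pP.
Qed.

Lemma minH_le x p : minH G x <= G x p.
Proof. by apply: inf_lbound; [exact: minH_lbound|exists p]. Qed.

Lemma minH_attained x : exists p, G x p = minH G x.
Proof.
have [p pP] := coercive_min (good_cont gG (x := x)) (good_coercive gG x).
exists p; apply/eqP; rewrite eq_le minH_le andbT.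
by apply: lb_le_inf; [exists (G x p), p|move=> _ [q _ <-]; exact: pP].
Qed.

Lemma minH_bounded : exists M : R, forall x, `|minH G x| <= M.
Proof.
have [M0 M0P] := good_bnd gG 0.
have [B B0 BP] := good_coer gG (M0 + 1).
have [M MP] := good_bnd gG B.
exists M => x; have [p pE] := minH_attained x; rewrite -pE; apply: MP.
rewrite leNgt; apply/negP => /ltW /(BP x).
have := M0P x 0; rewrite normr0 lexx => /(_ isT); rewrite ler_norml => /andP[_].
by have := minH_le x 0; lra.
Qed.

Lemma minH_unif e : 0 < e -> exists2 d : R, 0 < d & forall x z, `|z - x| < d -> minH G x <= minH G z + e.
Proof.
move=> e0; have [M MP] := minH_bounded.
have [d d0 dP] := sublevel_unif gG M e0; exists d => // x z xz.
have [p pE] := minH_attained z.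
have := dP x z p xz; have := MP z; rewrite ler_norml => /andP[_ h].
by rewrite pE => /(_ h); have := minH_le x p; lra.
Qed.

Lemma minH_cont : continuous (minH G).
Proof.
apply/contP => x e e0; have e20 : 0 < e / 2 by lra.
have [d d0 dP] := minH_unif e20; exists d => // y yx.
have := dP x y yx; have := dP y x; rewrite distrC => /(_ yx) h1 h2.
by rewrite ltr_norml; apply/andP; split; lra.
Qed.

(** A point slightly below [pmax], moved towards the minimiser, is strictly inside the sublevel set,
    and one slightly above is strictly outside; both facts persist nearby. With equality in place of
    [minH G x < f x], a flat bottom could make [pmax] jump. *)
Lemma pmax_cont f : continuous f -> (forall x, minH G x < f x) ->
  continuous (fun x => pmax (G x) (f x)).
Proof.
move=> cf mf; apply/contP => x e e0; set P := pmax (G x) (f x).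
have [p0 p0E] := minH_attained x.
have ex y : exists p, G y p <= f y.
  by have [p pE] := minH_attained y; exists p; rewrite pE ltW.
have GP : G x P = f x by apply: pmax_level; [exact: good_cont|exact: good_coercive|exact: ex].
have p0P : p0 <= P by apply: pmax_ge; [exact: good_coercive|rewrite p0E ltW].
have p0P' : p0 < P.
  rewrite lt_neqAle p0P andbT; apply/eqP => h; have := mf x.
  by rewrite -GP -h p0E ltxx.
pose t := Num.min 1 (e / 2 / (P - p0)).
have t0 : 0 < t by rewrite lt_min ltr01 !divr_gt0 ?subr_gt0.
have t1 : t <= 1 by rewrite ge_min lexx.
have te : t * (P - p0) <= e / 2 by rewrite -ler_pdivlMr ?subr_gt0 // ge_min lexx orbT.
pose p1 := t * p0 + (1 - t) * P.
have p1P : P - e < p1 by rewrite /p1; lra.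
have Gp1 : G x p1 < f x.
  apply: le_lt_trans (good_cvx gG x _ _ (ltW t0) t1) _.
  by rewrite GP p0E; have := mf x; nra.
have Gp2 : f x < G x (P + e / 2) by apply: pmax_gt; [exact: good_coercive|rewrite -/P; lra].
have near p : {for x, continuous (fun y => G y p - f y)}.
  by apply: cvgB; [exact: (good_cont1 gG)|exact: cf].
have [|d1 d10 dP1] := (cont_atP _ _).1 (near p1) (f x - G x p1); first lra.
have [|d2 d20 dP2] := (cont_atP _ _).1 (near (P + e / 2)) (G x (P + e / 2) - f x); first lra.
exists (Num.min d1 d2); first by rewrite lt_min d10.
move=> y; rewrite lt_min => /andP[/dP1 h1 /dP2 h2].
have [_ {}h1] := normlt h1; have [{}h2 _] := normlt h2.
have l1 : p1 <= pmax (G y) (f y) by apply: pmax_ge; [exact: good_coercive|lra].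
have l2 : pmax (G y) (f y) <= P + e / 2.
  rewrite leNgt; apply/negP => h.
  have Gy : G y (pmax (G y) (f y)) = f y by apply: pmax_level; [exact: good_cont|exact: good_coercive|exact: ex].
  have Gp1' : G y p1 <= f y by lra.
  have := @cvx_between _ _ (f y) p1 (P + e / 2) _ (good_cvx gG y) _ (ltW h) Gp1'.
  rewrite Gy => /(_ _ (lexx _)); suff : p1 <= P + e / 2 by move=> hh /(_ hh); lra.
  by rewrite /p1; have := p0P; nra.
by rewrite ltr_norml; apply/andP; split; lra.
Qed.

Lemma lsup_sub T (F : set_system T) (u : T -> R -> R) f : ProperFilter F -> continuous f ->
  (forall x, evb F (u ^~ x)) ->
  (forall e x y, 0 < e -> x < y -> \forall t \near F, forall z, x <= z -> z <= y ->
     subat (G z) (f z + e) (u t) z) ->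
  sub G f (fun x => lsup F (u ^~ x)).
Proof.
move=> FF cf bu su; apply: lsup_stable => // x0 e e0.
have e20 : 0 < e / 2 by lra.
have cf2 : {for x0, continuous (fun z => f z + e / 2)}.
  by apply: cvgD; [exact: cf|exact: cvg_cst].
have [d d0 dP] := sublevel_local gG cf2 e20.
exists d => // x y h1 xy h2; apply: filterS (su _ x y e20 xy) => t st.
have -> : f x0 + e = f x0 + e / 2 + e / 2 by lra.
apply: (mean_value xy _ st (good_cvx gG x0) (good_cont gG (x := x0))).
  by move=> z _ _; exact: good_CCC.
move=> z p xz zy; have zx : `|z - x0| < d by rewrite ltr_norml; apply/andP; split; lra.
exact: dP.
Qed.

Lemma C1_sub f u u' : has_deriv u u' -> continuous u' -> (forall x, G x (u' x) <= f x) -> sub G f u.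
Proof.
by move=> du cu Gu x; apply: (@subat_C1 _ _ _ _ u'); [exact: good_cont|exact: du|exact: cu|exact: Gu].
Qed.

Lemma lip_bound u (B : R) : (forall x y, x < y -> `|u y - u x| <= B * (y - x)) ->
  forall x y, `|u y - u x| <= B * `|y - x|.
Proof.
move=> uB x y; have [xy|yx|->] := ltgtP x y.
- by rewrite (gtr0_norm (_ : 0 < y - x)) ?subr_gt0 // uB.
- by rewrite distrC (distrC y) (gtr0_norm (_ : 0 < x - y)) ?subr_gt0 // uB.
- by rewrite !subrr normr0 mulr0.
Qed.

(** At the level [minH G] itself the maximal slope need not be continuous. So the maximal slopes at
    the levels [minH G + 1/(n+1)] are integrated, and the primitives, normalised at 0, pass to the
    upper limit. *)
Lemma minH_sub_exists : exists u, sub G (minH G) u.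
Proof.
pose f n x : R := minH G x + n.+1%:R^-1.
have n0 n : 0 < n.+1%:R^-1 :> R by rewrite invr_gt0.
have n1 n : n.+1%:R^-1 <= 1 :> R by rewrite invf_le1 // ler1n.
have cf n : continuous (f n) by move=> x; apply: cvgD; [exact: minH_cont|exact: cvg_cst].
have mf n x : minH G x < f n x by rewrite /f ltrDl.
have [Z ZP] := choice (fun n => primitive (pmax_cont (cf n) (mf n))).
have ex n x : exists p, G x p <= f n x.
  by have [p pE] := minH_attained x; exists p; rewrite pE ltW.
have sZ n : sub G (f n) (Z n).
  apply: C1_sub (ZP n) (pmax_cont (cf n) (mf n)) _ => x.
  by rewrite pmax_level //; [exact: good_cont|exact: good_coercive].
have [M MP] := minH_bounded.
have [B B0 BP] := sub_lip gG (M + 1).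
have fM n x : f n x <= M + 1.
  by rewrite /f lerD //; have := MP x; rewrite ler_norml => /andP[].
have ZB n := lip_bound (BP _ _ (sZ n) (fM n)).
exists (fun x => lsup \oo (fun n => Z n x - Z n 0)).
apply: (lsup_sub (u := fun n x => Z n x - Z n 0)).
- exact: minH_cont.
- by move=> x; exists (B * `|x - 0|); apply: nearW => n; exact: ZB.
move=> e x y e0 xy; near=> n => z _ _; apply: subat_shift.
apply: subat_le (sZ n z); rewrite /f lerD2l.
near: n; have /cvgrPdist_le /(_ _ e0) := @cvg_harmonic R.
by apply: filterS => n /=; rewrite sub0r normrN gtr0_norm.
Unshelve. all: by end_near. Qed.

End Levels.

(** * Integer translations and periodic functions *)

Section Periodicity.
Variable R : realType.
Implicit Types (w : R -> R) (x : R).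

Lemma periodic_int T (w : R -> T) : (forall x, w (x + 1) = w x) ->
  forall (n : int) x, w (x + n%:~R) = w x.
Proof.
move=> pw; have pn (n : nat) x : w (x + n%:R) = w x.
  elim: n => [|n IH]; first by rewrite addr0.
  by rewrite -addn1 natrD addrA pw IH.
case=> n x; first exact: pn.
rewrite NegzE mulrNz -(pn n.+1).
by congr w; rewrite /=; ring.
Qed.

Lemma floor_decomp x : exists n : int, 0 <= x - n%:~R < 1.
Proof.
exists (Num.floor x); have := floor_itv x; rewrite intrD => /andP[h1 h2].
by apply/andP; split; lra.
Qed.

Lemma periodic_bounded w : continuous w -> periodic w 1 -> exists M : R, forall x, `|w x| <= M.
Proof.
move=> cw pw; have [M _ MP] := bounded_seg 0 1 cw.
exists M => x; have [n /andP[h1 h2]] := floor_decomp x.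
have <- := periodic_int pw (- n) x; rewrite mulrNz; apply: MP; lra.
Qed.

End Periodicity.

(** * The given Hamiltonians satisfy the uniform bounds *)

Section Goodness.
Variable R : realType.
Implicit Types (H : R -> R -> R) (V : R -> R) (a b e x y p q : R).

(** Only [(x, p)] is confined to the box; [(y, q)] may leave it, so points near the boundary need no
    separate treatment. *)
Lemma unif_cont_compact (F : R * R -> R) a b B e : continuous F -> 0 < e ->
  exists2 d : R, 0 < d & forall x y p q, a <= x <= b -> `|p| <= B ->
    `|y - x| < d -> `|q - p| < d -> `|F (x, p) - F (y, q)| < e.
Proof.
move=> cF e0.
have cK : compact (`[a, b] `*` `[- B, B] : set (R * R)).
  by apply: compact_setX; exact: segment_compact.
pose P (d : R) (z : R * R) := forall y q, `|y - z.1| < d -> `|q - z.2| < d -> `|F z - F (y, q)| < e.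
have /near0P[d d0 dP] : \forall d \near 0^'+, `[a, b] `*` `[- B, B] `<=` P d.
  apply: ((compact_near_coveringP _).1 cK R (0^'+) P _).
  move=> z0 _; have e20 : 0 < e / 2 by lra.
  have /cvgrPdist_lt/(_ _ e20)/nbhs_ballP[d /= d0 dP] := cF z0.
  have d20 : 0 < d / 2 by lra.
  exists (ball z0 (d / 2), [set r | r < d / 2]).
    split; first exact: nbhsx_ballx.
    by apply/near0P; exists (d / 2).
  move=> [z r] /= [zb rd] y q yz qz.
  case: zb => zb1 zb2; rewrite /ball /= in zb1 zb2.
  have h1 : `|F z0 - F z| < e / 2.
    by apply: dP; split; rewrite /ball /=; lra.
  have h2 : `|F z0 - F (y, q)| < e / 2.
    apply: dP; split; rewrite /ball /=.
      by have := ler_distD z.1 z0.1 y; rewrite (distrC z.1 y); lra.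
    by have := ler_distD z.2 z0.2 q; rewrite (distrC z.2 q); lra.
  by have := ler_distD (F z0) (F z) (F (y, q)); rewrite (distrC (F z) (F z0)); lra.
exists (d / 2); first lra.
move=> x y p q xab pB yx qp.
have d2 : 0 < d / 2 by lra.
apply: (dP (d / 2) d2) => //=; first lra.
by rewrite !in_itv /= xab -ler_norml.
Qed.

Lemma admissible_good H : admissible H -> good H.
Proof.
move=> [cH pH cvH slH].
have HI (n : int) x p : H (x + n%:~R) p = H x p.
  by rewrite (periodic_int (w := fun x => H x)) // => y; apply/funext => q; exact: pH.
split.
- move=> x p q t t0 t1; have := cvH x (Itv01 t0 t1) p q; rewrite !inE => /(_ I I).
  by rewrite convRE /=; exact.
- move=> B e e0; have [d d0 dP] := unif_cont_compact (- 1) 2 (B + 1) cH e0.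
  exists d => // x y p q xy pq pB qB; have [n nx] := floor_decomp x.
  have := dP (x - n%:~R) (y - n%:~R) p q; rewrite /= -!mulrNz !HI.
  apply; first by move: nx => /andP[]; lra.
  + lra.
  + have -> : y + (- n)%:~R - (x + (- n)%:~R) = y - x by ring.
    by rewrite distrC.
  + by rewrite distrC.
- move=> M; have [B [B0 BP]] := slH `|M|.
  (* Having [|p| >= 1] turns the bound on the quotient into one on [H x p]; [|M|] makes the sign of
     [M] irrelevant. *)
  exists (Num.max B 1); first by rewrite lt_max B0.
  move=> x p; rewrite ge_max => /andP[/(BP x) + p1].
  rewrite ler_pdivlMr; last lra.
  have := ler_norm M; have := normr_ge0 M; nra.
- move=> B; have [d d0 dP] := unif_cont_compact 0 1 B cH ltr01.
  have cK : compact (`[0, 1] `*` `[- B, B] : set (R * R)).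
    by apply: compact_setX; exact: segment_compact.
  have [B0|B0] := leP 0 B; last first.
    by exists 0 => x p pB; have := normr_ge0 p; lra.
  have [||z _ zP] := @compact_EVT_max _ R (fun z => `|H z.1 z.2|) _ _ cK.
  + by exists (0, 0); split; rewrite /= in_itv /=; lra.
  + by apply: continuous_subspaceT => z; apply: cvg_norm; exact: cH.
  exists `|H z.1 z.2| => x p pB; have [n nx] := floor_decomp x.
  rewrite -(HI (- n)) mulrNz; apply: (zP (x - n%:~R, p)).
  rewrite inE; split; rewrite /= in_itv /= -?ler_norml //; move: nx => /andP[]; lra.
Qed.

Lemma supp_seg V : compact (supp V) -> exists A : R, 0 < A /\ forall x, A < `|x| -> V x = 0.
Proof.
move=> /compact_bounded; rewrite /bounded_set /=.
move=> [M [_ MP]]; exists (`|M| + 1); split; first by rewrite ltr_wpDl.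
move=> x xM; apply/eqP; apply: contraT => Vx.
have sx : supp V x by apply: subset_closure.
have : M < `|M| + 1 by have := ler_norm M; lra.
by move=> /MP /(_ x sx) /=; lra.
Qed.

Lemma potential_good H V : good H -> continuous V -> compact (supp V) -> good (sub_potential H V).
Proof.
move=> gH cV /supp_seg[A [A0 VA]].
have [Mv _ MvP] := bounded_seg (- A) A cV.
have VB x : `|V x| <= Mv + 1.
  have [xA|xA] := leP `|x| A.
    by have := MvP x; rewrite -ler_norml => /(_ xA); lra.
  rewrite VA // normr0; have := MvP A; have := normr_ge0 (V A).
  by move=> h1 h2; have := h2 _; lra.
have cF : continuous (fun z : R * R => V z.1).
  by move=> z; apply: continuous_comp; [exact: cvg_fst|exact: cV].
split.
- move=> x p q t t0 t1; rewrite /sub_potential; have := good_cvx gH x p q t0 t1; lra.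
- move=> B e e0; have e20 : 0 < e / 2 by lra.
  have [d1 d10 dP1] := good_ucont gH B e20.
  have [d2 d20 dP2] := unif_cont_compact (- (A + 1)) (A + 1) 0 cF e20.
  exists (Num.min (Num.min d1 d2) 1); first by rewrite !lt_min d10 d20 ltr01.
  move=> x y p q; rewrite !lt_min => /andP[/andP[x1 x2] x3] /andP[/andP[p1 p2] p3] pB qB.
  have h1 := dP1 x y p q x1 p1 pB qB.
  suff h2 : `|V x - V y| < e / 2.
    have := ler_normB (H x p - H y q) (V x - V y); rewrite /sub_potential.
    have -> : H x p - V x - (H y q - V y) = H x p - H y q - (V x - V y) by ring.
    lra.
  have [xA|xA] := leP `|x| (A + 1).
    have := dP2 x y 0 0; rewrite /= subrr normr0 -ler_norml distrC; exact.
  have yA : A < `|y|.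
    by have := ler_normD y (x - y); have -> : y + (x - y) = x by [ring]; lra.
  by rewrite !VA ?subrr ?normr0 //; lra.
- move=> M; have [B B0 BP] := good_coer gH (M + (Mv + 1)); exists B => // x p /(BP x).
  by rewrite /sub_potential; have := VB x; rewrite ler_norml => /andP[]; lra.
- move=> B; have [M MP] := good_bnd gH B; exists (M + (Mv + 1)) => x p /(MP x).
  by have := VB x; have := ler_normB (H x p) (V x); rewrite /sub_potential; lra.
Qed.

End Goodness.

(** * Critical values, gluing, and translation limits *)

Section CriticalValues.
Variable R : realType.
Implicit Types (G H : R -> R -> R) (f g u v w : R -> R) (a b c d e x y z p q : R).

Section OneHamiltonian.
Variable G : R -> R -> R.
Hypothesis gG : good G.

Lemma minH_le_sub a u x : sub G (fun=> a) u -> minH G x <= a.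
Proof.
move=> su; have [p Gp] := subat_nonempty (good_cont gG (x := x)) (good_coercive gG x) (su x).
exact: le_trans (minH_le gG x p) Gp.
Qed.

Lemma sub_cst_le a a' u : a <= a' -> sub G (fun=> a) u -> sub G (fun=> a') u.
Proof. by move=> aa su x; apply: subat_le aa (su x). Qed.

Lemma c_freeE : c_free G = inf [set a | exists u, sub G (fun=> a) u].
Proof.
rewrite /c_free; congr inf; apply/seteqP.
by split=> a [u]; [move/(visc_sub_stationaryP gG)|move/(visc_sub_stationaryP gG)]; exists u.
Qed.

Lemma c_boundedE : c_bounded G = inf [set a | exists u, bounded_fun u /\ sub G (fun=> a) u].
Proof.
rewrite /c_bounded; congr inf; apply/seteqP.
by split=> a [u [bu]]; [move/(visc_sub_stationaryP gG)|move/(visc_sub_stationaryP gG)]; exists u.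
Qed.

Lemma sub_zero : exists a, sub G (fun=> a) (fun=> 0).
Proof.
have [M MP] := good_bnd gG 0; exists M; apply: (C1_sub gG (u' := fun=> 0)).
- by move=> x; exact: is_derive_cst.
- by move=> x; exact: cvg_cst.
- by move=> x; have := MP x 0; rewrite normr0 lexx => /(_ isT); apply: le_trans (ler_norm _).
Qed.

Lemma minH_le_c_free x : minH G x <= c_free G.
Proof.
rewrite c_freeE; apply: lb_le_inf.
  by have [a sa] := sub_zero; exists a, (fun=> 0).
by move=> a [u]; exact: minH_le_sub.
Qed.

(** In dimension one the pointwise obstruction is the only one: together with [minH_le_c_free], the
    free critical value is the supremum of [minH G]. *)
Lemma c_free_le a : (forall x, minH G x <= a) -> c_free G <= a.
Proof.
move=> ma; rewrite c_freeE; apply: inf_lbound.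
  by exists (minH G 0) => b [u]; exact: minH_le_sub.
have [u su] := minH_sub_exists gG; exists u => x; exact: subat_le (ma x) (su x).
Qed.

Lemma free_sub_cst a : c_free G <= a -> exists u, sub G (fun=> a) u.
Proof.
move=> ca; have [u su] := minH_sub_exists gG; exists u => x.
by apply: subat_le (su x); apply: le_trans (minH_le_c_free x) ca.
Qed.

Lemma c_bounded_le a u : bounded_fun u -> sub G (fun=> a) u -> c_bounded G <= a.
Proof.
move=> bu su; rewrite c_boundedE; apply: inf_lbound; last by exists u.
by exists (minH G 0) => b [v [_]]; exact: minH_le_sub.
Qed.

Lemma c_bounded_approx e : 0 < e -> exists u, bounded_fun u /\ sub G (fun=> c_bounded G + e) u.
Proof.
move=> e0; have := @inf_adherent _ [set a | exists u, bounded_fun u /\ sub G (fun=> a) u] _ e0.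
rewrite -c_boundedE => -[].
  split; last by exists (minH G 0) => b [v [_]]; exact: minH_le_sub.
  have [a sa] := sub_zero; exists a, (fun=> 0); split=> //.
  by apply/boundedP; exists 0 => x; rewrite normr0.
by move=> a [u [bu su]] ae; exists u; split=> //; apply: sub_cst_le su; exact: ltW.
Qed.

Lemma c_free_le_bounded : c_free G <= c_bounded G.
Proof.
apply/ler_addgt0Pr => e /c_bounded_approx[u [_ su]].
by apply: c_free_le => x; exact: minH_le_sub su.
Qed.

End OneHamiltonian.

Section Glue.
Variable G : R -> R -> R.
Hypothesis gG : good G.

Definition join2 a u v : R -> R := fun y => if y <= a then u y else v y.

Lemma join2_l a u v y : y <= a -> join2 a u v y = u y.
Proof. by rewrite /join2 => ->. Qed.

Lemma join2_r a u v y : u a = v a -> a <= y -> join2 a u v y = v y.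
Proof.
move=> uv ay; rewrite /join2; case: (leP y a) => // ya.
by have -> : y = a by lra.
Qed.

Lemma subat_join2 f a u v z : u a = v a ->
  (z <= a -> subat (G z) (f z) u z) -> (a <= z -> subat (G z) (f z) v z) ->
  subat (G z) (f z) (join2 a u v) z.
Proof.
move=> uv su sv; have [za|az|za] := ltgtP z a.
- apply: (subat_local (d := a - z)) (su (ltW za)); first by rewrite subr_gt0.
  by move=> y /normlt[_ h]; rewrite join2_l //; lra.
- apply: (subat_local (d := z - a)) (sv (ltW az)); first by rewrite subr_gt0.
  by move=> y /normlt[h _]; rewrite join2_r //; lra.
- subst z; apply: subat_glue => //; [exact: good_cvx|exact: su|exact: sv].
Qed.

(** The middle piece is kept; the outer ones are shifted by constants to fit, which leaves their
    slopes unchanged. *)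
Definition join3 a b u v w := join2 b (join2 a (fun y => u y + (v a - u a)) v) (fun y => w y + (v b - w b)).

Lemma join3_l a b u v w y : a <= b -> y <= a -> join3 a b u v w y = u y + (v a - u a).
Proof. by move=> ab ya; rewrite /join3 (join2_l _ _ (le_trans ya ab)) join2_l. Qed.

Lemma join3_m a b u v w y : a <= y -> y <= b -> join3 a b u v w y = v y.
Proof. by move=> ay yb; rewrite /join3 join2_l // join2_r //; ring. Qed.

Lemma join3_r a b u v w y : a <= b -> b <= y -> join3 a b u v w y = w y + (v b - w b).
Proof. by move=> ab yb; rewrite /join3 join2_r // join2_r //; ring. Qed.

Lemma subat_join3 f a b u v w : a <= b ->
  (forall z, z <= a -> subat (G z) (f z) u z) ->
  (forall z, a <= z -> z <= b -> subat (G z) (f z) v z) ->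
  (forall z, b <= z -> subat (G z) (f z) w z) ->
  sub G f (join3 a b u v w).
Proof.
move=> ab su sv sw z; rewrite /join3.
apply: subat_join2; first by rewrite join2_r //; ring.
  move=> zb; apply: subat_join2; first by ring.
  + by move=> za; apply: subat_shift; exact: su.
  + by move=> za; exact: sv.
by move=> bz; apply: subat_shift; exact: sw.
Qed.

Lemma join3_bounded a b u v w (Bu Bw : R) : a <= b -> (forall x, x <= a -> `|u x| <= Bu) ->
  continuous v -> (forall x, b <= x -> `|w x| <= Bw) -> bounded_fun (join3 a b u v w).
Proof.
move=> ab uB cv wB; have [Bv Bv0 vB] := bounded_seg a b cv.
apply/boundedP; exists (Bu + `|v a - u a| + Bv + Bw + `|v b - w b|) => x.
have hu := uB x; have hw := wB x; have hv := vB x.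
have h1 := normr_ge0 (v a - u a); have h2 := normr_ge0 (v b - w b).
have h3 := le_trans (normr_ge0 _) (uB a (lexx _)).
have h4 := le_trans (normr_ge0 _) (wB b (lexx _)).
have [xa|ax] := leP x a.
  by rewrite join3_l //; have := ler_normD (u x) (v a - u a); have := hu xa; lra.
have [xb|bx] := leP x b.
  rewrite join3_m ?(ltW ax) //.
  by have : `|v x| <= Bv by [apply: hv; lra]; lra.
by rewrite join3_r ?(ltW bx) //; have := ler_normD (w x) (v b - w b); have := hw (ltW bx); lra.
Qed.

End Glue.

Section Translates.
Variables (G H : R -> R -> R) (d : R).
Hypothesis gG : good G.
Hypothesis gH : good H.
Hypothesis dE : d = 1 \/ d = -1.
Hypothesis GH : forall x y, \forall k \near \oo, forall z, x <= z -> z <= y ->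
  G (z + d * k%:R) = H z.

(** Integer translation pushes the perturbation off to infinity, turning subsolutions for [G] into
    subsolutions for [H]; an upper limit ignores an index shift, hence the result is periodic. *)
Definition tlim v x := lsup \oo (fun k : nat => v (x + d * k%:R)).

Lemma tlim_evb v x : bounded_fun v -> evb \oo (fun k : nat => v (x + d * k%:R)).
Proof. by move=> /boundedP[M MP]; exists M; apply: nearW => k; exact: MP. Qed.

Lemma tlim_bounded v : bounded_fun v -> bounded_fun (tlim v).
Proof.
move=> bv; have /boundedP[M MP] := bv; apply/boundedP; exists M => x.
rewrite ler_norml; apply/andP; split.
  apply: lsup_ge; first exact: tlim_evb.
  by apply: nearW => k; have := MP (x + d * k%:R); rewrite ler_norml => /andP[].
apply: lsup_le; first exact: tlim_evb.
by apply: nearW => k; have := MP (x + d * k%:R); rewrite ler_norml => /andP[].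
Qed.

Lemma tlim_sub v a : bounded_fun v -> sub G (fun=> a) v -> sub H (fun=> a) (tlim v).
Proof.
move=> bv sv; apply: (lsup_sub gH (u := fun (k : nat) x => v (x + d * k%:R))).
- by move=> x; exact: cvg_cst.
- by move=> x; exact: tlim_evb.
- move=> e x y e0 xy; apply: filterS (GH x y) => k GHk z xz zy.
  apply: (@subat_le _ _ a); first lra.
  by rewrite -GHk //; apply: subat_translate; exact: sv.
Qed.

Lemma near_infty_S (P : nat -> Prop) : (\forall k \near \oo, P k.+1) <-> \forall k \near \oo, P k.
Proof.
split=> [[N _ NP]|[N _ NP]].
  by exists N.+1 => // -[//|k] /= kN; apply: NP.
by exists N => // k /= kN; apply: NP; rewrite /= leqW.
Qed.

Lemma lsup_S (h : nat -> R) : lsup \oo (fun k => h k.+1) = lsup \oo h.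
Proof.
rewrite /lsup; congr inf; apply/seteqP; split=> r /= hr.
  exact: (near_infty_S (fun k => h k <= r)).1 hr.
exact: (near_infty_S (fun k => h k <= r)).2 hr.
Qed.

Lemma tlim_periodic v : periodic (tlim v) 1.
Proof.
move=> x; rewrite /tlim; case: dE => ->.
  rewrite -[RHS](lsup_S (fun k => v (x + 1 * k%:R))); congr lsup; apply/funext => k.
  by congr v; rewrite -addn1 natrD; ring.
rewrite -[LHS](lsup_S (fun k => v (x + 1 + -1 * k%:R))); congr lsup; apply/funext => k.
by congr v; rewrite -addn1 natrD; ring.
Qed.

End Translates.

Section Periodic.
Variable H : R -> R -> R.
Hypothesis gH : good H.
Hypothesis pH : forall x, H (x + 1) = H x.

Lemma periodic_translate d : d = 1 \/ d = -1 -> forall x y : R, \forall k \near \oo, forall z, x <= z -> z <= y ->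
  H (z + d * k%:R) = H z.
Proof.
move=> dE x y; apply: nearW => k z _ _.
case: dE => ->; first by rewrite mul1r; exact: (periodic_int pH k).
have := periodic_int pH (- k%:Z) z; rewrite mulrNz => <-; congr H.
by rewrite mulN1r.
Qed.

Lemma sub_periodic v a : bounded_fun v -> sub H (fun=> a) v ->
  exists w, [/\ bounded_fun w, sub H (fun=> a) w & periodic w 1].
Proof.
move=> bv sv; exists (tlim 1 v); split.
- exact: tlim_bounded.
- by apply: tlim_sub sv => //; apply: periodic_translate; left.
- by apply: tlim_periodic; left.
Qed.

(** Approximate subsolutions made periodic and normalised at 0 have a continuous periodic upper
    limit, which is bounded; so the infimum defining [c_bounded H] is attained. *)
Lemma critical_periodic : exists w, [/\ bounded_fun w, sub H (fun=> c_bounded H) w & periodic w 1].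
Proof.
have ex (n : nat) : exists w, [/\ bounded_fun w, sub H (fun=> c_bounded H + n.+1%:R^-1) w & periodic w 1].
  have n0 : 0 < n.+1%:R^-1 :> R by rewrite invr_gt0.
  by have [v [bv sv]] := c_bounded_approx gH n0; exact: sub_periodic sv.
have [W WP] := choice ex.
have n1 (n : nat) : n.+1%:R^-1 <= 1 :> R by rewrite invf_le1 // ler1n.
have [B B0 BP] := sub_lip gH (c_bounded H + 1).
have WB n := lip_bound (BP _ _ (let: And3 _ h _ := WP n in h) (fun=> lerD (lexx _) (n1 n))).
pose w x := lsup \oo (fun n => W n x - W n 0).
have wE x : evb \oo (fun n => W n x - W n 0).
  by exists (B * `|x - 0|); apply: nearW => n; exact: WB.
have sw : sub H (fun=> c_bounded H) w.
  apply: (lsup_sub gH (u := fun n x => W n x - W n 0)) => //.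
    by move=> x; exact: cvg_cst.
  move=> e x y e0 xy; near=> n => z _ _; apply: subat_shift.
  have [_ sW _] := WP n; apply: subat_le (sW z); rewrite lerD2l.
  near: n; have /cvgrPdist_le /(_ _ e0) := @cvg_harmonic R.
  by apply: filterS => n /=; rewrite sub0r normrN gtr0_norm.
have pw : periodic w 1.
  by move=> x; apply: lsup_eq; apply: nearW => n; have [_ _ ->] := WP n.
exists w; split=> //; have [M MP] := periodic_bounded (sub_cont gH sw) pw.
by apply/boundedP; exists M.
Unshelve. all: by end_near. Qed.

End Periodic.

Section Perturbation.
Variables (G H : R -> R -> R) (a b : R).
Hypotheses (gG : good G) (gH : good H) (pH : forall x, H (x + 1) = H x).
Hypothesis ab : a <= b.
Hypotheses (GHl : forall z, z <= a -> G z = H z) (GHr : forall z, b <= z -> G z = H z).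

Lemma perturb_translate d : d = 1 \/ d = -1 -> forall x y : R, \forall k \near \oo, forall z, x <= z -> z <= y ->
  G (z + d * k%:R) = H z.
Proof.
move=> dE x y; near=> k => z xz zy.
have kx : `|x| + `|y| + `|a| + `|b| <= k%:R by near: k; exact: nbhs_infty_ger.
have hx := ler_normlP _ _ (lexx `|x|); have hy := ler_normlP _ _ (lexx `|y|).
have ha := ler_normlP _ _ (lexx `|a|); have hb := ler_normlP _ _ (lexx `|b|).
have nx := normr_ge0 x; have ny := normr_ge0 y; have na := normr_ge0 a; have nb := normr_ge0 b.
case: hx => hx1 hx2; case: hy => hy1 hy2; case: ha => ha1 ha2; case: hb => hb1 hb2.
case: dE => dE.
  rewrite GHr; last by rewrite dE; lra.
  by rewrite dE mul1r; exact: (periodic_int pH k).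
rewrite GHl; last by rewrite dE; lra.
have := periodic_int pH (- k%:Z) z; rewrite mulrNz => <-; congr H.
by rewrite dE mulN1r.
Unshelve. all: by end_near. Qed.

Lemma c_bounded_perturb_ge : c_bounded H <= c_bounded G.
Proof.
apply/ler_addgt0Pr => e /(c_bounded_approx gG)[u [bu su]].
apply: (c_bounded_le gH (u := tlim 1 u)); first exact: tlim_bounded.
by apply: tlim_sub su => //; apply: perturb_translate; left.
Qed.

Lemma c_free_perturb_ge : c_free H <= c_free G.
Proof.
apply: (c_free_le gH) => x.
have [N _ NP] := perturb_translate (or_introl erefl) x x.
have := NP N (leqnn N) x (lexx _) (lexx _).
rewrite /minH => <-; exact: (minH_le_c_free gG).
Qed.

(** A free subsolution for [G] may be unbounded, but only its part over [[a, b]] is kept; a bounded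
    critical one for [H] continues it outside. Hence [c_bounded G] is the maximum of [c_bounded H]
    and [c_free G]. *)
Lemma perturb_bounded_sub c : c_bounded H <= c -> c_free G <= c ->
  exists v, bounded_fun v /\ sub G (fun=> c) v.
Proof.
move=> cH cG; have [w [bw sw _]] := critical_periodic gH pH.
have [v sv] := free_sub_cst gG cG.
exists (join3 a b w v w); split.
  have [M MP] := (boundedP w).1 bw.
  by apply: (join3_bounded (Bu := M) (Bw := M)) => //; exact: (sub_cont gG sv).
apply: subat_join3 => // [z za|z bz].
- by rewrite GHl //; apply: subat_le cH (sw z).
- by rewrite GHr //; apply: subat_le cH (sw z).
Qed.

Lemma c_bounded_perturb_le c : c_bounded H <= c -> c_free G <= c -> c_bounded G <= c.
Proof. by move=> cH cG; have [v [bv sv]] := perturb_bounded_sub cH cG; exact: (c_bounded_le gG bv sv). Qed.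

Lemma critical_bounded_sub : exists v, bounded_fun v /\ sub G (fun=> c_bounded G) v.
Proof. by apply: perturb_bounded_sub; [exact: c_bounded_perturb_ge|exact: c_free_le_bounded]. Qed.

End Perturbation.

End CriticalValues.

(** * From pointwise to locally uniform convergence *)

Section CompactConvergence.
Variable R : realType.

Lemma equi_lip_cvg (u : R -> R -> R) (u0 : R -> R) (B : R) : 0 < B ->
  (forall lam x y, 0 < lam -> lam <= 1 -> `|u lam y - u lam x| <= B * `|y - x|) ->
  (forall x y, `|u0 y - u0 x| <= B * `|y - x|) ->
  (forall x e : R, 0 < e -> \forall lam \near 0^'+, `|u lam x - u0 x| <= e) ->
  {family compact, u lam @[lam --> 0^'+] --> u0}.
Proof.
move=> B0 uB u0B ux.
have FF : Filter (u lam @[lam --> 0^'+]) by apply: fmap_filter.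
apply/fam_cvgP => A cA P /uniform_nbhs[E [entE EP]].
have [e /= e0 eE] : exists2 e : R, 0 < e & [set z : R * R | ball z.1 e z.2] `<=` E.
  by move: entE; rewrite -entourage_ballE => -[e e0 eE]; exists e.
suff : \forall lam \near 0^'+, A `<=` (fun x => `|u lam x - u0 x| < e).
  apply: filterS => lam uA; apply: EP => x Ax; apply: eE => /=.
  by rewrite /ball /= distrC; exact: uA.
apply: ((compact_near_coveringP _).1 cA R (0^'+) (fun lam x => `|u lam x - u0 x| < e)).
move=> x0 _; have e40 : 0 < e / 4 by lra.
exists (ball x0 (e / 4 / B), [set lam | 0 < lam /\ lam <= 1 /\ `|u lam x0 - u0 x0| <= e / 4]).
  split; first by apply: nbhsx_ballx; rewrite divr_gt0.
  apply: filterS2 (ux x0 _ e40) ((near0P (fun lam => 0 < lam /\ lam <= 1)).2 _).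
    by move=> lam h [h1 h2].
  by exists 1 => // y y0 y1; split=> //; exact: ltW.
move=> [x lam] /= [xb [l0 [l1 ul]]].
have {}xb : B * `|x - x0| < e / 4 by rewrite mulrC -ltr_pdivlMr // distrC.
have h1 := uB _ x0 x l0 l1; have h2 := u0B x0 x.
have -> : u lam x - u0 x = (u lam x - u lam x0) + (u lam x0 - u0 x0) - (u0 x - u0 x0) by ring.
apply: le_lt_trans (ler_normB _ _) _.
by have := ler_normD (u lam x - u lam x0) (u lam x0 - u0 x0); lra.
Qed.

End CompactConvergence.

(** * The discounted family: bounds, upper limit, lower estimate *)

Section DiscountedFamily.
Variable R : realType.
Implicit Types (f v w z : R -> R) (a b d e x y p q l r lam rho : R).

(** As an inequality it defines the empty set when [c] exceeds the free critical value; the sign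
    condition on it then disappears without a case distinction. *)
Definition Eset (G : R -> R -> R) (c : R) : set R := [set y | forall p, c <= G y p].

Variables (G : R -> R -> R) (c : R) (u : R -> R -> R) (vb : R -> R).
Hypothesis gG : good G.
Hypothesis bu : forall lam, 0 < lam -> bounded_fun (u lam).
Hypothesis su : forall lam, 0 < lam -> visc_sol (discounted G lam c) (u lam).
Hypothesis bvb : bounded_fun vb.
Hypothesis svb : sub G (fun=> c) vb.

Lemma fam_sub lam : 0 < lam -> sub G (fun x => c - lam * u lam x) (u lam).
Proof. by move=> l0; apply: visc_sub_discounted => //; exact: (su l0).1. Qed.

Lemma fam_cmp lam z : 0 < lam -> bounded_fun z -> sub G (fun x => c - lam * z x) z ->
  forall x, z x <= u lam x.
Proof. by move=> l0 bz sz; apply: (comparison gG l0 bz (bu l0) sz); exact: (su l0).2. Qed.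

(** A bounded subsolution shifted to be nonpositive is a discounted one for every [lam]. *)
Lemma fam_lower : exists2 C : R, 0 < C & forall lam x, 0 < lam -> - C <= u lam x.
Proof.
have [M MP] := (boundedP _).1 bvb.
have M0 : 0 <= M by apply: le_trans (MP 0); rewrite normr_ge0.
exists (2 * M + 1) => [|lam x l0]; first lra.
apply: le_trans (_ : vb x + - M <= _).
  by have := MP x; rewrite ler_norml => /andP[]; lra.
apply: (@fam_cmp lam (fun x => vb x + - M)) => //.
  apply/boundedP; exists (2 * M) => y; have := MP y; rewrite !ler_norml => /andP[h1 h2].
  by apply/andP; split; lra.
move=> y; apply: subat_shift; apply: subat_le (svb y).
have := MP y; rewrite !ler_norml => /andP[_ h2].
have : lam * (vb y + - M) <= 0 by rewrite mulr_ge0_le0 ?(ltW l0) //; lra.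
lra.
Qed.

Lemma fam_lip : exists2 B : R, 0 < B & forall lam x y, 0 < lam -> lam <= 1 ->
  `|u lam y - u lam x| <= B * `|y - x|.
Proof.
have [C C0 CP] := fam_lower; have [B B0 BP] := sub_lip gG (c + C).
exists B => // lam x y l0 l1; apply: lip_bound; apply: BP (fam_sub l0) _ => t.
by have := CP lam t l0; nra.
Qed.

(** At such a point no momentum reaches a level below [c], so [c - lam * u lam y] cannot be below
    [c]. *)
Lemma fam_le0 lam y : 0 < lam -> Eset G c y -> u lam y <= 0.
Proof.
move=> l0 Ey.
have [p Gp] := subat_nonempty (good_cont gG (x := y)) (good_coercive gG y) (fam_sub l0 y).
have := Ey p => h; have : lam * u lam y <= 0 by lra.
by rewrite pmulr_rle0.
Qed.

Definition ustar x := lsup (0^'+) (fun lam => u lam x).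

Lemma near_pos e : 0 < e -> \forall lam \near (0:R)^'+, 0 < lam /\ lam <= e.
Proof. by move=> e0; apply/near0P; exists e => // y y0 /ltW. Qed.

Section UpperLimit.
Hypothesis ub : forall x, exists M : R, \forall lam \near 0^'+, u lam x <= M.

Lemma ustar_evb x : evb (0^'+) (fun lam => u lam x).
Proof.
have [M MP] := ub x; have [C C0 CP] := fam_lower.
exists (`|M| + C); apply: filterS2 MP (near_pos ltr01) => lam uM [l0 _].
have := CP lam x l0; have := ler_norm M; have := normr_ge0 M.
by rewrite ler_norml => h1 h2 h3; apply/andP; split; lra.
Qed.

Lemma ustar_sub : sub G (fun=> c) ustar.
Proof.
have [C C0 CP] := fam_lower.
apply: (lsup_sub gG (u := u)); [by move=> x; exact: cvg_cst|exact: ustar_evb|].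
move=> e x y e0 xy; have eC : 0 < e / C by rewrite divr_gt0.
apply: filterS (near_pos eC) => lam [l0 le] z _ _.
apply: subat_le (fam_sub l0 z).
have : lam * C <= e by rewrite -ler_pdivlMr.
by have := CP lam z l0; nra.
Qed.

Lemma ustar_le0 y : Eset G c y -> ustar y <= 0.
Proof.
move=> Ey; apply: lsup_le; first exact: ustar_evb.
by apply: filterS (near_pos ltr01) => lam [l0 _]; exact: fam_le0.
Qed.

Lemma ustar_lower : exists C : R, forall x, - C <= ustar x.
Proof.
have [C C0 CP] := fam_lower; exists C => x; apply: lsup_ge; first exact: ustar_evb.
by apply: filterS (near_pos ltr01) => lam [l0 _]; exact: CP.
Qed.

Lemma ustar_le x M : (\forall lam \near 0^'+, u lam x <= M) -> ustar x <= M.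
Proof. by move=> h; apply: lsup_le => //; exact: ustar_evb. Qed.

Lemma ustar_ge x M : (\forall lam \near 0^'+, M <= u lam x) -> M <= ustar x.
Proof. by move=> h; apply: lsup_ge => //; exact: ustar_evb. Qed.

Lemma ustar_cvg : (forall x e, 0 < e -> \forall lam \near 0^'+, ustar x - e <= u lam x) ->
  {family compact, u lam @[lam --> 0^'+] --> ustar}.
Proof.
move=> lo; have [B B0 BP] := fam_lip.
apply: (equi_lip_cvg B0 BP).
  move=> x y; have h x1 y1 : ustar y1 <= ustar x1 + B * `|y1 - x1|.
    apply: lsup_add_le; [exact: ustar_evb|exact: ustar_evb|].
    apply: filterS (near_pos ltr01) => lam [l0 l1].
    by have := BP lam x1 y1 l0 l1; rewrite ler_norml => /andP[]; lra.
  rewrite ler_norml; apply/andP; split; last by have := h x y; lra.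
  by have := h y x; rewrite distrC; lra.
move=> x e e0; apply: filterS2 (lo x e e0) (lsup_eps _ (ustar_evb x) e0) => lam h1 h2.
by rewrite ler_norml; apply/andP; split; rewrite /ustar in h1 *; lra.
Qed.

End UpperLimit.

(** A piece with prescribed value [rho] at [l], to be joined there without any shift, since an
    upward shift could spoil the discounted inequality. *)
Definition outer (D : R -> Prop) lam l rho := exists z, exists M : R, [/\ forall x, D x -> `|z x| <= M,
  z l = rho & forall x, D x -> subat (G x) (c - lam * z x) z x].

Lemma lower_bound l r v : l <= r -> sub G (fun=> c) v ->
  (forall y, l <= y -> y <= r -> Eset G c y -> v y <= 0) ->
  (forall rho, rho < v l -> \forall lam \near 0^'+, outer (fun x => x <= l) lam l rho) ->
  (forall rho, rho < v r -> \forall lam \near 0^'+, outer (fun x => r <= x) lam r rho) ->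
  forall e, 0 < e -> \forall lam \near 0^'+, forall x, l <= x -> x <= r -> v x - e <= u lam x.
Proof.
move=> lr sv vE outl outr e e0.
have [vs svs] := minH_sub_exists gG.
have cv := sub_cont gG sv; have cvs := sub_cont gG svs.
have cd : continuous (fun x => vs x - v x) by move=> x; apply: cvgB; [exact: cvs|exact: cv].
have [D D0 DP] := bounded_seg l r cd.
have [Bv Bv0 BvP] := bounded_seg l r cv.
(* Keeps [z] within [e / 4] of [v - e / 2] on [[l, r]]. *)
pose th := Num.min 1 (e / (4 * D)).
have th0 : 0 < th by rewrite lt_min ltr01 divr_gt0 // mulr_gt0.
have th1 : th <= 1 by rewrite ge_min lexx.
have thD : th * D <= e / 4.
  have : th <= e / (4 * D) by rewrite ge_min lexx orbT.
  rewrite ler_pdivlMr ?mulr_gt0 //; lra.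
pose z x := th * vs x + (1 - th) * v x + - (e / 2).
have zv x : l <= x -> x <= r -> v x - 3 / 4 * e <= z x /\ z x <= v x - e / 4.
  move=> lx xr; have /DP : l <= x <= r by rewrite lx.
  rewrite ler_norml => /andP[h1 h2]; rewrite /z; split; nra.
have cz : continuous z.
  by move=> x; apply: cvgD; [apply: cvgD; apply: cvgMr; [exact: cvs|exact: cv]|exact: cvg_cst].
have mc x : minH G x <= c by exact: (minH_le_sub gG) sv.
(* Both regimes in one continuous function: its minimum [m] over [[l, r]] is positive and at each
   point bounds either the room or [e / 4 - v] from below. *)
have cq : continuous (fun x => Num.max (c - minH G x) (e / 4 - v x)).
  have c1 : continuous (fun x => c - minH G x).
    by move=> x; apply: cvgB; [exact: cvg_cst|exact: minH_cont].
  have c2 : continuous (fun x => e / 4 - v x).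
    by move=> x; apply: cvgB; [exact: cvg_cst|exact: cv].
  by move=> x; exact: (@continuous_max R R _ _ x (c1 x) (c2 x)).
have [x0 [/andP[lx0 x0r] x0P]] := min_seg lr cq.
pose m := Num.max (c - minH G x0) (e / 4 - v x0).
have m0 : 0 < m.
  rewrite /m lt_max; apply/orP; have [h|h] := ltP 0 (c - minH G x0); first by left.
  right; suff : v x0 <= 0 by lra.
  apply: vE => // p; have := minH_le gG x0 p; lra.
pose d := th * m / Bv.
have d0 : 0 < d by rewrite /d divr_gt0 // mulr_gt0.
have zl : z l < v l by have := (zv l (lexx _) lr).2; lra.
have zr : z r < v r by have := (zv r lr (lexx _)).2; lra.
apply: filterS3 (near_pos d0) (outl _ zl) (outr _ zr) => lam [l0 ld] [w1 [M1 [bw1 w1l sw1]]] [w2 [M2 [bw2 w2r sw2]]].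
have lBv : lam * Bv <= th * m by rewrite -ler_pdivlMr.
pose g := join3 l r w1 z w2.
have bg : bounded_fun g by exact: (join3_bounded lr bw1 cz bw2).
have gl x : x <= l -> g x = w1 x by move=> xl; rewrite /g join3_l // w1l; ring.
have gr x : r <= x -> g x = w2 x by move=> xl; rewrite /g join3_r // w2r; ring.
have gm x : l <= x -> x <= r -> g x = z x by move=> h1 h2; rewrite /g join3_m.
have sg : sub G (fun x => c - lam * g x) g.
  apply: subat_join3 => //.
  - by move=> x xl; rewrite gl //; exact: sw1.
  - move=> x lx xr; rewrite gm //; apply: subat_shift.
    apply: subat_le (subat_cvx (good_cvx gG x) (ltW th0) th1 (svs x) (sv x)).
    suff : lam * z x <= th * (c - minH G x) by lra.
    have [z1 z2] := zv x lx xr.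
    have mm : 0 <= th * (c - minH G x) by rewrite mulr_ge0 ?(ltW th0) //; have := mc x; lra.
    have xx : l <= x <= r by rewrite lx.
    have := x0P x xx; rewrite -/m le_max => /orP[h|h].
      have vB : v x <= Bv by have := BvP x xx; rewrite ler_norml => /andP[].
      have : lam * z x <= lam * Bv by rewrite ler_pM2l //; lra.
      have : th * m <= th * (c - minH G x) by rewrite ler_pM2l.
      lra.
    have : lam * z x <= 0 by rewrite pmulr_rle0 //; lra.
    lra.
  - by move=> x xl; rewrite gr //; exact: sw2.
move=> x lx xr; apply: le_trans (fam_cmp l0 bg sg x); rewrite gm //.
by have := (zv x lx xr).1; lra.
Qed.

End DiscountedFamily.

(** * Pointwise suprema and coercivity *)

Section PointwiseSup.
Variable R : realType.

Lemma pointwise_sup (u : R -> R) (S : set (R -> R)) :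
  (forall v, S v -> forall x, v x <= u x) -> (forall x, exists2 v, S v & v x = u x) ->
  is_pointwise_sup u S.
Proof.
move=> ub at_ x; apply/eqP; rewrite eq_le; apply/andP; split.
  by apply: ereal_sup_ubound; have [v Sv <-] := at_ x; exists v.
by apply: ge_ereal_sup => _ [v Sv <-]; rewrite lee_fin; exact: ub.
Qed.

Lemma pointwise_sup_ge (u : R -> R) (S : set (R -> R)) v x : is_pointwise_sup u S -> S v -> v x <= u x.
Proof.
by move=> h Sv; rewrite -lee_fin (h x); apply: ereal_sup_ubound; exists v.
Qed.

Lemma coercive_cvg (f : R -> R) (eta C : R) : 0 < eta -> (forall x, eta * `|x| - C <= f x) ->
  (f x @[x --> +oo] --> +oo) /\ (f x @[x --> -oo] --> +oo).
Proof.
move=> e0 fP; split; apply/cvgryPge => A.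
  near=> x; apply: le_trans (fP x); rewrite lerBrDr -ler_pdivrMl //.
  apply: le_trans (ler_norm x); near: x; apply: nbhs_pinfty_ge; exact: num_real.
near=> x; apply: le_trans (fP x); rewrite lerBrDr -ler_pdivrMl // -normrN.
apply: le_trans (ler_norm (- x)); rewrite lerNr; near: x; apply: nbhs_ninfty_le; exact: num_real.
Unshelve. all: by end_near. Qed.

End PointwiseSup.

(** * Reduction to bounds on candidates, and case (I) *)

Section Cases.
Variable R : realType.
Implicit Types (f v w : R -> R) (d e x y z p q l r lam rho : R).

Variables (G H : R -> R -> R) (a b c : R) (u : R -> R -> R) (vb : R -> R).
Hypotheses (gG : good G) (gH : good H) (pH : forall x, H (x + 1) = H x).
Hypothesis ab : a <= b.
Hypotheses (GHl : forall z, z <= a -> G z = H z) (GHr : forall z, b <= z -> G z = H z).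
Hypothesis bu : forall lam, 0 < lam -> bounded_fun (u lam).
Hypothesis su : forall lam, 0 < lam -> visc_sol (discounted G lam c) (u lam).
Hypothesis bvb : bounded_fun vb.
Hypothesis svb : sub G (fun=> c) vb.

(** The candidates with the integral constraint already replaced by a sign condition; [Sb_minusE]
    justifies the replacement. *)
Definition Smin (G : R -> R -> R) (c : R) : set (R -> R) :=
  [set v | [/\ bounded_fun v, sub G (fun=> c) v & forall y, Eset G c y -> v y <= 0]].

(** A candidate equal to the upper limit at [x] bounds the lower limit at [x] by the same value, so
    the family converges there. *)
Lemma limit_from_bounds (S : set (R -> R)) :
  (forall x, exists M : R, \forall lam \near 0^'+, u lam x <= M) ->
  (forall v, S v -> forall x e, 0 < e -> \forall lam \near 0^'+, v x - e <= u lam x) ->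
  (forall x, exists2 v, S v & v x = ustar u x) ->
  {family compact, u lam @[lam --> 0^'+] --> ustar u} /\ is_pointwise_sup (ustar u) S.
Proof.
move=> ub lo at_; split.
  apply: (ustar_cvg gG bu su bvb svb ub) => x e e0.
  by have [v Sv <-] := at_ x; exact: lo.
apply: pointwise_sup => // v Sv x; apply/ler_addgt0Pr => e e0.
suff : v x - e <= ustar u x by lra.
by apply: (ustar_ge gG bu su bvb svb ub); exact: lo.
Qed.

Lemma upper_bound_from_Eset y0 x : Eset G c y0 -> exists M : R, \forall lam \near 0^'+, u lam x <= M.
Proof.
move=> Ey0; have [B B0 BP] := fam_lip gG bu su bvb svb.
exists (B * `|x - y0|); apply: filterS (near_pos ltr01) => lam [l0 l1].
have := BP lam y0 x l0 l1; have := fam_le0 gG su l0 Ey0.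
by rewrite ler_norml => h /andP[]; lra.
Qed.

Section CaseI.
Hypothesis cH : c_bounded H < c.

Lemma caseI_Eset y : Eset G c y -> a < y /\ y < b.
Proof.
move=> Ey; have mH x : minH H x < c.
  apply: le_lt_trans (minH_le_c_free gH x) _; apply: le_lt_trans cH; exact: c_free_le_bounded.
have [p pE] := minH_attained gH y.
split; rewrite ltNge; apply/negP => h; have := Ey p.
  by rewrite GHl // pE; have := mH y; lra.
by rewrite GHr // pE; have := mH y; lra.
Qed.

(** The room [c - c_bounded H] absorbs the discount whatever [rho] is, so the end values are
    unconstrained here. *)
Lemma caseI_outer w M (D : R -> Prop) l rho : sub H (fun=> c_bounded H) w ->
  (forall x, `|w x| <= M) -> (forall x, D x -> G x = H x) ->
  \forall lam \near 0^'+, outer G c D lam l rho.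
Proof.
move=> sw wM DG.
have M0 : 0 <= M by apply: le_trans (wM 0); rewrite normr_ge0.
have r0 := normr_ge0 rho.
have d0 : 0 < (c - c_bounded H) / (2 * M + `|rho| + 1) by rewrite divr_gt0 ?subr_gt0 //; lra.
apply: filterS (near_pos d0) => lam [l0 ld].
have B x : `|w x + (rho - w l)| <= 2 * M + `|rho|.
  have := ler_normD (w x) (rho - w l); have := ler_normB rho (w l).
  by have := wM x; have := wM l; lra.
exists (fun x => w x + (rho - w l)), (2 * M + `|rho|); split.
- by move=> x _; exact: B.
- by ring.
- move=> x Dx; apply: subat_shift; rewrite DG //; apply: subat_le (sw x).
  move: ld; rewrite ler_pdivlMr; last lra.
  by have := B x; rewrite ler_norml => /andP[_ h]; nra.
Qed.

Lemma caseI_lower v : sub G (fun=> c) v -> (forall y, Eset G c y -> v y <= 0) ->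
  forall x e, 0 < e -> \forall lam \near 0^'+, v x - e <= u lam x.
Proof.
move=> sv vE x e e0.
have [w [/boundedP[M MP] sw _]] := critical_periodic gH pH.
pose l := Num.min a x; pose r := Num.max b x.
have la : l <= a by rewrite /l ge_min lexx.
have lx : l <= x by rewrite /l ge_min lexx orbT.
have br : b <= r by rewrite /r le_max lexx.
have xr : x <= r by rewrite /r le_max lexx orbT.
have := @lower_bound _ G c u gG bu su l r v (le_trans lx xr) sv (fun y _ _ => vE y) _ _ e e0.
move=> H1; apply: filterS (H1 _ _) => [lam /(_ x lx xr)//|rho _|rho _].
  by apply: (caseI_outer _ _ sw MP) => y yl; apply: GHl; lra.
by apply: (caseI_outer _ _ sw MP) => y yl; apply: GHr; lra.
Qed.

Hypothesis Ene : exists y, Eset G c y.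

Lemma caseI_ub x : exists M : R, \forall lam \near 0^'+, u lam x <= M.
Proof. by have [y Ey] := Ene; exact: upper_bound_from_Eset Ey. Qed.

(** [ustar] is coercive and hence no candidate; it is truncated by a bounded subsolution shifted to
    meet it at [x]. *)
Lemma caseI_attained x : exists2 v, Smin G c v & v x = ustar u x.
Proof.
have [C CP] := ustar_lower gG bu su bvb svb caseI_ub.
have [M MP] := (boundedP _).1 bvb.
pose m := ustar u x - vb x.
exists (fun y => Num.min (ustar u y) (vb y + m)); last first.
  by rewrite /m; apply/min_idPl; lra.
split.
- apply/boundedP; exists (`|C| + M + `|m|) => y.
  have h1 := CP y; have := MP y; rewrite ler_norml => /andP[h2 h3].
  have h4 := ler_norm C; have h5 := ler_norm m; have := ler_norm (- m); rewrite normrN => h6.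
  have h7 := normr_ge0 C; have h8 := normr_ge0 m.
  rewrite ler_norml le_min ge_min; apply/andP; split; first by apply/andP; split; lra.
  by apply/orP; right; lra.
- move=> y; apply: subat_min; first exact: good_cvx.
    exact: (ustar_sub gG bu su bvb svb caseI_ub).
  by apply: subat_shift; exact: svb.
- move=> y Ey; rewrite ge_min; apply/orP; left.
  exact: (ustar_le0 gG bu su bvb svb caseI_ub).
Qed.

Lemma subat_tilt a1 a2 : a1 < a2 -> exists2 eta : R, 0 < eta & forall t z w, `|t| <= eta ->
  subat (H z) a1 w z -> subat (H z) a2 (fun x => w x + t * x) z.
Proof.
move=> a12; have [B B0 BP] := good_coer gH (a1 + 2).
have a120 : 0 < a2 - a1 by lra.
have [d d0 dP] := good_ucont gH (B + 1) a120.
pose eta := Num.min d 1 / 2.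
have e0 : 0 < eta by rewrite divr_gt0 // lt_min d0 ltr01.
have ed : eta < d by rewrite /eta; have : Num.min d 1 <= d by [rewrite ge_min lexx]; lra.
have e1 : eta < 1 by rewrite /eta; have : Num.min d 1 <= 1 by [rewrite ge_min lexx orbT]; lra.
exists eta => // t z w te sw e ee.
(* Capped at 1 so that the slopes stay in the ball of radius [B], where the uniform continuity was
   invoked. *)
pose e' := Num.min e 1.
have e'0 : 0 < e' by rewrite lt_min ee ltr01.
have e'e : e' <= e by rewrite ge_min lexx.
have e'1 : e' <= 1 by rewrite ge_min lexx orbT.
have [d' d'0 d'P] := sw e' e'0; exists d' => // x y zx xy yz.
have := d'P x y zx xy yz; set s := slope w x y => Hs.
have yx0 : 0 < y - x by lra.
have -> : slope (fun x => w x + t * x) x y = s + t.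
  apply: (mulIf (lt0r_neq0 yx0)); rewrite -slopeM // mulrDl /s -slopeM //; ring.
have sB : `|s| <= B.
  by rewrite leNgt; apply/negP => /ltW /(BP z); lra.
have stB : `|s + t| <= B + 1 by apply: le_trans (ler_normD _ _) _; lra.
have := dP z z (s + t) s; rewrite subrr normr0 => /(_ d0).
have -> : s + t - s = t by ring.
have td : `|t| < d by lra.
have sB1 : `|s| <= B + 1 by lra.
by move=> /(_ td stB sB1) /normlt[]; lra.
Qed.

(** A subcritical subsolution tilted outwards on both sides grows linearly. Lowered by [D] it is
    nonpositive on [Eset], which lies in [(a, b)], and [caseI_lower], which does not ask for
    boundedness, puts it below [ustar]. *)
Lemma caseI_coercive : (ustar u x @[x --> +oo] --> +oo) /\ (ustar u x @[x --> -oo] --> +oo).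
Proof.
have [w [/boundedP[M MP] sw _]] := critical_periodic gH pH.
have M0 : 0 <= M by apply: le_trans (MP 0); rewrite normr_ge0.
have [eta e0 eP] := subat_tilt cH.
pose wl x := w x + - eta * x; pose wr x := w x + eta * x.
pose g := join3 a b wl vb wr.
have en : `|eta| <= eta by rewrite gtr0_norm.
have sg : sub G (fun=> c) g.
  apply: subat_join3 => // z h.
  - by rewrite GHl //; apply: eP (sw z); rewrite normrN.
  - by rewrite GHr //; apply: eP (sw z).
have [D D0 DP] := bounded_seg a b (sub_cont gG sg).
have lo : forall x, g x - D <= ustar u x.
  move=> x; apply/ler_addgt0Pr => e ee.
  suff : g x - D - e <= ustar u x by lra.
  apply: (ustar_ge gG bu su bvb svb caseI_ub).
  apply: (caseI_lower (v := fun x => g x + - D)) ee => [y|y Ey].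
    by apply: subat_shift; exact: sg.
  have [ay yb] := caseI_Eset Ey.
  have : a <= y <= b by apply/andP; split; lra.
  by move=> /DP; rewrite ler_norml => /andP[]; lra.
pose A := `|vb a - wl a| + `|vb b - wr b| + M + D + 2 * eta * (`|a| + `|b|).
apply: (coercive_cvg (eta := eta) (C := A + D)) => // x.
suff h : eta * `|x| - A <= g x by have := lo x; lra.
have n1 := normr_ge0 (vb a - wl a); have n2 := normr_ge0 (vb b - wr b).
have na := normr_ge0 a; have nb := normr_ge0 b.
have ea : 0 <= eta * `|a| by rewrite mulr_ge0 // ltW.
have eb : 0 <= eta * `|b| by rewrite mulr_ge0 // ltW.
have := MP x; rewrite ler_norml => /andP[w1 w2].
have k1 : - `|vb a - wl a| <= vb a - wl a by rewrite lerNl -normrN ler_norm.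
have k2 : - `|vb b - wr b| <= vb b - wr b by rewrite lerNl -normrN ler_norm.
have aa := ler_norm a; have aN : - b <= `|b| by rewrite -normrN ler_norm.
have [xa|ax] := leP x a.
  rewrite /g join3_l // /wl.
  have : eta * `|x| <= eta * (2 * `|a| - x).
    by rewrite ler_pM2l //; case: (leP 0 x) => ?; [rewrite ger0_norm|rewrite ltr0_norm]; lra.
  by rewrite /A /wl in k1 *; lra.
have [xb|bx] := leP x b.
  have : eta * `|x| <= eta * (`|a| + `|b|).
    rewrite ler_pM2l // ler_norml; have := ler_norm b; have := ler_norm (- a); rewrite normrN => *.
    by apply/andP; split; lra.
  have : a <= x <= b by rewrite (ltW ax).
  by move=> /DP; rewrite ler_norml => /andP[? ?]; rewrite /A; lra.
rewrite /g join3_r ?(ltW bx) // /wr.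
have : eta * `|x| <= eta * (2 * `|b| + x).
  by rewrite ler_pM2l //; case: (leP 0 x) => ?; [rewrite ger0_norm|rewrite ltr0_norm]; lra.
by rewrite /A /wr in k2 *; lra.
Qed.

End CaseI.
End Cases.

(** * Outer continuation by the unperturbed discounted solutions *)

Section OuterSolutions.
Variable R : realType.
Implicit Types (f v w : R -> R) (d e x y z p q l r lam rho : R).

Variables (G H : R -> R -> R) (c : R) (uH : R -> R -> R) (u0H : R -> R).
Hypothesis gH : good H.
Hypothesis buH : forall lam, 0 < lam -> bounded_fun (uH lam).
Hypothesis suH : forall lam, 0 < lam -> visc_sol (discounted H lam c) (uH lam).
Hypothesis limH : forall x e, 0 < e -> \forall lam \near 0^'+, `|uH lam x - u0H x| <= e.

(** A downward shift of [uH lam] remains a discounted subsolution; [rho < u0H l] makes the shift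
    downward for small [lam]. *)
Lemma outer_solution (D : R -> Prop) l rho : (forall x, D x -> G x = H x) -> rho < u0H l ->
  \forall lam \near 0^'+, outer G c D lam l rho.
Proof.
move=> DG rl; have e0 : 0 < u0H l - rho by lra.
apply: filterS2 (near_pos ltr01) (limH l e0) => lam [l0 _].
rewrite ler_norml => /andP[h _].
have [M MP] := (boundedP _).1 (buH l0).
exists (fun x => uH lam x + (rho - uH lam l)), (M + `|rho - uH lam l|); split.
- by move=> x _; apply: le_trans (ler_normD _ _) _; rewrite lerD2r.
- by ring.
- move=> x Dx; apply: subat_shift; rewrite DG //; apply: subat_le (fam_sub gH suH l0 x).
  have : lam * (rho - uH lam l) <= 0 by rewrite pmulr_rle0 //; lra.
  lra.
Qed.

End OuterSolutions.

(** * Case (III) *)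

Section CaseIII.
Variable R : realType.
Implicit Types (f v w : R -> R) (d e x y z p q l r lam rho : R).

Variables (G H : R -> R -> R) (a b c : R) (u uH : R -> R -> R) (vb u0H : R -> R).
Hypotheses (gG : good G) (gH : good H) (pH : forall x, H (x + 1) = H x).
Hypothesis ab : a <= b.
Hypotheses (GHl : forall z, z <= a -> G z = H z) (GHr : forall z, b <= z -> G z = H z).
Hypothesis bu : forall lam, 0 < lam -> bounded_fun (u lam).
Hypothesis su : forall lam, 0 < lam -> visc_sol (discounted G lam c) (u lam).
Hypothesis buH : forall lam, 0 < lam -> bounded_fun (uH lam).
Hypothesis suH : forall lam, 0 < lam -> visc_sol (discounted H lam c) (uH lam).
Hypothesis bvb : bounded_fun vb.
Hypothesis svb : sub G (fun=> c) vb.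
Hypothesis limH : forall x e, 0 < e -> \forall lam \near 0^'+, `|uH lam x - u0H x| <= e.
Hypothesis pu0H : periodic u0H 1.
Hypothesis u0H_max : forall v, periodic v 1 -> sub H (fun=> c) v ->
  (forall y, Eset H c y -> v y <= 0) -> forall x, v x <= u0H x.
Hypothesis EH : exists y, Eset H c y.

Lemma caseIII_far_Eset y d : d = 1 \/ d = -1 -> Eset H c y ->
  \forall k \near \oo, Eset G c (y + d * k%:R).
Proof.
move=> dE Ey; apply: filterS (perturb_translate pH GHl GHr dE y y) => k h p.
by rewrite h //; exact: Ey.
Qed.

(** Integer translates of a point of [Eset H] are within 1 of every [x]; those outside [(a, b)]
    belong to [Eset G], and for the others the far point [p0] is substituted. So every [x] is at
    bounded distance from a point where [u lam <= 0]. *)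
Lemma caseIII_ub : exists M : R, forall lam x, 0 < lam -> lam <= 1 -> u lam x <= M.
Proof.
have [B B0 BP] := fam_lip gG bu su bvb svb.
have [y0 Ey0] := EH.
have [k Ek] := filter_ex (caseIII_far_Eset (or_introl erefl) Ey0).
set p0 := y0 + 1 * k%:R in Ek.
exists (B * (2 + `|a| + `|b| + `|p0|)) => lam x l0 l1.
suff [t Et tx] : exists2 t, Eset G c t & `|x - t| <= 2 + `|a| + `|b| + `|p0|.
  have := BP lam t x l0 l1; rewrite ler_norml => /andP[_ h].
  have := fam_le0 gG su l0 Et; have : B * `|x - t| <= B * (2 + `|a| + `|b| + `|p0|) by rewrite ler_pM2l.
  lra.
have na := normr_ge0 a; have nb := normr_ge0 b; have np := normr_ge0 p0.
have [n /andP[n1 n2]] := floor_decomp (x - y0).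
pose t := y0 + n%:~R.
have tx : `|x - t| <= 1 by rewrite /t ger0_norm; lra.
have Et : (G t = H t) -> Eset G c t.
  by move=> GH p; rewrite GH /t (periodic_int pH); exact: Ey0.
have [ta|at_] := leP t a; first by exists t; [exact/Et/GHl|lra].
have [bt|tb] := leP b t; first by exists t; [exact/Et/GHr|lra].
exists p0 => //.
have h1 := ler_norm b; have h2 : - a <= `|a| by rewrite -normrN ler_norm.
have h3 := ler_norm p0; have h4 : - p0 <= `|p0| by rewrite -normrN ler_norm.
move: tx; rewrite !ler_norml => /andP[? ?]; apply/andP; split; lra.
Qed.

(** The upper limit of the integer translates of [v] is a competitor in (U), hence at most [u0H]; so
    [v] cannot stay above [u0H + e] at distant integers. *)
Lemma caseIII_far v d e x : Smin G c v -> d = 1 \/ d = -1 -> 0 < e ->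
  exists k : nat, x <= k%:R /\ v (d * k%:R) < u0H (d * k%:R) + e.
Proof.
move=> [bv sv vE] dE e0.
have GHt := perturb_translate pH GHl GHr dE.
have e20 : 0 < e / 2 by lra.
have pv := tlim_periodic dE v.
have sv' : sub H (fun=> c) (tlim d v) by apply: tlim_sub sv.
have vE' y : Eset H c y -> tlim d v y <= 0.
  move=> Ey; apply: lsup_le; first exact: tlim_evb.
  by apply: filterS (caseIII_far_Eset dE Ey) => k; exact: vE.
have v0 := u0H_max pv sv' vE' 0.
have ev : evb \oo (fun k : nat => v (0 + d * k%:R)) by exact: tlim_evb.
have [k [kx kv]] := filter_ex (filterI (nbhs_infty_ger x) (lsup_eps _ ev e20)).
exists k; split=> //.
have -> : u0H (d * k%:R) = u0H 0.
  have pn := periodic_int pu0H; case: dE => ->.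
    by rewrite mul1r -(pn k 0) add0r.
  by rewrite mulN1r -(pn (- k%:Z) 0) add0r mulrNz.
by move: kv; rewrite add0r -/(tlim d v 0) => kv; lra.
Qed.

Lemma caseIII_lower v : Smin G c v ->
  forall x e, 0 < e -> \forall lam \near 0^'+, v x - e <= u lam x.
Proof.
move=> Sv x e e0; have e20 : 0 < e / 2 by lra.
have [bv sv vE] := Sv.
have [k1 [k1x k1v]] := caseIII_far (`|x| + `|b|) Sv (or_introl erefl) e20.
have [k2 [k2x k2v]] := caseIII_far (`|x| + `|a|) Sv (or_intror erefl) e20.
rewrite mul1r in k1v; rewrite mulN1r in k2v.
set r := k1%:R in k1x k1v; set l := - k2%:R in k2v.
have l_def : - l = k2%:R by rewrite /l opprK.
rewrite -l_def in k2x.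
have nx := ler_norm x; have nx' : - x <= `|x| by rewrite -normrN ler_norm.
have nb := ler_norm b; have na' : - a <= `|a| by rewrite -normrN ler_norm.
have n1 := normr_ge0 x; have n2 := normr_ge0 a; have n3 := normr_ge0 b.
have lx : l <= x by lra. have xr : x <= r by lra.
have la : l <= a by lra. have br : b <= r by lra.
(* Lowering by [e / 2] puts both end values strictly below [u0H], as [outer_solution] demands. *)
have sv' : sub G (fun=> c) (fun y => v y + - (e / 2)) by move=> y; apply: subat_shift; exact: sv.
have vE' y : l <= y -> y <= r -> Eset G c y -> v y + - (e / 2) <= 0.
  by move=> _ _ /vE; lra.
have H1 := lower_bound gG bu su (le_trans lx xr) sv' vE' _ _ e20.
apply: filterS (H1 _ _) => [lam /(_ x lx xr)|rho rl|rho rl]; first lra.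
  apply: (outer_solution gH buH suH limH); last by lra.
  by move=> y yl; apply: GHl; lra.
apply: (outer_solution gH buH suH limH); last by lra.
by move=> y yl; apply: GHr; lra.
Qed.

End CaseIII.

(** * Case (II,A) *)

Section CaseII.
Variable R : realType.
Implicit Types (f v w : R -> R) (d e x y z q l r lam rho : R).

Variables (G H : R -> R -> R) (a b c : R) (u uH : R -> R -> R) (vb u0H P p : R -> R) (eta h0 : R).
Hypotheses (gG : good G) (gH : good H).
Hypothesis ab : a <= b.
Hypotheses (GHl : forall z, z <= a -> G z = H z) (GHr : forall z, b <= z -> G z = H z).
Hypothesis bu : forall lam, 0 < lam -> bounded_fun (u lam).
Hypothesis su : forall lam, 0 < lam -> visc_sol (discounted G lam c) (u lam).
Hypothesis buH : forall lam, 0 < lam -> bounded_fun (uH lam).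
Hypothesis suH : forall lam, 0 < lam -> visc_sol (discounted H lam c) (uH lam).
Hypothesis bvb : bounded_fun vb.
Hypothesis svb : sub G (fun=> c) vb.
Hypothesis limH : forall x e, 0 < e -> \forall lam \near 0^'+, `|uH lam x - u0H x| <= e.
Hypotheses (dP : has_deriv P p) (cp : continuous p) (pP : periodic P 1).
Hypothesis p_max : forall x q, H x q <= c -> q <= p x.
Hypothesis p_level : forall x, H x (p x) = c.
Hypotheses (eta0 : 0 < eta) (h00 : 0 < h0) (p_strict : forall x, H x (p x - eta) <= c - h0).

(** Away from ties only the larger function matters locally; at a tie the two discounted levels
    agree. *)
Lemma subat_max_discounted K lam v w z : cvx K ->
  {for z, continuous v} -> {for z, continuous w} ->
  subat K (c - lam * v z) v z -> subat K (c - lam * w z) w z ->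
  subat K (c - lam * Num.max (v z) (w z)) (fun y => Num.max (v y) (w y)) z.
Proof.
move=> cK cv cw sv sw.
have main v1 w1 : {for z, continuous v1} -> {for z, continuous w1} -> w1 z < v1 z ->
    subat K (c - lam * v1 z) v1 z ->
    subat K (c - lam * Num.max (v1 z) (w1 z)) (fun y => Num.max (v1 y) (w1 y)) z.
  move=> /cont_atP cv1 /cont_atP cw1 wv sv1; rewrite (max_idPl (ltW wv)).
  have e0 : 0 < (v1 z - w1 z) / 2 by lra.
  have [d1 d10 d1P] := cv1 _ e0; have [d2 d20 d2P] := cw1 _ e0.
  apply: (subat_local (d := Num.min d1 d2)) sv1; first by rewrite lt_min d10.
  move=> y; rewrite lt_min => /andP[/d1P/normlt[h1 h2] /d2P/normlt[h3 h4]].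
  by apply/esym/max_idPl; lra.
have [vw|wv|vw] := ltgtP (v z) (w z).
- have := main w v cw cv vw sw; rewrite (max_idPl (ltW vw)) => h.
  by apply: subat_ext h => y; rewrite maxC.
- by have := main v w cv cw wv sv; rewrite (max_idPl (ltW wv)).
- by apply: subat_max => //; rewrite vw.
Qed.

(* To the right of [r] one may descend along [P - eta id], which leaves room [h0] for the
   discount, until a nonpositive multiple of the critical subsolution [P] takes over. *)
Lemma right_outer r M : \forall lam \near 0^'+, forall rho, rho <= M ->
  outer H c (fun x => r <= x) lam r rho.
Proof.
have [MP MPP] := periodic_bounded (has_deriv_cont dP) pP.
have MP0 : 0 <= MP by apply: le_trans (MPP 0); rewrite normr_ge0.
have PM x : - MP <= P x /\ P x <= MP by have := MPP x; rewrite ler_norml => /andP[].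
(* Makes [v r >= M], so that adjusting the value at [r] to [rho] is a downward shift. *)
pose C := `|M| + MP + eta * r.
have d0 : 0 < h0 / (2 * MP + `|M| + 1) by rewrite divr_gt0 //; have := normr_ge0 M; lra.
apply: filterS (near_pos d0) => lam [l0 ld] rho rM.
have nM := normr_ge0 M; have lM := ler_norm M.
have {}ld : lam * (2 * MP + `|M| + 1) <= h0 by rewrite -ler_pdivlMr //; lra.
(* [w <= 0] needs no room for the discount, and it keeps [g] bounded below, which [v] alone is
   not. *)
pose v x := P x + (C - eta * x); pose w x := P x + - MP.
pose g x := Num.max (v x) (w x).
have dv : has_deriv v (fun x => p x - eta).
  move=> x; have h : is_derive x (1:R) (fun x => C - eta * x) (- eta).
    by apply: is_derive_eq; rewrite /GRing.scale /=; ring.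
  exact: is_deriveD (dP x) h.
have dw : has_deriv w p.
  move=> x; have := is_deriveD (dP x) (is_derive_cst (- MP) x 1).
  by rewrite addr0.
have cpe : continuous (fun x => p x - eta) by move=> x; apply: cvgB; [exact: cp|exact: cvg_cst].
have gr : rho <= g r.
  by rewrite /g le_max; apply/orP; left; rewrite /v /C; have := PM r; lra.
have vr x : r <= x -> v x <= 2 * MP + `|M|.
  move=> rx; have : eta * r <= eta * x by rewrite ler_pM2l.
  by rewrite /v /C; have := PM x; lra.
have sg x : r <= x -> subat (H x) (c - lam * g x) g x.
  move=> rx; apply: subat_max_discounted.
  - exact: good_cvx.
  - exact: (has_deriv_cont dv).
  - exact: (has_deriv_cont dw).
  - apply: (subat_C1 (u' := fun x => p x - eta)); [exact: good_cont|exact: dv|exact: cpe|].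
    have : lam * v x <= lam * (2 * MP + `|M|) by rewrite ler_pM2l // vr.
    by have := p_strict x; rewrite /=; lra.
  - apply: (subat_C1 (u' := p)); [exact: good_cont|exact: dw|exact: cp|].
    rewrite p_level; have : lam * w x <= 0 by rewrite pmulr_rle0 // /w; have := PM x; lra.
    lra.
have wg x : - (2 * MP) <= g x.
  by rewrite /g le_max; apply/orP; right; rewrite /w; have := PM x; lra.
have gM x : r <= x -> g x <= 2 * MP + `|M|.
  by move=> rx; rewrite /g ge_max vr //= /w; have := PM x; lra.
exists (fun x => g x + (rho - g r)), (2 * MP + `|M| + `|rho - g r|); split.
- move=> x rx; apply: le_trans (ler_normD _ _) _; rewrite lerD2r ler_norml.
  by have := wg x; have := gM x rx; move=> *; apply/andP; split; lra.
- by ring.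
- move=> x rx; apply: subat_shift; apply: subat_le (sg x rx).
  have : lam * (rho - g r) <= 0 by rewrite pmulr_rle0 //; lra.
  lra.
Qed.

Lemma caseII_lower v : sub G (fun=> c) v -> (forall y, Eset G c y -> v y <= 0) ->
  (forall x, x < a -> v x <= u0H x) ->
  forall x e, 0 < e -> \forall lam \near 0^'+, v x - e <= u lam x.
Proof.
move=> sv vE vu x e e0.
(* The extra 1 gives [l < a], where [v <= u0H] is available. *)
pose l := Num.min a x - 1; pose r := Num.max b x.
have h1 : Num.min a x <= a by rewrite ge_min lexx.
have h2 : Num.min a x <= x by rewrite ge_min lexx orbT.
have br : b <= r by rewrite /r le_max lexx.
have xr : x <= r by rewrite /r le_max lexx orbT.
have la : l < a by rewrite /l; lra. have lx : l <= x by rewrite /l; lra.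
have H1 := lower_bound gG bu su (le_trans lx xr) sv (fun y _ _ => vE y) _ _ e0.
apply: filterS (H1 _ _) => [lam /(_ x lx xr)//|rho rl|rho rl].
  apply: (outer_solution gH buH suH limH); first by move=> y yl; apply: GHl; lra.
  by have := vu l la; lra.
apply: filterS (right_outer r rho) => lam /(_ rho (lexx _)) [z [M [zM zr zs]]].
exists z, M; split=> // y ry; rewrite GHr; [exact: zs|lra].
Qed.

(** Integrates a momentum bound that varies with [z], by the Dini argument applied to [u1 - Q]. *)
Lemma sub_le_primitive (u1 q1 Q : R -> R) (a1 x y : R) : x <= y -> has_deriv Q q1 -> continuous q1 ->
  (forall z, x <= z -> z <= y -> subat (H z) a1 u1 z) ->
  (forall z q, x <= z -> z <= y -> H z q <= a1 -> q <= q1 z) ->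
  u1 y - u1 x <= Q y - Q x.
Proof.
move=> xy dQ cq su1 qm; pose g z := u1 z - Q z.
suff : g y <= g x by rewrite /g; lra.
apply: dini_nonincreasing xy _ => z xz zy e e0.
have e20 : 0 < e / 2 by lra.
have [d1 d10 d1P] := (contP _).1 cq z _ e20.
have He : a1 < H z (q1 z + e / 2).
  by rewrite ltNge; apply/negP => /(qm z _ xz zy); lra.
have e'0 : 0 < (H z (q1 z + e / 2) - a1) / 2 by lra.
have [d2 d20 d2P] := su1 z xz zy _ e'0.
have [p0 Hp0] := subat_nonempty (good_cont gH (x := z)) (good_coercive gH z) (su1 z xz zy).
have p0q := qm z p0 xz zy Hp0.
exists (Num.min d1 d2); first by rewrite lt_min d10.
have m1 : Num.min d1 d2 <= d1 by rewrite ge_min lexx.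
have m2 : Num.min d1 d2 <= d2 by rewrite ge_min lexx orbT.
move=> s t h1 h2 h3 h4 st.
have Hs : H z (slope u1 s t) <= a1 + (H z (q1 z + e / 2) - a1) / 2 by apply: d2P; lra.
have se : slope u1 s t <= q1 z + e / 2.
  rewrite leNgt; apply/negP => hs.
  have Hp0' : H z p0 <= a1 + (H z (q1 z + e / 2) - a1) / 2 by lra.
  have p0r : p0 <= q1 z + e / 2 by lra.
  by have := cvx_between (good_cvx gH z) p0r (ltW hs) Hp0' Hs; lra.
have [m [sm mt E]] := mvt st dQ.
have /d1P/normlt[k1 _] : `|m - z| < d1 by rewrite ltr_norml; apply/andP; split; lra.
have E2 := slopeM u1 st; rewrite /g.
have ts : 0 < t - s by lra.
have : slope u1 s t * (t - s) <= (q1 z + e / 2) * (t - s) by rewrite ler_pM2r.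
have : (q1 z - e / 2) * (t - s) <= q1 m * (t - s) by rewrite ler_pM2r //; lra.
lra.
Qed.

(** Since [p x] sits exactly at level [c], uniform continuity keeps momenta at level [c - beta] a
    fixed distance away from it. *)
Lemma level_gap beta : 0 < beta -> exists2 k : R, 0 < k & forall x q, H x q <= c - beta -> q <= p x - k.
Proof.
move=> b0; have [B B0 BP] := good_coer gH (c + 1).
have lev x q : H x q <= c -> `|q| <= B.
  by move=> Hq; rewrite leNgt; apply/negP => /ltW /(BP x); lra.
have [d d0 dPP] := good_ucont gH B b0; exists (d / 2); first lra.
move=> x q Hq; rewrite leNgt; apply/negP => h.
have qp : q <= p x by apply: p_max; lra.
have pB : `|p x| <= B by apply: (lev x); rewrite p_level.
have qB : `|q| <= B by apply: (lev x); lra.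
have := dPP x x (p x) q; rewrite subrr normr0 => /(_ d0).
have -> : `|p x - q| < d by rewrite ger0_norm; lra.
by move=> /(_ isT pB qB) /normlt[_]; rewrite p_level; lra.
Qed.

(* Where [u_G^lam] is positive the discount makes its increments strictly smaller than those of
   the periodic function [P], so it grows under translation by one period to the left. *)
Lemma drift B lam : 0 < lam -> (forall x y, `|u lam y - u lam x| <= B * `|y - x|) ->
  exists2 k : R, 0 < k & forall x, (forall z, x - 1 <= z -> z <= x -> G z = H z) ->
    B + 1 <= u lam x -> u lam x + k <= u lam (x - 1).
Proof.
move=> l0 uB; have [k k0 kP] := level_gap l0; exists k => // x GH ux.
have B0 : 0 <= B by have := le_trans (normr_ge0 _) (uB 0 1); rewrite subr0 normr1 mulr1.
have dQ : has_deriv (fun x => P x - k * x) (fun x => p x - k).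
  move=> y; have h : is_derive y (1:R) (fun x => k * x) k.
    by apply: is_derive_eq; rewrite /GRing.scale /= mulr1.
  exact: is_deriveB (dP y) h.
have := @sub_le_primitive (u lam) (fun x => p x - k) (fun x => P x - k * x) (c - lam) (x - 1) x.
have x1 : x - 1 <= x by lra.
move=> /(_ x1 dQ) h; suff : u lam x - u lam (x - 1) <= P x - k * x - (P (x - 1) - k * (x - 1)).
  by have := pP (x - 1); rewrite subrK => ->; lra.
apply: h => [y|z xz zx|z q _ _ /kP//].
  by apply: cvgB; [exact: cp|exact: cvg_cst].
rewrite -GH //; apply: subat_le (fam_sub gG su l0 z).
(* The threshold [B + 1] gives [u lam >= 1] on the whole period before [x], so the level there is at
   most [c - lam], the one given to [level_gap]. *)
have := uB x z; rewrite ler_norml => /andP[h1 _].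
have : B * `|z - x| <= B * 1 by rewrite ler_wpM2l // ler_norml; apply/andP; split; lra.
by rewrite mulr1 => h2; have : 1 <= u lam z by [lra]; nra.
Qed.

(** Above the threshold, a near-maximal point of the half-line would be beaten one period to its
    left. The gain [k] depends on [lam], the threshold does not. *)
Lemma caseII_ub_left : exists2 M : R, 0 < M & forall lam x, 0 < lam -> lam <= 1 -> x <= a -> u lam x <= M.
Proof.
have [B B0 BP] := fam_lip gG bu su bvb svb; exists (B + 2) => [|lam x l0 l1 xa]; first lra.
rewrite leNgt; apply/negP => ux.
have [k k0 kP] := drift l0 (fun x y => BP lam x y l0 l1).
pose A := [set u lam y | y in [set y | y <= a]].
have [M MP] := (boundedP _).1 (bu l0).
have hA : has_sup A.
  split; first by exists (u lam x), x.
  by exists M => _ [y _ <-]; apply: le_trans (ler_norm _) (MP y).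
(* Within [k] of the supremum for the contradiction, within 1 to stay above the threshold of
   [drift]. *)
have k10 : 0 < Num.min k 1 by rewrite lt_min k0 ltr01.
have [_ [y ya <-] yS] := sup_adherent k10 hA.
have m1 : Num.min k 1 <= k by rewrite ge_min lexx.
have m2 : Num.min k 1 <= 1 by rewrite ge_min lexx orbT.
have : u lam x <= sup A by apply: sup_upper_bound => //; exists x.
have : u lam (y - 1) <= sup A by apply: sup_upper_bound => //; exists (y - 1) => //=; rewrite /= in ya; lra.
have := kP y; rewrite /= in ya.
have h z : y - 1 <= z -> z <= y -> G z = H z by move=> _ zy; apply: GHl; lra.
by move=> /(_ h) h1 h2 h3; have : B + 1 <= u lam y by [lra]; move=> /h1; lra.
Qed.

(** The same argument on the right half-line: the bound on [[a, b + 1]], from the left half-line and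
    the Lipschitz constant, ensures that the step to the left stays beyond [b]. *)
Lemma caseII_ub : exists M : R, forall lam x, 0 < lam -> lam <= 1 -> u lam x <= M.
Proof.
have [B B0 BP] := fam_lip gG bu su bvb svb; have [M1 M10 M1P] := caseII_ub_left.
pose M2 := M1 + B * (b - a) + 2 * B + 2.
have Bab : 0 <= B * (b - a) by rewrite mulr_ge0 ?(ltW B0) // subr_ge0.
have mid lam x : 0 < lam -> lam <= 1 -> a <= x -> x <= b + 1 -> u lam x <= M1 + B * (b - a) + B.
  move=> l0 l1 ax xb; have := BP lam a x l0 l1; rewrite ler_norml (ger0_norm (_ : 0 <= x - a)) ?subr_ge0 //.
  move=> /andP[_ h]; have := M1P lam a l0 l1 (lexx _).
  have : B * (x - a) <= B * (b + 1 - a) by rewrite ler_pM2l //; lra.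
  lra.
exists M2 => lam x l0 l1; rewrite leNgt; apply/negP => ux.
have [k k0 kP] := drift l0 (fun x y => BP lam x y l0 l1).
have bx : b <= x.
  rewrite leNgt; apply/negP => xb; have [xa|ax] := leP x a.
    by have := M1P lam x l0 l1 xa; rewrite /M2 in ux; lra.
  by have := mid lam x l0 l1 (ltW ax); rewrite /M2 in ux; lra.
pose A := [set u lam y | y in [set y | b <= y]].
have [M MP] := (boundedP _).1 (bu l0).
have hA : has_sup A.
  split; first by exists (u lam x), x.
  by exists M => _ [y _ <-]; apply: le_trans (ler_norm _) (MP y).
have k10 : 0 < Num.min k 1 by rewrite lt_min k0 ltr01.
have [_ [y /= yb <-] yS] := sup_adherent k10 hA.
have m1 : Num.min k 1 <= k by rewrite ge_min lexx.
have m2 : Num.min k 1 <= 1 by rewrite ge_min lexx orbT.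
have xS : u lam x <= sup A by apply: sup_upper_bound => //; exists x.
have uy : M2 - 1 < u lam y by lra.
have yb1 : b + 1 < y.
  rewrite ltNge; apply/negP => yb1; have := mid lam y l0 l1 (le_trans ab yb) yb1.
  by rewrite /M2 in uy; lra.
have : u lam (y - 1) <= sup A by apply: sup_upper_bound => //; exists (y - 1) => //=; lra.
have h z : y - 1 <= z -> z <= y -> G z = H z by move=> zy _; apply: GHr; lra.
have : B + 1 <= u lam y by rewrite /M2 in uy; lra.
by move=> /(kP y h); lra.
Qed.

(** [right_outer] is uniform in [rho <= M], so it may start from the value [u lam a], which moves
    with [lam]. *)
Lemma caseII_left : \forall lam \near 0^'+, forall x, x <= a -> u lam x <= uH lam x.
Proof.
have [M M0 MP] := caseII_ub_left.
apply: filterS2 (near_pos ltr01) (right_outer a M) => lam [l0 l1] out x xa.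
have [z [Mz [zM za zs]]] := out (u lam a) (MP lam a l0 l1 (lexx _)).
have [Mu MuP] := (boundedP _).1 (bu l0).
pose g := join2 a (u lam) z.
have gl y : y <= a -> g y = u lam y by exact: join2_l.
have gr y : a <= y -> g y = z y by move=> ay; apply: join2_r.
rewrite -gl //; apply: (fam_cmp gH buH suH l0).
  apply/boundedP; exists (`|Mu| + `|Mz|) => y; have [ya|ay] := leP y a.
    by rewrite gl //; have := MuP y; have := ler_norm Mu; have := normr_ge0 Mz; lra.
  by rewrite gr ?(ltW ay) //; have := zM y (ltW ay); have := ler_norm Mz; have := normr_ge0 Mu; lra.
move=> y; apply: (subat_join2 gH (f := fun y => c - lam * g y)) => // h.
  by rewrite gl // -GHl //; exact: fam_sub.
by rewrite gr //; exact: zs.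
Qed.

End CaseII.

(** * Reflection of the line, which turns (II,B) into (II,A) *)

Section Reflection.
Variable R : realType.
Implicit Types (G H : R -> R -> R) (f u v : R -> R) (a c x y z p q lam : R).

Definition refl G : R -> R -> R := fun x p => G (- x) (- p).

Lemma refl_good G : good G -> good (refl G).
Proof.
move=> gG; split.
- by move=> x; apply: (@cvxN _ (G (- x))); exact: good_cvx.
- move=> B e e0; have [d d0 dP] := good_ucont gG B e0; exists d => // x y p q xy pq pB qB.
  by apply: dP; rewrite ?normrN // -opprD normrN // opprK.
- move=> M; have [B B0 BP] := good_coer gG M; exists B => // x p pB.
  by apply: BP; rewrite normrN.
- move=> B; have [M MP] := good_bnd gG B; exists M => x p pB.
  by apply: MP; rewrite normrN.
Qed.

Lemma refl_sub G f v : sub G f v -> sub (refl G) (fun x => f (- x)) (fun x => v (- x)).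
Proof. by move=> sv z; apply: (subat_reflect (K := G (- z))); exact: sv. Qed.

Lemma refl_bounded v : bounded_fun v -> bounded_fun (fun x => v (- x)).
Proof. by move=> /boundedP[M MP]; apply/boundedP; exists M => x; exact: MP. Qed.

Lemma refl_Eset G c y : Eset (refl G) c y -> Eset G c (- y).
Proof. by move=> Ey p; have := Ey (- p); rewrite /refl opprK. Qed.

Lemma refl_visc_sol G lam c u : visc_sol (discounted G lam c) u ->
  visc_sol (discounted (refl G) lam c) (fun x => u (- x)).
Proof.
have near_opp (Q : R -> Prop) z : (\forall y \near z, Q y) -> \forall y \near - z, Q (- y).
  move=> /nearP[d d0 dP]; apply/nearP; exists d => // y yz; apply: dP.
  by have -> : - y - z = - (y - - z) by [ring]; rewrite normrN.
move=> [[cu subu] [_ supu]]; have cu' : continuous (fun x => u (- x)) := contN cu.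
split; split=> // phi z Cphi nz; have [Cphi' dphi'] := C1_comp_opp Cphi.
  have nz' : \forall y \near - z, u y - phi (- y) <= u (- z) - phi (- - z).
    by have := near_opp _ _ nz; apply: filterS => y; rewrite !opprK.
  by have := subu (fun x => phi (- x)) (- z) Cphi' nz'; rewrite dphi' opprK.
have nz' : \forall y \near - z, u (- z) - phi (- - z) <= u y - phi (- y).
  by have := near_opp _ _ nz; apply: filterS => y; rewrite !opprK.
by have := supu (fun x => phi (- x)) (- z) Cphi' nz'; rewrite dphi' opprK.
Qed.

Lemma inf_oppE (S : set R) : inf S = - sup [set q | S (- q)].
Proof.
rewrite /inf; congr (- sup _); apply/seteqP; split=> [_ [p Sp <-]|q Sq] /=.
  by rewrite opprK.
by exists (- q); rewrite ?opprK.
Qed.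

Lemma p_minusE H x : p_minus H x = - pmax (refl H (- x)) (c_bounded H).
Proof. by rewrite /p_minus inf_oppE /pmax /refl opprK. Qed.

End Reflection.

(** * The extremal slopes and their primitives *)

Section ExtremalSlopes.
Variable R : realType.
Implicit Types (f u v : R -> R) (a x y z p q t : R).

Lemma prim_integral (F f : R -> R) : has_deriv F f -> continuous f ->
  \int[lebesgue_measure]_(x in `[0, 1]) f x = F 1 - F 0.
Proof.
move=> dF cf; rewrite /Rintegral (@continuous_FTC2 _ f F) //.
- exact: continuous_subspaceT.
- split; first by move=> x _; case: (dF x).
    by apply: cvg_at_right_filter; exact: (has_deriv_cont dF).
  by apply: cvg_at_left_filter; exact: (has_deriv_cont dF).
- by move=> x _; rewrite (has_deriv_derive1 dF).
Qed.

Lemma prim_increment (F f : R -> R) : has_deriv F f -> (forall x, f (x + 1) = f x) ->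
  forall x y, F (x + 1) - F x = F (y + 1) - F y.
Proof.
move=> dF pf.
have d x : is_derive x (1:R) (fun x => F (x + 1) - F x) 0.
  have H2 : is_derive x (1:R) (fun x : R => x + 1) 1 by apply: is_derive_eq; rewrite addr0.
  have := is_deriveB (@is_derive1_comp R F (fun x : R => x + 1) x _ _ (dF (x + 1)) H2) (dF x).
  by rewrite mulr1 pf subrr.
have mono x y : x < y -> F (x + 1) - F x = F (y + 1) - F y.
  by move=> xy; have [m [_ _]] := mvt xy d; rewrite mul0r; lra.
by move=> x y; have [/mono//|/mono//|->//] := ltgtP x y.
Qed.

Variables (H : R -> R -> R) (c : R).
Hypotheses (gH : good H) (pH : forall x, H (x + 1) = H x) (cf : c_free H < c).

Let pp x := pmax (H x) c.

Lemma minH_lt x : minH H x < c.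
Proof. exact: le_lt_trans (minH_le_c_free gH x) cf. Qed.

Lemma level_ex x : exists q, H x q <= c.
Proof. by have [q qE] := minH_attained gH x; exists q; rewrite qE ltW // minH_lt. Qed.

Lemma pp_cont : continuous pp.
Proof. by apply: (pmax_cont gH (f := fun=> c)); [move=> x; exact: cvg_cst|exact: minH_lt]. Qed.

Lemma pp_level x : H x (pp x) = c.
Proof. by apply: pmax_level; [exact: good_cont|exact: good_coercive|exact: level_ex]. Qed.

Lemma pp_max x q : H x q <= c -> q <= pp x.
Proof. by apply: pmax_ge; exact: good_coercive. Qed.

Lemma pp_periodic x : pp (x + 1) = pp x.
Proof. by rewrite /pp pH. Qed.

(** Quantitative convexity: moving at least a fraction [al] of the way from [p1] to [p0] gains at
    least that fraction of the gap [g]. *)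
Lemma cvx_strict K p0 p1 q g al : cvx K -> p0 <= q -> q <= p1 -> p0 < p1 -> K p0 <= c - g -> K p1 <= c ->
  0 <= g -> al * (p1 - p0) <= p1 - q -> K q <= c - al * g.
Proof.
move=> cK p0q qp1 p01 K0 K1 g0 alP.
pose s := (p1 - q) / (p1 - p0).
have d0 : 0 < p1 - p0 by lra.
have s0 : 0 <= s by rewrite divr_ge0 //; lra.
have s1 : s <= 1 by rewrite ler_pdivrMr //; lra.
have sE : s * (p1 - p0) = p1 - q by rewrite /s divfK // gt_eqF.
have als : al <= s by rewrite /s ler_pdivlMr.
have -> : q = s * p0 + (1 - s) * p1 by lra.
apply: le_trans (cK _ _ _ s0 s1) _.
have h1 : s * K p0 <= s * (c - g) by rewrite ler_wpM2l.
have h2 : (1 - s) * K p1 <= (1 - s) * c by rewrite ler_wpM2l ?subr_ge0.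
have h3 : al * g <= s * g by rewrite ler_wpM2r.
lra.
Qed.

Lemma pp_strict : exists eta h0 : R, [/\ 0 < eta, 0 < h0 & forall x, H x (pp x - eta) <= c - h0].
Proof.
pose g := c - c_free H; have g0 : 0 < g by rewrite subr_gt0.
have [B B0 BP] := good_coer gH (c + 1).
have lev x q : H x q <= c -> `|q| <= B.
  by move=> Hq; rewrite leNgt; apply/negP => /ltW /(BP x); lra.
have [d d0 dP] := good_ucont gH B g0.
have al0 : 0 < d / (2 * B) by rewrite divr_gt0 // mulr_gt0.
(* The minimiser is at least [d] and at most [2 * B] away from the maximal slope, so a step [d]
   covers a fraction [d / (2 * B)] of the way. *)
exists d, (d / (2 * B) * g); split=> // [|x]; first by rewrite mulr_gt0.
have [p0 p0E] := minH_attained gH x; have m := minH_le_c_free gH x.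
have l0 : H x p0 <= c by rewrite p0E ltW // minH_lt.
have b0 := lev x p0 l0.
have l1 : H x (pp x) <= c by rewrite pp_level.
have b1 := lev x _ l1; have p0p := pp_max l0.
have dp : d <= pp x - p0.
  rewrite leNgt; apply/negP => h.
  have := dP x x (pp x) p0; rewrite subrr normr0 => /(_ d0).
  have -> : `|pp x - p0| < d by rewrite ger0_norm; lra.
  by move=> /(_ isT b1 b0) /normlt[_]; rewrite pp_level p0E /g; lra.
apply: (cvx_strict (p0 := p0) (p1 := pp x)) => //; try lra; first exact: good_cvx.
  by rewrite p0E /g; lra.
rewrite mulrAC ler_pdivrMr ?mulr_gt0 //.
have : pp x - p0 <= 2 * B by move: b0 b1; rewrite !ler_norml => /andP[? ?] /andP[? ?]; lra.
by move=> h; have -> : pp x - (pp x - d) = d by [ring]; rewrite ler_pM2l.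
Qed.

End ExtremalSlopes.

(** * One of the two extremal slopes has mean zero *)

Section Dichotomy.
Variable R : realType.
Variables (H : R -> R -> R).
Hypotheses (gH : good H) (pH : forall x, H (x + 1) = H x) (cf : c_free H < c_bounded H).
Let c := c_bounded H.
Let pp x := pmax (H x) c.
Let pr x := pmax (refl H x) c.

Lemma refl_periodic x : refl H (x + 1) = refl H x.
Proof.
rewrite /refl; apply/funext => q; rewrite opprD -{2}(subrK 1 (- x)) pH.
by [].
Qed.

Lemma refl_minH x : minH (refl H) x = minH H (- x).
Proof.
rewrite /minH; congr inf; apply/seteqP; split=> _ [q _ <-].
  by exists (- q).
by exists (- q) => //; rewrite /refl opprK.
Qed.

Lemma refl_c_free : c_free (refl H) < c.
Proof.
apply: le_lt_trans cf; apply: c_free_le; first exact: refl_good.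
by move=> x; rewrite refl_minH; exact: minH_le_c_free.
Qed.

(** A periodic critical subsolution shows that both increments are nonnegative. If both were
    positive, a mixture of the two extremal slopes with mean zero would have a bounded primitive,
    strictly subcritical by convexity. *)
Lemma zero_rotation (P Pr : R -> R) : has_deriv P pp -> has_deriv Pr pr -> P 1 = P 0 \/ Pr 1 = Pr 0.
Proof.
move=> dP dPr; have gR := refl_good gH; have cf' : c_free H < c := cf.
have cpp : continuous pp := pp_cont gH cf.
have cpr : continuous pr := pp_cont gR refl_c_free.
have [w [bw sw pw]] := critical_periodic gH pH.
have w01 : w 1 = w 0 by have := pw 0; rewrite add0r.
have I0 : 0 <= P 1 - P 0.
  have := @sub_le_primitive _ H gH w pp P c 0 1 ler01 dP cpp (fun z _ _ => sw z).
  by move=> h; have := h (fun z q _ _ => @pp_max _ _ _ gH z q); rewrite w01 subrr.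
have J0 : 0 <= Pr 1 - Pr 0.
  have := @sub_le_primitive _ _ gR (fun x => w (- x)) pr Pr c 0 1 ler01 dPr cpr (fun z _ _ => refl_sub sw z).
  move=> h; have := h (fun z q _ _ => @pp_max _ _ _ gR z q); rewrite oppr0.
  by have := pw (- 1); rewrite addrC subrr => <-; rewrite subrr.
have [->|I1] := eqVneq (P 1) (P 0); first by left.
have [->|J1] := eqVneq (Pr 1) (Pr 0); first by right.
exfalso.
have {I1}I0 : 0 < P 1 - P 0 by rewrite lt_neqAle eq_sym subr_eq0 I1.
have {J1}J0 : 0 < Pr 1 - Pr 0 by rewrite lt_neqAle eq_sym subr_eq0 J1.
set I := P 1 - P 0 in I0; set J := Pr 1 - Pr 0 in J0.
(* The weight for which the mean [t * I - (1 - t) * J] of [q] vanishes, so that [Q] is periodic. *)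
pose t := J / (I + J).
have IJ : 0 < I + J by lra.
have tE : t * (I + J) = J by rewrite /t divfK // gt_eqF.
have t0 : 0 < t by rewrite divr_gt0.
have t1 : t < 1 by rewrite ltr_pdivrMr //; lra.
pose q x := t * pp x + (1 - t) * - pr (- x).
pose Q x := t * P x + (1 - t) * Pr (- x).
have dQ : has_deriv Q q.
  move=> x; have H2 : is_derive x (1:R) (fun x : R => - x) (- 1) by apply: is_derive_eq.
  have H3 := @is_derive1_comp R Pr (fun x : R => - x) x _ _ (dPr (- x)) H2.
  rewrite mulrN1 in H3.
  exact: is_deriveD (is_deriveZ t (dP x)) (is_deriveZ (1 - t) H3).
have cq : continuous q.
  move=> x; apply: cvgD; apply: cvgMr; first exact: cpp.
  by apply: cvgN; exact: (contN cpr).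
have pq x : q (x + 1) = q x.
  rewrite /q; congr (_ * _ + _ * - _); first exact: pp_periodic.
  rewrite -[in RHS](subrK 1 (- x)) -opprD /pr; congr pmax.
  by rewrite refl_periodic.
have pQ : periodic Q 1.
  move=> x; have h := prim_increment dQ pq x (-1).
  have Pi := prim_increment dP (pp_periodic c pH) (-1) 0.
  rewrite addNr add0r in h Pi.
  suff : Q 0 - Q (- 1) = 0 by lra.
  have -> : Q 0 - Q (- 1) = t * (P 0 - P (- 1)) - (1 - t) * (Pr 1 - Pr 0).
    by rewrite /Q oppr0 opprK; ring.
  by rewrite Pi -/I -/J; lra.
have [M MP] := periodic_bounded (has_deriv_cont dQ) pQ.
pose g := c - c_free H; have g0 : 0 < g by rewrite subr_gt0.
pose h := Num.min t (1 - t) * g.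
have h0 : 0 < h by rewrite mulr_gt0 // lt_min t0 /=; lra.
suff : c <= c - h by lra.
rewrite {1}/c; apply: (c_bounded_le gH (u := Q)); first by apply/boundedP; exists M.
apply: (C1_sub gH dQ cq) => x.
have [p0 p0E] := minH_attained gH x; have m := minH_le_c_free gH x.
have l0 : H x p0 <= c by rewrite p0E; apply: le_trans m (ltW cf).
have p0p : p0 <= pp x := pp_max gH l0.
have p0p' : p0 < pp x.
  rewrite lt_neqAle p0p andbT; apply/eqP => e; have := pp_level gH cf x.
  by rewrite -/(pp x) -e p0E; lra.
have prx : H x (- pr (- x)) = c.
  have hr : refl H (- x) (pr (- x)) = c := pp_level gR refl_c_free (- x).
  by move: hr; rewrite {1}/refl opprK.
have p0r : - pr (- x) <= p0.
  rewrite lerNl; apply: (pp_max gR); rewrite /refl !opprK; exact: l0.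
have p0r' : - pr (- x) < p0.
  rewrite lt_neqAle p0r andbT; apply/eqP => e; have := prx.
  by rewrite e p0E; lra.
have h1 : h <= t * g by rewrite /h ler_pM2r // ge_min lexx.
have h2 : h <= (1 - t) * g by rewrite /h ler_pM2r // ge_min lexx orbT.
(* On either side of the minimiser, [q x] is compared with the extremal slope on that side; its
   relative distance from it is at least [1 - t] or [t]. *)
have [pq0|qp0] := leP p0 (q x).
  apply: (le_trans _ (_ : c - (1 - t) * g <= _)); last by lra.
  apply: (cvx_strict (p0 := p0) (p1 := pp x)) => //; first exact: good_cvx.
  - by rewrite /q; nra.
  - by rewrite p0E /g; lra.
  - by rewrite pp_level.
  - exact: ltW.
  - by rewrite /q; nra.
apply: (le_trans _ (_ : c - t * g <= _)); last by lra.
have := @cvx_strict _ c (fun s => H x (- s)) (- p0) (pr (- x)) (- q x) g t.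
rewrite !opprK; apply.
- by apply: (@cvxN _ (H x)); exact: good_cvx.
- by rewrite lerN2 ltW.
- by rewrite /q; nra.
- by lra.
- by rewrite p0E /g; lra.
- by rewrite prx.
- exact: ltW.
- by rewrite /q; nra.
Qed.

End Dichotomy.

(** * Closed measures, minimal action, and the sign condition *)

Section MatherMeasures.
Variable R : realType.
Local Notation phase := (measurableTypeR R * measurableTypeR R)%type.
Implicit Types (mu : probability phase R) (f v : R -> R).

(* Monotonicity holds for the integral of arbitrary functions, so the Lagrangian need not be
   shown to be measurable. *)
Lemma le_integral_pw mu (f g : phase -> \bar R) : (forall z, (f z <= g z)%E) ->
  (\int[mu]_z f z <= \int[mu]_z g z)%E.
Proof.
move=> fg; rewrite /integral !patch_setT.
have fg' : {in [set: phase], forall z, (f z <= g z)%E} by move=> z _; exact: fg.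
apply: leeB; apply: le_ereal_sup => _ [h hf <-]; exists h => // z; apply: le_trans (hf z) _.
  by apply: (funepos_le fg'); rewrite inE.
by apply: (funeneg_le fg'); rewrite inE.
Qed.

Lemma measurable_comp_fst f : continuous f -> measurable_fun setT (fun z : phase => (f z.1 : R)).
Proof.
move=> cf; apply: (measurableT_comp (f := f)); last exact: measurable_fst.
exact: continuous_measurable_fun.
Qed.

Lemma bounded_phase (g : phase -> R) (M : R) : (forall z, `|g z| <= M) -> [bounded g z | z in [set: phase]].
Proof.
move=> gM; have PF : ProperFilter (globally [set: phase]) by exact: (@globally_properfilter _ _ (0, 0)).
by rewrite ex_bound; exists M => z _; exact: gM.
Qed.

Lemma integrable_fst mu f : continuous f -> bounded_fun f ->
  mu.-integrable setT (EFin \o (fun z : phase => f z.1)).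
Proof.
move=> cf /boundedP[M MP]; apply: measurable_bounded_integrable => //.
- exact: (eq_ind_r (fun x => (x < +oo)%E) (ltry 1) (@probability_setT _ _ _ mu)).
- exact: measurable_comp_fst.
- by apply: (@bounded_phase _ M) => z; exact: MP.
Qed.

Lemma integrable_snd mu : (\int[mu]_z (`|z.2|)%:E < +oo)%E ->
  mu.-integrable setT (EFin \o (fun z : phase => z.2)).
Proof.
move=> h; apply/integrableP; split=> //.
by apply/measurable_EFinP; exact: measurable_snd.
Qed.

Lemma measurable_fst_snd f : continuous f ->
  measurable_fun setT (fun z : phase => (f z.1 * z.2 : R)).
Proof.
move=> cf; apply: measurable_funM; last exact: measurable_snd.
exact: measurable_comp_fst.
Qed.

(** The test functions of [closed_measure] are bounded, and a primitive of a bounded function need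
    not be; cutting off repairs this. *)
Definition cutoff (n : nat) (x : R) : R := Num.max 0 (Num.min 1 (n%:R + 1 - `|x|)).

Lemma cutoff_cont n : continuous (cutoff n).
Proof.
move=> x; apply: (@continuous_max R R (fun=> 0) (fun x => Num.min 1 (n%:R + 1 - `|x|)) x).
  exact: cvg_cst.
apply: (@continuous_min R R (fun=> 1) (fun x => n%:R + 1 - `|x|) x); first exact: cvg_cst.
by apply: cvgB; [exact: cvg_cst|apply: cvg_norm; exact: cvg_id].
Qed.

Lemma cutoff01 n x : 0 <= cutoff n x /\ cutoff n x <= 1.
Proof. by rewrite /cutoff le_max lexx ge_max ler01 ge_min lexx. Qed.

Lemma cutoff_in n x : `|x| <= n%:R -> cutoff n x = 1.
Proof.
by move=> xn; rewrite /cutoff; have -> : Num.min 1 (n%:R + 1 - `|x|) = 1 by [apply/min_idPl; lra]; apply/max_idPr.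
Qed.

Lemma cutoff_out n x : n%:R + 1 <= `|x| -> cutoff n x = 0.
Proof.
move=> xn; rewrite /cutoff; apply/max_idPl; rewrite ge_min; apply/orP; right; lra.
Qed.

(** The primitive of the cut-off function is Lipschitz and constant beyond each end of a compact
    interval, hence bounded, so it may be tested. *)
Lemma closed_cutoff mu f n : closed_measure mu -> continuous f -> bounded_fun f ->
  (\int[mu]_z (f z.1 * cutoff n z.1 * z.2)%:E = 0)%E.
Proof.
move=> [_ cl] cf /boundedP[B BP].
pose g x := f x * cutoff n x.
have cg : continuous g by move=> x; apply: cvgM; [exact: cf|exact: cutoff_cont].
have gB x : `|g x| <= B.
  rewrite /g normrM; have [c0 c1] := cutoff01 n x; rewrite (ger0_norm c0).
  by have := BP x; have := normr_ge0 (f x); nra.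
have [Z dZ] := primitive cg.
have CZ := derive_C1 dZ cg.
have B0 : 0 <= B by apply: le_trans (gB 0); rewrite normr_ge0.
have lipZ x y : `|Z x - Z y| <= B * `|x - y|.
  apply: (lip_bound (u := Z) (B := B)) => {}x {}y xy; have [m [_ _ ->]] := mvt xy dZ.
  by rewrite normrM (gtr0_norm (_ : 0 < y - x)) ?subr_gt0 // ler_wpM2r ?gB // subr_ge0 ltW.
have bZ : bounded_fun Z.
  have [M M0 MP] := bounded_seg (- (n%:R + 1)) (n%:R + 1) (has_deriv_cont dZ).
  have n0 : 0 <= n%:R :> R by [].
  apply/boundedP; exists M => x.
  have [xn|nx] := leP x (n%:R + 1); last first.
    suff -> : Z x = Z (n%:R + 1) by apply: MP; lra.
    have [m [m1 _ E]] := mvt nx dZ.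
    by move: E; rewrite /g cutoff_out ?mulr0 ?mul0r; [lra|rewrite ger0_norm; lra].
  have [xn'|nx] := leP (- (n%:R + 1)) x; first by apply: MP; lra.
  suff -> : Z x = Z (- (n%:R + 1)) by apply: MP; lra.
  have [m [_ m1 E]] := mvt nx dZ.
  by move: E; rewrite /g cutoff_out ?mulr0 ?mul0r; [lra|rewrite ler0_norm; lra].
have lZ : lipschitz Z.
  have PF : ProperFilter (globally ([set: R] `*` [set: R])) by exact: (@globally_properfilter _ _ (0, 0)).
  by apply: (@klipschitzW _ _ _ B) => -[x y] _ /=; exact: lipZ.
by have := cl Z CZ bZ lZ; rewrite (has_deriv_derive1 dZ).
Qed.

(** Dominated convergence removes the cutoff; the majorant [B * |q|] is integrable by the first
    clause of [closed_measure]. *)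
Lemma closed_bounded mu f : closed_measure mu -> continuous f -> bounded_fun f ->
  (\int[mu]_z (f z.1 * z.2)%:E = 0)%E.
Proof.
move=> clm cf bf; have [B BP] := (boundedP _).1 bf.
have B0 : 0 <= B by apply: le_trans (BP 0); rewrite normr_ge0.
have iq := integrable_snd clm.1.
have [|||||_ _ cvg] := @dominated_convergence _ _ _ mu setT measurableT
  (fun n z => (f z.1 * cutoff n z.1 * z.2)%:E) (fun z => (f z.1 * z.2)%:E) (fun z => (B * `|z.2|)%:E).
- move=> n; apply/measurable_EFinP; apply: (measurable_fst_snd (f := fun x => f x * cutoff n x)).
  by move=> x; apply: cvgM; [exact: cf|exact: cutoff_cont].
- by apply/measurable_EFinP; exact: measurable_fst_snd.
- apply: nearW => z _; apply: cvg_near_cst; near=> n; congr EFin.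
  by rewrite cutoff_in ?mulr1 //; near: n; exact: nbhs_infty_ger.
- have := integrableZl measurableT B (integrable_abse iq).
  by apply: eq_integrable => // z _ /=; rewrite EFinM.
- apply: nearW => z n _; rewrite lee_fin !normrM -mulrA.
  have [c0 c1] := cutoff01 n z.1; rewrite (ger0_norm c0).
  have := BP z.1; have := normr_ge0 (f z.1); have := normr_ge0 z.2 => h1 h2 h3.
  apply: ler_pM => //; first by rewrite mulr_ge0.
  by rewrite -[leRHS]mul1r ler_wpM2r.
rewrite -(cvg_lim (@ereal_hausdorff R) cvg).
rewrite (_ : (fun n => _) = fun=> 0%E); first exact: (lim_cst (@ereal_hausdorff R)).
by apply/funext => n; exact: closed_cutoff.
Unshelve. all: by end_near. Qed.

Lemma integral_prob_cst mu (r : R) : (\int[mu]_z r%:E = r%:E)%E.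
Proof.
have := @integral_cst _ phase R mu setT measurableT r%:E; rewrite /cst => ->.
by rewrite -[RHS]mule1; congr (_ * _)%E; exact: probability_setT.
Qed.

Section Minimisation.
Variable G : R -> R -> R.
Hypothesis gG : good G.

Lemma lagrangian_ge x p q : ((p * q - G x p)%:E <= lagrangian G x q)%E.
Proof. by apply: ereal_sup_ubound; exists p. Qed.

Let m mu := fine (\int[mu]_z (minH G z.1)%:E)%E.

Lemma bounded_minH : bounded_fun (minH G).
Proof. by apply/boundedP; exact: minH_bounded. Qed.

Lemma mE mu : (\int[mu]_z (minH G z.1)%:E)%E = (m mu)%:E.
Proof.
by rewrite fineK //; apply: integrable_fin_num => //; exact: (integrable_fst mu (minH_cont gG) bounded_minH).
Qed.

(* A continuous almost-minimising selection [p(x)] gives [L(x,q) >= p(x) q - minH x - e],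
   and the first term integrates to zero. *)
Lemma action_ge mu : closed_measure mu -> ((- m mu)%:E <= \int[mu]_z lagrangian G z.1 z.2)%E.
Proof.
move=> clm; apply/lee_addgt0Pr => e e0.
(* The margin [e] makes the selection continuous; at the level [minH G] itself [pmax_cont] does not
   apply. *)
pose f x := minH G x + e; pose p x := pmax (G x) (f x).
have cf : continuous f by move=> x; apply: cvgD; [exact: minH_cont|exact: cvg_cst].
have mf x : minH G x < f x by rewrite /f ltrDl.
have cp : continuous p := pmax_cont gG cf mf.
have pE x : G x (p x) = f x.
  apply: pmax_level; [exact: good_cont|exact: good_coercive|].
  by have [q qE] := minH_attained gG x; exists q; rewrite qE ltW.
have [M MP] := minH_bounded gG.
have bp : bounded_fun p.
  have [B B0 BP] := good_coer gG (M + e + 1); apply/boundedP; exists B => x.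
  rewrite leNgt; apply/negP => /ltW /(BP x); rewrite pE /f.
  by have := MP x; rewrite ler_norml => /andP[_]; lra.
have bf : bounded_fun f.
  apply/boundedP; exists (M + e) => x; apply: le_trans (ler_normD _ _) _.
  by rewrite (gtr0_norm e0) lerD2r.
have ipq : mu.-integrable setT (EFin \o (fun z : phase => p z.1 * z.2)).
  have [B BP] := (boundedP _).1 bp.
  have bpz : [bounded p z.1 | z in [set: phase]] by apply: (@bounded_phase _ B) => z; exact: BP.
  have mp : measurable_fun setT (fun z : phase => p z.1).
    exact: measurable_comp_fst.
  have := integrableMr measurableT mp bpz (integrable_snd clm.1).
  by apply: eq_integrable => // z _ /=; rewrite EFinM.
have if1 := integrable_fst mu cf bf.
have le1 : (\int[mu]_z ((p z.1 * z.2)%:E - (f z.1)%:E) <= \int[mu]_z lagrangian G z.1 z.2)%E.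
  by apply: le_integral_pw => z; rewrite -EFinB -pE; exact: lagrangian_ge.
have fE : (\int[mu]_z (f z.1)%:E = (m mu + e)%:E)%E.
  have i1 := integrable_fst mu (minH_cont gG) bounded_minH.
  have i2 := finite_measure_integrable_cst mu e measurableT.
  have := integralD_EFin measurableT i1 i2.
  by rewrite /comp /cst mE integral_prob_cst; apply: etrans; apply: eq_integral => z _.
rewrite (integralB_EFin measurableT ipq if1) closed_bounded // fE in le1.
have -> : (- m mu)%:E = ((0 - (m mu + e)%:E) + e%:E)%E by rewrite -EFinB -EFinD; congr EFin; ring.
by rewrite leeD2r.
Qed.

Lemma m_le mu c : (forall x, minH G x <= c) -> m mu <= c.
Proof.
move=> mc; rewrite -lee_fin -mE.
rewrite -(integral_prob_cst mu c).
by apply: le_integral_pw => z; rewrite lee_fin.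
Qed.

Lemma dirac_closed (y : R) : closed_measure (dirac ((y, 0) : phase) : probability phase R).
Proof.
split.
  rewrite integral_dirac //; first by rewrite diracT mul1e normr0 ltry.
  by apply/measurable_EFinP; apply: measurableT_comp => //; exact: measurable_snd.
move=> phi Cphi _ _; rewrite integral_dirac //; first by rewrite diracT mul1e mulr0.
by apply/measurable_EFinP; apply: measurable_fst_snd; exact: Cphi.2.
Qed.

(** Avoids measurability of the Lagrangian: it is majorised by a measurable function equal to [- c]
    at the atom and infinite elsewhere. *)
Lemma dirac_action y c : (forall p, c <= G y p) ->
  (\int[dirac ((y, 0%R) : phase)]_z lagrangian G z.1 z.2 <= (- c)%:E)%E.
Proof.
move=> cG; pose a : phase := (y, 0).
pose U (z : phase) : \bar R := if z \in [set a] then (- c)%:E else +oo%E.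
have mU : measurable_fun setT U.
  have ma : measurable [set a].
    have -> : [set a] = [set y] `*` [set (0 : measurableTypeR R)].
      by apply/seteqP; split=> [_ ->|[z1 z2] /= [-> ->]].
    by apply: measurableX; exact: measurable_set1.
  apply: measurable_fun_ifT => //.
  by apply: (measurable_fun_bool true); rewrite setTI; have -> : (fun t : phase => t \in [set a]) @^-1` [set true] = [set a] by [apply/seteqP; split=> [z /set_mem//|z ->]; exact/mem_set].
apply: (le_trans _ (_ : \int[dirac a]_z U z <= _)%E).
  apply: le_integral_pw => z; rewrite /U; case: ifPn => [|_]; last exact: leey.
  rewrite inE => ->; apply: ge_ereal_sup => _ [p _ <-]; rewrite lee_fin mulr0 sub0r lerN2.
  exact: cG.
rewrite integral_dirac // diracT mul1e /U ifT //; by rewrite inE.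
Qed.

(** Dirac masses with zero velocity over [Eset] are minimising, which gives one direction.
    Conversely, comparison with the one at [y0] shows that [minH G] has integral [c] for any
    minimiser; the nonnegative function [c - minH G] then vanishes almost everywhere. *)
Lemma mather_Eset c v y0 : (forall x, minH G x <= c) -> Eset G c y0 ->
  continuous v -> bounded_fun v ->
  (forall mu, mather_measure G mu -> (\int[mu]_z (v z.1)%:E <= 0)%E) <->
  (forall y, Eset G c y -> v y <= 0).
Proof.
move=> mc Ey0 cv bv; split=> [h y Ey|h mu [clm minm]].
  have := h (dirac ((y, 0) : phase)) _; rewrite integral_dirac //; last first.
    by apply/measurable_EFinP; exact: measurable_comp_fst.
  rewrite diracT mul1e lee_fin; apply; split; first exact: dirac_closed.
  move=> nu cln; apply: le_trans (dirac_action Ey) _; apply: le_trans (action_ge cln).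
  by rewrite lee_fin lerN2 m_le.
have mmu : m mu = c.
  apply/eqP; rewrite eq_le m_le //= -lerN2 -lee_fin; apply: le_trans (action_ge clm) _.
  by apply: le_trans (minm _ (dirac_closed y0)) _; exact: dirac_action.
have bm : bounded_fun (fun x => c - minH G x).
  have [M MP] := minH_bounded gG; apply/boundedP; exists (`|c| + M) => x.
  by apply: le_trans (ler_normB _ _) _; rewrite lerD2l.
have cm : continuous (fun x => c - minH G x).
  by move=> x; apply: cvgB; [exact: cvg_cst|exact: minH_cont].
have mcm : measurable_fun setT (fun z : phase => (c - minH G z.1)%:E).
  by apply/measurable_EFinP; exact: (measurable_comp_fst cm).
have ae0 : ae_eq mu setT (fun z : phase => (c - minH G z.1)%:E) (cst 0%E).
  apply/(ae_eq_integral_abs mu measurableT mcm).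
  have -> : (\int[mu]_z `|(c - minH G z.1)%:E| = \int[mu]_z (c%:E - (minH G z.1)%:E))%E.
    by apply: eq_integral => z _; rewrite gee0_abs ?lee_fin ?subr_ge0 ?mc // EFinB.
  have i1 := integrable_fst mu (minH_cont gG) bounded_minH.
  have i2 := finite_measure_integrable_cst mu c measurableT.
  have := integralB_EFin measurableT i2 i1; rewrite /cst => ->.
  by rewrite mE mmu integral_prob_cst subee.
(* Only the positive part of [v] has to vanish almost everywhere; it majorises [v]. *)
pose w x := Num.max (v x) 0.
have cw : continuous w by move=> x; apply: (@continuous_max R R v (fun=> 0) x); [exact: cv|exact: cvg_cst].
have mw : measurable_fun setT (fun z : phase => (w z.1)%:E).
  by apply/measurable_EFinP; exact: (measurable_comp_fst cw).
apply: (le_trans _ (_ : \int[mu]_z `|(w z.1)%:E| <= 0)%E).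
  by apply: le_integral_pw => z; rewrite lee_fin; apply: le_trans (ler_norm _); rewrite /w le_max lexx.
rewrite (ae_eq_integral_abs mu measurableT mw).2 //.
apply: filterS ae0 => z /(_ I) /= [hz] _; congr EFin; apply/max_idPr; apply: h => p.
by have := minH_le gG z.1 p; lra.
Qed.

End Minimisation.
End MatherMeasures.

(** * An interval outside which the potential vanishes *)

Section SupportInterval.
Variable R : realType.

Lemma supp_interval (V : R -> R) : continuous V -> compact (supp V) -> exists a b : R,
  [/\ a <= b, forall x, x <= a -> V x = 0, forall x, b <= x -> V x = 0 &
      (exists x, V x != 0) -> a = inf (supp V) /\ b = sup (supp V)].
Proof.
move=> cV cs; have [A [A0 AV]] := supp_seg cs.
have [[x0 Vx0]|nV] := pselect (exists x, V x != 0); last first.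
  have V0 x : V x = 0 by apply/eqP; apply: contrapT => /negP Vx; apply: nV; exists x.
  by exists 0, 0; split=> // -[x]; rewrite V0 eqxx.
have in_supp x : V x != 0 -> supp V x by move=> Vx; apply: subset_closure.
have inA x : supp V x -> `|x| <= A.
  move=> sx; rewrite leNgt; apply/negP => Ax.
  have := sx _ (nbhsx_ballx x _ (_ : 0 < `|x| - A)); rewrite subr_gt0 => /(_ Ax)[y [/= Vy]].
  rewrite /ball /= => yx; suff : V y = 0 by move/eqP: Vy.
  apply: AV; have := ler_normD y (x - y); have -> : y + (x - y) = x by ring.
  lra.
have h1 : has_inf (supp V).
  split; first by exists x0; exact: in_supp.
  by exists (- A) => x /inA; rewrite ler_norml => /andP[].
have h2 : has_sup (supp V).
  split; first by exists x0; exact: in_supp.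
  by exists A => x /inA; rewrite ler_norml => /andP[].
have lo x : V x != 0 -> inf (supp V) <= x by move=> /in_supp; apply: inf_lbound; exact: h1.2.
have up x : V x != 0 -> x <= sup (supp V) by move=> /in_supp; apply: sup_upper_bound.
have nz x : V x != 0 -> exists2 d : R, 0 < d & forall y, `|y - x| < d -> V y != 0.
  move=> Vx; have n0 : 0 < `|V x| by rewrite normr_gt0.
  have [d d0 dP] := (contP _).1 cV x _ n0; exists d => // y /dP.
  by apply: contraTneq => ->; rewrite sub0r normrN ltxx.
exists (inf (supp V)), (sup (supp V)); split=> //.
- by apply: le_trans (lo _ Vx0) (up _ Vx0).
- move=> x xa; apply/eqP; apply: contrapT => /negP Vx.
  have [d d0 dP] := nz x Vx; have : inf (supp V) <= x - d / 2.
    by apply: lo; apply: dP; rewrite ltr_norml; apply/andP; split; lra.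
  lra.
- move=> x xb; apply/eqP; apply: contrapT => /negP Vx.
  have [d d0 dP] := nz x Vx; have : x + d / 2 <= sup (supp V).
    by apply: up; apply: dP; rewrite ltr_norml; apply/andP; split; lra.
  lra.
Qed.

End SupportInterval.

(** * Assembly of the three cases *)

Section Conclusions.
Variable R : realType.
Implicit Types (f v w : R -> R) (d e x y z p q l r lam rho : R).

Variables (G H : R -> R -> R) (a b : R) (u uH : R -> R -> R) (u0H : R -> R).
Hypotheses (gG : good G) (gH : good H) (pH : forall x, H (x + 1) = H x).
Hypothesis ab : a <= b.
Hypotheses (GHl : forall z, z <= a -> G z = H z) (GHr : forall z, b <= z -> G z = H z).
Hypothesis famG : discounted_family G u.
Hypothesis famH : discounted_family H uH.
Hypothesis limH : forall x e, 0 < e -> \forall lam \near 0^'+, `|uH lam x - u0H x| <= e.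

Let c := c_bounded G.
Let bu lam (l0 : 0 < lam) := (famG l0).1.
Let su lam (l0 : 0 < lam) := (famG l0).2.
Let buH lam (l0 : 0 < lam) := (famH l0).1.
Let suH lam (l0 : 0 < lam) := (famH l0).2.

Lemma EsetP (F : R -> R -> R) k y : good F -> Eset F k y <-> k <= minH F y.
Proof.
move=> gF; have [p pE] := minH_attained gF y; split=> [Ey|h q].
  by rewrite -pE.
by apply: le_trans h _; exact: minH_le.
Qed.

Lemma periodic_Eset : exists y, minH H y = c_free H.
Proof.
have [y [_ yP]] := max_seg (@ler01 R) (minH_cont gH).
exists y; apply/eqP; rewrite eq_le (minH_le_c_free gH) /=.
apply: (c_free_le gH) => x; have [n nx] := floor_decomp x.
have -> : minH H x = minH H (x - n%:~R).
  have := @periodic_int R R (minH H) _ (- n) x; rewrite mulrNz => -> // z.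
  by rewrite /minH pH.
by apply: yP; move: nx => /andP[]; lra.
Qed.

(** The supremum of [minH G] is attained: either over [[a, b]], or it equals that of [minH H],
    reached at a distant integer translate. *)
Lemma perturb_Eset : exists y, Eset G (c_free G) y.
Proof.
have [y1 [_ y1P]] := max_seg ab (minH_cont gG).
have [yH yHE] := periodic_Eset.
have mG x : minH G x <= Num.max (minH G y1) (c_free H).
  rewrite le_max; have [xa|ax] := leP x a.
    by apply/orP; right; rewrite /minH GHl //; exact: (minH_le_c_free gH).
  have [bx|xb] := leP b x; last by apply/orP; left; apply: y1P; lra.
  by apply/orP; right; rewrite /minH GHr //; exact: (minH_le_c_free gH).
have := c_free_le gG mG; rewrite le_max => /orP[h|h].
  by exists y1; apply/EsetP.
have [N _ NP] := perturb_translate pH GHl GHr (or_introl erefl) yH yH.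
have Ny := NP N (leqnn N) yH (lexx _) (lexx _).
by exists (yH + 1 * N%:R); apply/EsetP; rewrite // /minH Ny -/(minH H yH) yHE.
Qed.

(** Both constraints disappear together: a point of [Eset] forces [c = c_free G], and [c = c_free G]
    provides the point [y0] for [mather_Eset]. *)
Lemma Sb_minusE : Sb_minus G = Smin G c.
Proof.
have mc x : minH G x <= c := le_trans (minH_le_c_free gG x) (c_free_le_bounded gG).
apply/seteqP; split=> v [bv sv hv].
  have {}sv : sub G (fun=> c) v by apply/(visc_sub_stationaryP gG).
  split=> // y Ey; have cE : c = c_free G.
    apply/eqP; rewrite eq_le (c_free_le_bounded gG) andbT.
    by apply: le_trans (minH_le_c_free gG y); apply/EsetP.
  by apply: (mather_Eset gG mc Ey (sub_cont gG sv) bv).1 => //; exact: hv.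
split=> //; first by apply/(visc_sub_stationaryP gG).
move=> cE; have [y0 Ey0] := perturb_Eset; rewrite -cE in Ey0.
exact: (mather_Eset gG mc Ey0 (sub_cont gG sv) bv).2.
Qed.

Lemma conclusionI : c_bounded H < c ->
  {family compact, u lam @[lam --> 0^'+] --> ustar u} /\
  [/\ c = c_free G, is_pointwise_sup (ustar u) (Sb_minus G),
      ustar u x @[x --> +oo] --> +oo & ustar u x @[x --> -oo] --> +oo].
Proof.
move=> cH; have [vb [bvb svb]] := critical_bounded_sub gG gH pH ab GHl GHr.
have cE : c = c_free G.
  (* Otherwise gluing would give [c_bounded G] at most the maximum of [c_bounded H] and [c_free G],
     both below [c]. *)
  apply/eqP; rewrite eq_le (c_free_le_bounded gG) andbT leNgt; apply/negP => cf.
  have := @c_bounded_perturb_le _ G H a b gG gH pH ab GHl GHr (Num.max (c_bounded H) (c_free G)).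
  rewrite !le_max !lexx orbT => /(_ isT isT); rewrite !leNgt -/c.
  by rewrite cH cf.
have Ene : exists y, Eset G c y by rewrite cE; exact: perturb_Eset.
have lo v : Smin G c v -> forall x e, 0 < e -> \forall lam \near 0^'+, v x - e <= u lam x.
  by move=> [_ sv vE]; exact: (caseI_lower gG gH pH GHl GHr bu su cH sv vE).
have [cv sp] := limit_from_bounds gG bu su bvb svb (caseI_ub gG bu su bvb svb Ene) lo
  (caseI_attained gG bu su bvb svb Ene).
have [c1 c2] := caseI_coercive gG gH pH ab GHl GHr bu su bvb svb cH Ene.
by split=> //; rewrite Sb_minusE.
Qed.

(** Shared by (II) and (III), where [ustar] is bounded and is itself the largest candidate. [D]
    carries the extra constraint: empty in (III), a half-line in (II). *)
Lemma conclusion_bounded vb (D : R -> Prop) : bounded_fun vb -> sub G (fun=> c) vb ->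
  (exists M : R, forall lam x, 0 < lam -> lam <= 1 -> u lam x <= M) ->
  (forall v, Smin G c v -> (forall x, D x -> v x <= u0H x) ->
     forall x e, 0 < e -> \forall lam \near 0^'+, v x - e <= u lam x) ->
  (\forall lam \near 0^'+, forall x, D x -> u lam x <= uH lam x) ->
  [/\ {family compact, u lam @[lam --> 0^'+] --> ustar u},
      is_pointwise_sup (ustar u) [set v | Sb_minus G v /\ forall x, D x -> v x <= u0H x] &
      bounded_fun (ustar u)].
Proof.
move=> bvb svb [M MP] lo dom.
have ub x : exists M : R, \forall lam \near 0^'+, u lam x <= M.
  by exists M; apply: filterS (near_pos ltr01) => lam [l0 l1]; exact: MP.
have bs : bounded_fun (ustar u).
  have [C CP] := ustar_lower gG bu su bvb svb ub.
  apply/boundedP; exists (`|C| + `|M|) => x.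
  have : ustar u x <= M.
    apply: (ustar_le gG bu su bvb svb ub).
    by apply: filterS (near_pos ltr01) => lam [l0 l1]; exact: MP.
  have := CP x; have := ler_norm C; have := ler_norm M.
  have := normr_ge0 C; have := normr_ge0 M.
  by move=> *; rewrite ler_norml; apply/andP; split; lra.
have Ss : Smin G c (ustar u).
  split=> //; first exact: (ustar_sub gG bu su bvb svb ub).
  by move=> y; exact: (ustar_le0 gG bu su bvb svb ub).
have Ds x : D x -> ustar u x <= u0H x.
  move=> Dx; apply/ler_addgt0Pr => e e0; apply: (ustar_le gG bu su bvb svb ub).
  apply: filterS2 dom (limH x e0) => lam /(_ x Dx) h; rewrite ler_norml => /andP[_]; lra.
rewrite Sb_minusE; have [cv sp] := limit_from_bounds gG bu su bvb svb
  (S := [set v | Smin G c v /\ forall x, D x -> v x <= u0H x]) ub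
  (fun v Sv => lo v Sv.1 Sv.2) (fun x => ex_intro2 _ _ (ustar u) (conj Ss Ds) erefl).
by split.
Qed.

Hypothesis cGH : c_bounded G = c_bounded H.

Let suHc lam (l0 : 0 < lam) : visc_sol (discounted H lam c) (uH lam).
Proof. by rewrite /c cGH; exact: suH. Qed.

Lemma conclusionIII : c_bounded H = c_free H -> condU H u0H ->
  [/\ {family compact, u lam @[lam --> 0^'+] --> ustar u}, c = c_free G,
      is_pointwise_sup (ustar u) (Sb_minus G) & bounded_fun (ustar u)].
Proof.
move=> cHf U; have [vb [bvb svb]] := critical_bounded_sub gG gH pH ab GHl GHr.
have cE : c = c_free G.
  apply/eqP; rewrite eq_le (c_free_le_bounded gG) andbT /c cGH cHf.
  exact: (c_free_perturb_ge gG gH pH GHl GHr).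
have EH : exists y, Eset H c y.
  by have [y yE] := periodic_Eset; exists y; apply/EsetP; rewrite // yE /c cGH cHf.
have pu : periodic u0H 1.
  move=> x; apply: EFin_inj; rewrite (U (x + 1)) (U x); congr ereal_sup.
  by apply/seteqP; split=> _ [v [pv sv vE] <-]; exists v => //; rewrite pv.
have umax v : periodic v 1 -> sub H (fun=> c) v ->
    (forall y, Eset H c y -> v y <= 0) -> forall x, v x <= u0H x.
  move=> pv sv vE x; apply: (pointwise_sup_ge _ U); split=> //.
    by apply/(visc_sub_stationaryP gH); rewrite -cGH.
  move=> y Ey; apply: vE; apply/EsetP => //; rewrite /minH.
  by move: Ey; rewrite /E_set /= => ->; rewrite /c cGH cHf.
have [||] := @conclusion_bounded vb (fun=> False) bvb svb (caseIII_ub gG pH GHl GHr bu su bvb svb EH).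
- move=> v Sv _; exact: (caseIII_lower gG gH pH GHl GHr bu su buH suHc limH pu umax Sv).
- by apply: nearW => lam x.
move=> cv sp bs; split=> //; move: sp; congr (is_pointwise_sup _ _).
by apply/seteqP; split=> v; [case|].
Qed.

Section CaseIIConclusion.
Hypothesis cf : c_free H < c_bounded H.

Let pp x := pmax (H x) (c_bounded H).
Let pr x := pmax (refl H x) (c_bounded H).

Lemma conclusionIIA P : has_deriv P pp -> P 1 = P 0 ->
  [/\ {family compact, u lam @[lam --> 0^'+] --> ustar u},
      is_pointwise_sup (ustar u) [set v | Sb_minus G v /\ forall x, x < a -> v x <= u0H x] &
      bounded_fun (ustar u)].
Proof.
move=> dP P10; have [vb [bvb svb]] := critical_bounded_sub gG gH pH ab GHl GHr.
have cE : c_bounded H = c by [].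
have cp : continuous pp := pp_cont gH cf.
have pP : periodic P 1.
  by move=> x; have := prim_increment dP (pp_periodic _ pH) x 0; rewrite add0r P10; lra.
have [eta [h0 [eta0 h00 st]]] := pp_strict gH cf.
have pm x q : H x q <= c -> q <= pp x by rewrite -cE; exact: pp_max.
have pl x : H x (pp x) = c by rewrite -cE; exact: pp_level.
have {}st x : H x (pp x - eta) <= c - h0 by rewrite -cE; exact: st.
apply: (conclusion_bounded bvb svb).
- exact: (caseII_ub gG gH ab GHl GHr bu su bvb svb dP cp pP pm pl).
- move=> v [_ sv vE] vu.
  exact: (caseII_lower gG gH GHl GHr bu su buH suHc limH dP cp pP pl eta0 h00 st sv vE vu).
- apply: filterS (caseII_left gG gH GHl bu su buH suHc bvb svb dP cp pP pm pl eta0 h00 st) => lam h x xa.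
  exact/h/ltW.
Qed.

Lemma conclusionIIB P : has_deriv P pr -> P 1 = P 0 ->
  [/\ {family compact, u lam @[lam --> 0^'+] --> ustar u},
      is_pointwise_sup (ustar u) [set v | Sb_minus G v /\ forall x, b < x -> v x <= u0H x] &
      bounded_fun (ustar u)].
Proof.
move=> dP P10; have [vb [bvb svb]] := critical_bounded_sub gG gH pH ab GHl GHr.
have cE : c_bounded H = c by [].
have gG' := refl_good gG; have gH' := refl_good gH.
have cf' := refl_c_free gH cf.
have ab' : - b <= - a by rewrite lerN2.
have GHl' z : z <= - b -> refl G z = refl H z.
  by move=> h; rewrite /refl GHr //; lra.
have GHr' z : - a <= z -> refl G z = refl H z.
  by move=> h; rewrite /refl GHl //; lra.
pose u' lam x := u lam (- x); pose uH' lam x := uH lam (- x).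
have bu' lam : 0 < lam -> bounded_fun (u' lam) by move=> l0; apply: refl_bounded; exact: bu.
have buH' lam : 0 < lam -> bounded_fun (uH' lam) by move=> l0; apply: refl_bounded; exact: buH.
have su' lam : 0 < lam -> visc_sol (discounted (refl G) lam c) (u' lam).
  by move=> l0; apply: refl_visc_sol; exact: su.
have suH' lam : 0 < lam -> visc_sol (discounted (refl H) lam c) (uH' lam).
  by move=> l0; apply: refl_visc_sol; exact: suHc.
have bvb' := refl_bounded bvb; have svb' := refl_sub svb.
have limH' x e : 0 < e -> \forall lam \near 0^'+, `|uH' lam x - u0H (- x)| <= e by exact: limH.
have pH' := refl_periodic pH.
have cp : continuous pr := pp_cont gH' cf'.
have pP : periodic P 1.
  by move=> x; have := prim_increment dP (pp_periodic _ pH') x 0; rewrite add0r P10; lra.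
have [eta [h0 [eta0 h00 st]]] := pp_strict gH' cf'.
have pm x q : refl H x q <= c -> q <= pr x by rewrite -cE; exact: pp_max.
have pl x : refl H x (pr x) = c by rewrite -cE; exact: pp_level.
have {}st x : refl H x (pr x - eta) <= c - h0 by rewrite -cE; exact: st.
apply: (conclusion_bounded bvb svb).
- have [M MP] := caseII_ub gG' gH' ab' GHl' GHr' bu' su' bvb' svb' dP cp pP pm pl.
  by exists M => lam x l0 l1; rewrite -(opprK x); exact: MP.
- move=> v [_ sv vE] vu x e e0; rewrite -(opprK x).
  apply: (caseII_lower gG' gH' GHl' GHr' bu' su' buH' suH' limH' dP cp pP pl eta0 h00 st (refl_sub sv)) => //.
    by move=> y /refl_Eset; exact: vE.
  by move=> y yb; apply: vu; lra.
- apply: filterS (caseII_left gG' gH' GHl' bu' su' buH' suH' bvb' svb' dP cp pP pm pl eta0 h00 st) => lam h x xb.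
  by have := h (- x); rewrite /u' /uH' opprK; apply; lra.
Qed.

Lemma conclusionII :
  [/\ {family compact, u lam @[lam --> 0^'+] --> ustar u},
      \int[lebesgue_measure]_(x in `[0, 1]) p_plus H x = 0 ->
      is_pointwise_sup (ustar u) [set v | Sb_minus G v /\ forall x, x < a -> v x <= u0H x],
      \int[lebesgue_measure]_(x in `[0, 1]) p_minus H x = 0 ->
      is_pointwise_sup (ustar u) [set v | Sb_minus G v /\ forall x, b < x -> v x <= u0H x] &
      bounded_fun (ustar u)].
Proof.
have cp : continuous pp := pp_cont gH cf.
have cr : continuous pr := pp_cont (refl_good gH) (refl_c_free gH cf).
have [P dP] := primitive cp; have [Pr dPr] := primitive cr.
have IA : \int[lebesgue_measure]_(x in `[0, 1]) p_plus H x = P 1 - P 0 by exact: prim_integral.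
have IB : \int[lebesgue_measure]_(x in `[0, 1]) p_minus H x = - (Pr 1 - Pr 0).
  have dQ : has_deriv (fun x => Pr (- x)) (p_minus H).
    move=> x; have H2 : is_derive x (1:R) (fun x : R => - x) (- 1) by apply: is_derive_eq.
    have := @is_derive1_comp R Pr (fun x : R => - x) x _ _ (dPr (- x)) H2.
    by rewrite mulrN1 p_minusE.
  have cQ : continuous (p_minus H).
    have -> : p_minus H = fun x => - pr (- x) by apply/funext => x; exact: p_minusE.
    by move=> x; apply: cvgN; exact: (contN cr).
  rewrite (prim_integral dQ cQ) oppr0.
  have := prim_increment dPr (pp_periodic _ (refl_periodic pH)) (-1) 0.
  by rewrite addNr add0r => <-; rewrite opprB.
(* Convergence and boundedness do not wait for an integral hypothesis: one of the two increments
   vanishes anyway. *)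
have [|cv bs] : P 1 = P 0 \/ Pr 1 = Pr 0 -> {family compact, u lam @[lam --> 0^'+] --> ustar u} /\ bounded_fun (ustar u).
- by case=> h; [have [cv _ bs] := conclusionIIA dP h|have [cv _ bs] := conclusionIIB dPr h].
- exact: (zero_rotation gH pH cf dP dPr).
split=> //.
- rewrite IA => h; have P10 : P 1 = P 0 by lra.
  by have [_ sp _] := conclusionIIA dP P10.
- rewrite IB => h; have P10 : Pr 1 = Pr 0 by lra.
  by have [_ sp _] := conclusionIIB dPr P10.
Qed.

End CaseIIConclusion.
End Conclusions.

Lemma uniform_pointwise (R : realType) (u : R -> R -> R) (u0 : R -> R) :
  {uniform, u lam @[lam --> 0^'+] --> u0} ->
  forall x e, 0 < e -> \forall lam \near 0^'+, `|u lam x - u0 x| <= e.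
Proof.
move=> cu x e e0.
have : nbhs (u0 : {uniform R -> R}) [set g : R -> R | forall y, setT y -> ball (u0 y) e (g y)].
  by apply/uniform_nbhs; exists [set z | ball z.1 e z.2]; split=> //; exact: entourage_ball (PosNum e0).
move=> /cu h; have {}h : \forall lam \near 0^'+, forall y, setT y -> ball (u0 y) e (u lam y) by exact: h.
apply: filterS h => lam /(_ x I); rewrite /ball /= => h.
by rewrite distrC ltW.
Qed.

Unset Implicit Arguments.

Theorem theorem2 (R : realType) (H : R -> R -> R) (V : R -> R)
    (uH uG : R -> R -> R) (u0H : R -> R)
    (G := sub_potential H V) :
  admissible H ->
  continuous V -> compact (supp V) ->
  discounted_family H uH ->
  {uniform, uH lam @[lam --> 0^'+] --> u0H} ->
  discounted_family G uG ->
  (c_bounded G = c_bounded H -> c_bounded H = c_free H -> condU H u0H) ->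
  exists u0G : R -> R,
    {family compact, uG lam @[lam --> 0^'+] --> u0G} /\
    [/\
      (* (I) *)
      c_bounded H < c_bounded G ->
      [/\ c_bounded G = c_free G,
          is_pointwise_sup u0G (Sb_minus G),
          u0G x @[x --> +oo] --> +oo &
          u0G x @[x --> -oo] --> +oo],
      (* (II) *)
      c_bounded G = c_bounded H -> c_free H < c_bounded H ->
      (exists x, V x != 0) ->
      [/\ \int[lebesgue_measure]_(x in `[0, 1]) p_plus H x = 0 ->
          is_pointwise_sup u0G
            [set v | Sb_minus G v /\ forall x, x < inf (supp V) -> v x <= u0H x],
          \int[lebesgue_measure]_(x in `[0, 1]) p_minus H x = 0 ->
          is_pointwise_sup u0G
            [set v | Sb_minus G v /\ forall x, sup (supp V) < x -> v x <= u0H x] &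
          bounded_fun u0G] &
      (* (III) *)
      c_bounded G = c_bounded H -> c_bounded H = c_free H ->
      [/\ c_bounded G = c_free G,
          is_pointwise_sup u0G (Sb_minus G) &
          bounded_fun u0G]].
Proof.
move=> admH cV cs famH cuH famG U.
have gH := admissible_good admH; have gG : good G := potential_good gH cV cs.
have pH x : H (x + 1) = H x by apply/funext => p; case: admH => _ h _ _; exact: h.
have [a [b [ab Va Vb Vab]]] := supp_interval cV cs.
have GV x : V x = 0 -> G x = H x.
  by move=> Vx; apply/funext => p; rewrite /G /sub_potential Vx subr0.
have GHl x (xa : x <= a) := GV x (Va x xa).
have GHr x (xb : b <= x) := GV x (Vb x xb).
have limH := uniform_pointwise cuH.
exists (ustar uG).
have [lt|ge] := ltP (c_bounded H) (c_bounded G).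
  have [cv c1] := conclusionI gG gH pH ab GHl GHr famG lt.
  by split=> //; split=> [//|eq|eq]; rewrite eq ltxx in lt.
have cE : c_bounded G = c_bounded H.
  by apply/eqP; rewrite eq_le ge (c_bounded_perturb_ge gG gH pH GHl GHr).
have [cf|cf] := ltP (c_free H) (c_bounded H).
  have [cv cA cB bs] := conclusionII gG gH pH ab GHl GHr famG famH limH cE cf.
  split=> //; split=> [//|_ _ /Vab[<- <-] //|_ eq].
  by move: cf; rewrite eq ltxx.
have cfE : c_bounded H = c_free H by apply/eqP; rewrite eq_le cf (c_free_le_bounded gH).
have [cv cG sp bs] := conclusionIII gG gH pH ab GHl GHr famG famH limH cE cfE (U cE cfE).
by split=> //; split.
Qed.
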